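(* (Jacobi identity) In any logarithmic vertex algebra $V$ with braiding map $\mathcal S$, we have the following identity on $V^{\otimes3}$: $$\iota_{z_1,z_2}Y(z_1)(I\otimes Y(z_2))\delta_{\mathcal S_{12}}(z_3,z_{12})-\iota_{z_2,z_1}Y(z_2)(I\otimes Y(z_1))\delta_{\mathcal S_{12}}(z_3,z_{12})(P\otimes I)$$ $$=\iota_{z_1,z_3}Y(z_2)(Y(z_3)\otimes I)\delta_{\mathcal S_{13}}(z_{13},z_2).$$
   Context: Conventions. All superspaces, tensor products and Hom's are over $\mathbb C$; $p(v)$ is the parity; formulas with $p$ are for homogeneous elements, extended linearly. $(\phi\otimes\psi)(a\otimes b)=(-1)^{p(\psi)p(a)}\phi(a)\otimes\psi(b)$; $[\cdot,\cdot]$ is the supercommutator; $P(a\otimes b)=(-1)^{p(a)p(b)}b\otimes a$; $I$ is the identity. $z,z_1,z_2,z_3$, $\zeta,\zeta_1,\zeta_2,\zeta_3,\zeta_{ij}$ are commuting even formal variables ($\zeta_i$ plays the role of $\log z_i$, $\zeta_{ij}=\zeta_{ji}$ of $\log|z_{ij}|$). $D_z=\partial_z+z^{-1}\partial_\zeta$, $z_{ij}=z_i-z_j$, $\vartheta_{12}=\zeta_1-\sum_{n\ge1}\frac1n z_1^{-n}z_2^n$, $\vartheta_{21}=\zeta_2-\sum_{n\ge1}\frac1n z_1^{n}z_2^{-n}$. $\mathrm{LF}(V)=\mathrm{Hom}(V,V(\!(z)\!)[\zeta])$ with its natural superspace structure. Braiding map. A braiding map on $V$ is an even element $\mathcal S\in\mathrm{End}(V)\otimes\mathrm{End}(V)$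 with $\mathcal SP=P\mathcal S$ and $[\mathcal S_{12},\mathcal S_{23}]=[\mathcal S_{13},\mathcal S_{23}]=[\mathcal S_{12},\mathcal S_{13}]=0$ on $V^{\otimes3}$, where $\mathcal S_{12}=\mathcal S\otimes I$, $\mathcal S_{23}=I\otimes\mathcal S$, $\mathcal S_{13}=(I\otimes P)\mathcal S_{12}(I\otimes P)$. Logarithmic vertex algebra (logVA) $(V,\boldsymbol1,T,Y,\mathcal S)$: a superspace $V$, an even vector $\boldsymbol1$, an even $T\in\mathrm{End}(V)$, an even linear map $Y:V\to\mathrm{LF}(V)$, $a\mapsto Y(a,z)$, and a braiding map $\mathcal S$ on $V$ such that, with $Y(z)(a\otimes b):=Y(a,z)b$: (vacuum) $Y(\boldsymbol1,z)=I$, $Y(a,z)\boldsymbol1\in V[\![z]\!]$, $Y(a,z)\boldsymbol1|_{z=0}=a$, $T\boldsymbol1=0$; (covariance) $[T,Y(a,z)]=D_zY(a,z)$; (nilpotence) $\mathcal S$ is locally nilpotent on $V\otimes V$; (locality) for all $a,b\in V$ there is $N\in\mathbb Z_+$ such that for all $c\in V$, $Y(z_1)(I\otimes Y(z_2))z_{12}^Ne^{\vartheta_{12}\mathcal S_{12}}(a\otimes b\otimes c)=(-1)^{p(a)p(b)}Y(z_2)(I\otimes Y(z_1))z_{12}^Ne^{\vartheta_{21}\mathcal S_{12}}(b\otimes a\otimes c)$; (hexagon) $\mathcal S(Y(z)\otimes I)=(Y(z)\otimes I)(\mathcal S_{13}+\mathcal S_{23})$ on $V^{\otimes3}$. Delta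 functions and expansions. For a locally nilpotent operator $\mathcal N$, $\delta_{\mathcal N}(x,y)=\bigl(\sum_{n\in\mathbb Z}x^{-n-1}y^n\bigr)e^{(\log y-\log x)\mathcal N}$, where the formal logarithms are: $\log z_i\to\zeta_i$, $\log z_{ij}\to\zeta_{ij}$. Thus $\delta_{\mathcal S_{12}}(z_3,z_{12})=\sum_nz_3^{-n-1}z_{12}^ne^{(\zeta_{12}-\zeta_3)\mathcal S_{12}}$ and $\delta_{\mathcal S_{13}}(z_{13},z_2)=\sum_nz_{13}^{-n-1}z_2^ne^{(\zeta_2-\zeta_{13})\mathcal S_{13}}$. The maps $\iota$ fix $z_i^{\pm1},\zeta_i$; $\iota_{z_1,z_2}$ expands powers of $z_{12}$ in $|z_1|>|z_2|$ and sends $\zeta_{12}\mapsto\vartheta_{12}$; $\iota_{z_2,z_1}$ expands powers of $z_{12}$ in $|z_2|>|z_1|$ and sends $\zeta_{12}\mapsto\vartheta_{21}$; $\iota_{z_1,z_3}$ expands powers of $z_{13}$ in $|z_1|>|z_3|$ and sends $\zeta_{13}\mapsto\zeta_1-\sum_{j\ge1}\frac1jz_1^{-j}z_3^j$. *)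

(* Defs.v *)
From HB Require Import structures.
From mathcomp Require Import all_boot all_order all_algebra generic_quotient.
From mathcomp Require Import sesquilinear.
From mathcomp Require Import all_classical all_reals.
From mathcomp Require Import complex.

Set Implicit Arguments.
Unset Strict Implicit.
Unset Printing Implicit Defensive.

Import GRing.Theory.
Local Open Scope quotient_scope.
Local Open Scope ring_scope.

Definition Hom (K : fieldType) (U W : lmodType K) := {linear U -> W}.

Section HomTheory.
Variables (K : fieldType) (U W : lmodType K).
Local Notation hom := (Hom U W).

HB.instance Definition _ := gen_eqMixin hom.
HB.instance Definition _ := gen_choiceMixin hom.

Lemma homP (f g : hom) : (forall u, f u = g u) -> f = g.
Proof.
case: f g => f [[f1] [f2]] [g [[g1] [g2]]] /= fg.
have {}fg : f = g by apply/funext.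
by subst g; rewrite (Prop_irrelevance f1 g1) (Prop_irrelevance f2 g2).
Qed.

Definition hom_zero : hom := \0 : {linear U -> W}.
Definition hom_opp (f : hom) : hom := \- f : {linear U -> W}.
Definition hom_add (f g : hom) : hom := f \+ g : {linear U -> W}.
Definition hom_scale (c : K) (f : hom) : hom := c \*: f : {linear U -> W}.

Lemma hom_addA : associative hom_add.
Proof. by move=> f g h; apply: homP => u /=; rewrite addrA. Qed.
Lemma hom_addC : commutative hom_add.
Proof. by move=> f g; apply: homP => u /=; rewrite addrC. Qed.
Lemma hom_add0 : left_id hom_zero hom_add.
Proof. by move=> f; apply: homP => u /=; rewrite add0r. Qed.
Lemma hom_addN : left_inverse hom_zero hom_opp hom_add.
Proof. by move=> f; apply: homP => u /=; rewrite addNr. Qed.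

HB.instance Definition _ :=
  GRing.isZmodule.Build hom hom_addA hom_addC hom_add0 hom_addN.

Lemma hom_scaleA c d (f : hom) :
  hom_scale c (hom_scale d f) = hom_scale (c * d) f.
Proof. by apply: homP => u /=; rewrite scalerA. Qed.
Lemma hom_scale1 : left_id 1 hom_scale.
Proof. by move=> f; apply: homP => u /=; rewrite scale1r. Qed.
Lemma hom_scaleDr : right_distributive hom_scale +%R.
Proof. by move=> c f g; apply: homP => u /=; rewrite scalerDr. Qed.
Lemma hom_scaleDl f : {morph hom_scale^~ f : c d / c + d}.
Proof. by move=> c d; apply: homP => u /=; rewrite scalerDl. Qed.

HB.instance Definition _ := GRing.Zmodule_isLmodule.Build K hom
  hom_scaleA hom_scale1 hom_scaleDr hom_scaleDl.

Lemma homD (f g : hom) u : (f + g) u = f u + g u. Proof. by []. Qed.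
Lemma homZ c (f : hom) u : (c *: f) u = c *: f u. Proof. by []. Qed.
Lemma hom0 u : (0 : hom) u = 0. Proof. by []. Qed.
Lemma hom_sum I (r : seq I) (P : pred I) (F : I -> hom) u :
  (\sum_(i <- r | P i) F i) u = \sum_(i <- r | P i) F i u.
Proof. by elim/big_rec2: _ => // i y1 y2 _ <-. Qed.
End HomTheory.

Section Tensor.
Variables (K : fieldType) (U W : lmodType K).

(* A tensor is a class of finite lists [:: (u_1, w_1); ...; (u_n, w_n)],
   standing for \sum_i u_i (x) w_i; two lists are identified when no bilinear
   map separates them. *)
Definition tsum (X : lmodType K) (f : U -> W -> X) (s : seq (U * W)) : X :=
  \sum_(p <- s) f p.1 p.2.

Definition teq (s t : seq (U * W)) : bool :=
  `[< forall (X : lmodType K) (f : {bilinear U -> W -> X}),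
        tsum f s = tsum f t >].

Lemma teq_refl : reflexive teq.
Proof. by move=> s; apply/asboolP. Qed.
Lemma teq_sym : symmetric teq.
Proof. by move=> s t; apply/asboolP/asboolP => H X f; rewrite H. Qed.
Lemma teq_trans : transitive teq.
Proof.
by move=> t s r /asboolP st /asboolP tr; apply/asboolP => X f; rewrite st tr.
Qed.

Canonical teq_equiv := EquivRel teq teq_refl teq_sym teq_trans.
Definition tensor := {eq_quot teq_equiv}.

HB.instance Definition _ := Choice.on tensor.
HB.instance Definition _ := EqQuotient.on tensor.

Definition tclass (s : seq (U * W)) : tensor := \pi s.

Lemma tclassP s t : reflect
  (forall (X : lmodType K) (f : {bilinear U -> W -> X}), tsum f s = tsum f t)
  (tclass s == tclass t).
Proof. by rewrite /tclass piE; apply: asboolP. Qed.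

Lemma tsum_repr (X : lmodType K) (f : {bilinear U -> W -> X}) s :
  tsum f (repr (tclass s)) = tsum f s.
Proof. by apply: (tclassP _ _ _); rewrite /tclass reprK. Qed.

Lemma tclass_repr (x : tensor) : tclass (repr x) = x. Proof. exact: reprK. Qed.

Definition sscale (c : K) (s : seq (U * W)) := [seq (c *: p.1, p.2) | p <- s].

Definition tadd (x y : tensor) := tclass (repr x ++ repr y).
Definition tscale (c : K) (x : tensor) := tclass (sscale c (repr x)).
Definition topp := tscale (-1).
Definition tzero := tclass [::].

Section TsumTheory.
Variables (X : lmodType K) (f : {bilinear U -> W -> X}).
Lemma tsum_cat s t : tsum f (s ++ t) = tsum f s + tsum f t.
Proof. exact: big_cat. Qed.
Lemma tsum_sscale c s : tsum f (sscale c s) = c *: tsum f s.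
Proof.
rewrite /tsum big_map scaler_sumr; apply: eq_bigr => p _ /=.
by rewrite linearZl_LR.
Qed.
Lemma tsum_nil : tsum f [::] = 0. Proof. exact: big_nil. Qed.
Lemma tsum_add (x y : tensor) : tsum f (repr (tadd x y)) = tsum f (repr x) + tsum f (repr y).
Proof. by rewrite tsum_repr tsum_cat. Qed.
Lemma tsum_scale c (x : tensor) : tsum f (repr (tscale c x)) = c *: tsum f (repr x).
Proof. by rewrite tsum_repr tsum_sscale. Qed.
Lemma tsum_zero : tsum f (repr tzero) = 0.
Proof. by rewrite tsum_repr tsum_nil. Qed.
End TsumTheory.

Lemma tensorP (x y : tensor) :
  (forall (X : lmodType K) (f : {bilinear U -> W -> X}),
     tsum f (repr x) = tsum f (repr y)) -> x = y.
Proof. by move=> /tclassP/eqP; rewrite !tclass_repr. Qed.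

Lemma taddA : associative tadd.
Proof. by move=> x y z; apply: tensorP => X f; rewrite !tsum_add addrA. Qed.
Lemma taddC : commutative tadd.
Proof. by move=> x y; apply: tensorP => X f; rewrite !tsum_add addrC. Qed.
Lemma tadd0 : left_id tzero tadd.
Proof. by move=> x; apply: tensorP => X f; rewrite tsum_add tsum_zero add0r. Qed.
Lemma taddN : left_inverse tzero topp tadd.
Proof.
move=> x; apply: tensorP => X f.
by rewrite tsum_add tsum_scale tsum_zero scaleN1r addNr.
Qed.

HB.instance Definition _ := GRing.isZmodule.Build tensor taddA taddC tadd0 taddN.

Lemma tscaleA c d x : tscale c (tscale d x) = tscale (c * d) x.
Proof. by apply: tensorP => X f; rewrite !tsum_scale scalerA. Qed.
Lemma tscale1 : left_id 1 tscale.
Proof. by move=> x; apply: tensorP => X f; rewrite tsum_scale scale1r. Qed.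
Lemma tscaleDr : right_distributive tscale +%R.
Proof.
by move=> c x y; apply: tensorP => X f; rewrite !(tsum_add, tsum_scale) scalerDr.
Qed.
Lemma tscaleDl x : {morph tscale^~ x : c d / c + d}.
Proof.
by move=> c d; apply: tensorP => X f; rewrite !(tsum_add, tsum_scale) scalerDl.
Qed.

HB.instance Definition _ := GRing.Zmodule_isLmodule.Build K tensor
  tscaleA tscale1 tscaleDr tscaleDl.

Definition tpure (u : U) (w : W) : tensor := tclass [:: (u, w)].

Lemma tsum_pure (X : lmodType K) (f : {bilinear U -> W -> X}) u w :
  tsum f (repr (tpure u w)) = f u w.
Proof. by rewrite tsum_repr /tsum big_seq1. Qed.

Lemma tpure_bilinear :
  bilinear_for *:%R *:%R (tpure : U -> W -> tensor).
Proof.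
split=> [w|u] c x y; apply: tensorP => X f;
  rewrite !(tsum_add, tsum_scale, tsum_pure).
  by rewrite linearDl linearZl_LR.
by rewrite linearPr.
Qed.
HB.instance Definition _ := bilinear_isBilinear.Build K U W tensor
  *:%R *:%R tpure tpure_bilinear.

Lemma tclassE s : tclass s = \sum_(p <- s) tpure p.1 p.2.
Proof.
elim: s => [|p s IHs]; first by rewrite big_nil.
rewrite big_cons -IHs; apply: tensorP => X f.
by rewrite tsum_add tsum_pure !tsum_repr /tsum big_cons.
Qed.

Lemma tensor_ind (P : tensor -> Prop) : P 0 ->
  (forall u w x, P x -> P (tpure u w + x)) -> forall x, P x.
Proof.
move=> P0 PD x; rewrite -(tclass_repr x) tclassE.
by elim: (repr x) => [|p s IHs]; rewrite ?big_nil // big_cons; apply: PD.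
Qed.

Definition tlift (X : lmodType K) (f : {bilinear U -> W -> X}) (x : tensor) : X :=
  tsum f (repr x).

Lemma tlift_linear (X : lmodType K) (f : {bilinear U -> W -> X}) :
  linear (tlift f).
Proof. by move=> c x y; rewrite /tlift tsum_add tsum_scale. Qed.
HB.instance Definition _ (X : lmodType K) (f : {bilinear U -> W -> X}) :=
  GRing.isLinear.Build K tensor X *:%R (tlift f) (tlift_linear f).

Lemma tliftE (X : lmodType K) (f : {bilinear U -> W -> X}) u w :
  tlift f (tpure u w) = f u w.
Proof. exact: tsum_pure. Qed.

Lemma tensor_hom_ext (X : lmodType K) (f g : Hom tensor X) :
  (forall u w, f (tpure u w) = g (tpure u w)) -> f = g.
Proof.
move=> fg; apply: homP; elim/tensor_ind => [|u w x IHx]; first by rewrite !linear0.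
by rewrite !linearD fg IHx.
Qed.

End Tensor.

Arguments Hom {K} (U W)%_type.
Arguments tensor {K} (U W)%_type.
Arguments tpure {K U W}.
Notation "U ⊗ W" := (tensor U W) (at level 40, left associativity) : type_scope.
Notation "u ⊗ w" := (tpure u w) (at level 40, left associativity) : ring_scope.

Definition is_bilinear (K : fieldType) (U W X : lmodType K) (f : U -> W -> X) :=
  (forall c u u' w, f (c *: u + u') w = c *: f u w + f u' w) /\
  (forall c u w w', f u (c *: w + w') = c *: f u w + f u w').

Section BilinearMaps.
Variables (K : fieldType) (U W X : lmodType K) (f : U -> W -> X).
Hypothesis f_bilinear : is_bilinear f.

Definition mkbilinear : U -> W -> X := f.
Lemma mkbilinear_subproof : bilinear_for *:%R *:%R mkbilinear.
Proof.
case: f_bilinear => fl fr.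
by split=> [w|u] c x y; [exact: fl | exact: fr].
Qed.
HB.instance Definition _ := bilinear_isBilinear.Build K U W X
  *:%R *:%R mkbilinear mkbilinear_subproof.

Definition tmap : Hom (U ⊗ W) X := tlift mkbilinear.

Lemma tmapE u w : tmap (u ⊗ w) = f u w. Proof. exact: tliftE. Qed.
End BilinearMaps.

Lemma tpureP (K : fieldType) (U W : lmodType K) :
  is_bilinear (@tpure K U W).
Proof. by split=> *; rewrite (linearPl, linearPr). Qed.

Lemma tmap_param_linear (K : fieldType) (P U W X : lmodType K)
    (f : P -> U -> W -> X) (fP : forall p, is_bilinear (f p)) :
  (forall c p p' u w, f (c *: p + p') u w = c *: f p u w + f p' u w) ->
  forall c p p', tmap (fP (c *: p + p')) = c *: tmap (fP p) + tmap (fP p').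
Proof.
move=> fl c p p'; apply: tensor_hom_ext => u w.
by rewrite homD homZ !tmapE.
Qed.

Lemma eq_tmap (K : fieldType) (U W X : lmodType K)
    (f g : U -> W -> X) (fP : is_bilinear f) (gP : is_bilinear g) :
  (forall u w, f u w = g u w) -> tmap fP = tmap gP.
Proof. by move=> fg; apply: tensor_hom_ext => u w; rewrite !tmapE. Qed.

Section Associator.
Variables (K : fieldType) (U V W : lmodType K).

Lemma assoc_in_bilinear (w : W) :
  is_bilinear (fun (u : U) (v : V) => u ⊗ (v ⊗ w)).
Proof. by split=> *; rewrite ?(linearPl, linearPr). Qed.

Lemma assoc_bilinear : is_bilinear
  (fun (x : U ⊗ V) (w : W) => tmap (assoc_in_bilinear w) x).
Proof.
split=> [c x x' w|c x w w']; first by rewrite linearP.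
rewrite (tmap_param_linear assoc_in_bilinear) // => *.
by rewrite !linearPr.
Qed.

Definition assoc : Hom (U ⊗ V ⊗ W) (U ⊗ (V ⊗ W)) := tmap assoc_bilinear.

Lemma assocE u v w : assoc (u ⊗ v ⊗ w) = u ⊗ (v ⊗ w).
Proof. by rewrite /assoc !tmapE. Qed.

Lemma assocV_in_bilinear (u : U) :
  is_bilinear (fun (v : V) (w : W) => u ⊗ v ⊗ w).
Proof. by split=> *; rewrite ?(linearPl, linearPr). Qed.

Lemma assocV_bilinear : is_bilinear
  (fun (u : U) (x : V ⊗ W) => tmap (assocV_in_bilinear u) x).
Proof.
split=> [c u u' x|c u x x']; last by rewrite linearP.
rewrite (tmap_param_linear assocV_in_bilinear) // => *.
by rewrite !linearPl.
Qed.

Definition assocV : Hom (U ⊗ (V ⊗ W)) (U ⊗ V ⊗ W) := tmap assocV_bilinear.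

Lemma assocVE u v w : assocV (u ⊗ (v ⊗ w)) = u ⊗ v ⊗ w.
Proof. by rewrite /assocV !tmapE. Qed.

End Associator.

(* [part false] and [part true] are the projections of V onto its even and its
   odd subspace; p(v) = i means [part i v = v]. *)
HB.mixin Record Lmodule_isSuperspace (K : fieldType) V of GRing.Lmodule K V := {
  part : bool -> Hom V V;
  partK : forall i j v, part i (part j v) = if i == j then part j v else 0;
  part_sum : forall v, part false v + part true v = v
}.

#[short(type="superspace")]
HB.structure Definition Superspace (K : fieldType) :=
  {V of GRing.Lmodule K V & Lmodule_isSuperspace K V}.

Definition parity (K : fieldType) (V : superspace K) (v : V) (i : bool) :=
  part i v = v.

Section SuperTensor.
Variables (K : fieldType) (U W : superspace K).

Lemma tensor_part_bilinear (k : bool) : is_bilinear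
  (fun (u : U) (w : W) => \sum_(i : bool) part i u ⊗ part (i (+) k) w).
Proof.
by split=> *; rewrite scaler_sumr -big_split /=; apply: eq_bigr => i _;
  rewrite !linearP (linearPl, linearPr).
Qed.

Definition tensor_part (k : bool) : Hom (U ⊗ W) (U ⊗ W) :=
  tmap (tensor_part_bilinear k).

Lemma tensor_partE k u w :
  tensor_part k (u ⊗ w) = \sum_(i : bool) part i u ⊗ part (i (+) k) w.
Proof. exact: tmapE. Qed.

Lemma tensor_partK i j x :
  tensor_part i (tensor_part j x) = if i == j then tensor_part j x else 0.
Proof.
elim/tensor_ind: x => [|u w x IHx]; first by rewrite !linear0 if_same.
rewrite !linearD IHx; case: eqP => [<-|/eqP ij]; last first.
  rewrite addr0 tensor_partE big_bool /= linearD !tensor_partE !big_bool /=.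
  by case: i j ij {IHx} => [] [] //= _;
    rewrite !partK /= ?(linear0l, linear0r, addr0).
congr (_ + _); rewrite tensor_partE big_bool /= linearD !tensor_partE.
by rewrite !big_bool /=; case: i {IHx} => /=;
  rewrite !partK /= ?(linear0l, linear0r, addr0, add0r).
Qed.

Lemma tensor_part_sum x : tensor_part false x + tensor_part true x = x.
Proof.
elim/tensor_ind: x => [|u w x IHx]; first by rewrite !linear0 addr0.
rewrite !linearD addrACA IHx !tensor_partE !big_bool /=; congr (_ + _).
rewrite -[in RHS](part_sum u) -[in RHS](part_sum w) linearDl !linearDr.
by rewrite addrACA [X in X + _]addrC -addrA [X in _ + X]addrC addrA addrAC addrC.
Qed.

HB.instance Definition _ := Lmodule_isSuperspace.Build K (U ⊗ W)%type
  tensor_partK tensor_part_sum.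
End SuperTensor.

Section SuperHom.
Variables (K : fieldType) (U W : superspace K).

(* The component of parity k of f, sending parity i to parity i + k. *)
Definition hom_part_fun (k : bool) (f : Hom U W) : Hom U W :=
  \sum_(i : bool) ((part (i (+) k) \o f \o part i : {linear U -> W}) : Hom U W).

Lemma hom_part_funE k f u :
  hom_part_fun k f u = \sum_(i : bool) part (i (+) k) (f (part i u)).
Proof. by rewrite hom_sum. Qed.

Lemma hom_part_linear k : linear (hom_part_fun k).
Proof.
move=> c f g; apply: homP => u.
rewrite homD homZ !hom_part_funE scaler_sumr -big_split.
by apply: eq_bigr => i _; rewrite homD homZ linearP.
Qed.
HB.instance Definition _ k := GRing.isLinear.Build K (Hom U W) (Hom U W) *:%R
  (hom_part_fun k) (hom_part_linear k).

Definition hom_part (k : bool) : Hom (Hom U W) (Hom U W) := hom_part_fun k.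

Lemma hom_partE k f u :
  hom_part k f u = \sum_(i : bool) part (i (+) k) (f (part i u)).
Proof. exact: hom_part_funE. Qed.

Lemma hom_partK i j f :
  hom_part i (hom_part j f) = if i == j then hom_part j f else 0.
Proof.
apply: homP => u; rewrite hom_partE big_bool !hom_partE !big_bool /=.
case: eqP => [<-|/eqP ij].
  by rewrite hom_partE big_bool /= !partK /= !linear0 addr0 add0r !partK !eqxx.
transitivity (0 : W); last by [].
rewrite !partK /= !linear0 addr0 add0r !partK.
by case: i j ij => [] [] //= _; rewrite addr0.
Qed.

Lemma hom_part_sum f : hom_part false f + hom_part true f = f.
Proof.
apply: homP => u; rewrite homD !hom_partE !big_bool /= -[in RHS](part_sum u).
by rewrite linearD addrACA !part_sum [X in X + _]addrC part_sum addrC.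
Qed.

HB.instance Definition _ := Lmodule_isSuperspace.Build K (Hom U W)
  hom_partK hom_part_sum.
End SuperHom.

Section SuperMaps.
Variable K : fieldType.

Lemma scale_swap (V : lmodType K) (a b : K) (v : V) : a *: (b *: v) = b *: (a *: v).
Proof. by rewrite !scalerA mulrC. Qed.

Section Flip.
Variables U W : superspace K.

Lemma sflip_bilinear : is_bilinear (fun (u : U) (w : W) =>
  \sum_(i : bool) \sum_(j : bool) (-1) ^+ (i && j) *: (part j w ⊗ part i u)).
Proof.
split=> *; rewrite scaler_sumr -big_split /=; apply: eq_bigr => i _;
  rewrite scaler_sumr -big_split /=; apply: eq_bigr => j _;
  by rewrite !linearP (linearPl, linearPr) scalerDr scale_swap.
Qed.

(* P (u (x) w) = (-1)^(p(u) p(w)) w (x) u *)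
Definition sflip : Hom (U ⊗ W) (W ⊗ U) := tmap sflip_bilinear.
End Flip.

Section TensorOfMaps.
Variables U U' W W' : superspace K.

Lemma stensor_in_bilinear (f : Hom U U') (g : Hom W W') : is_bilinear
  (fun (u : U) (w : W) => \sum_(i : bool) \sum_(k : bool)
     (-1) ^+ (k && i) *: (f (part i u) ⊗ part k g w)).
Proof.
split=> *; rewrite scaler_sumr -big_split /=; apply: eq_bigr => i _;
  rewrite scaler_sumr -big_split /=; apply: eq_bigr => k _;
  by rewrite !linearP (linearPl, linearPr) scalerDr scale_swap.
Qed.

(* (f (x) g) (u (x) w) = (-1)^(p(g) p(u)) f u (x) g w *)
Definition stensor (f : Hom U U') (g : Hom W W') : Hom (U ⊗ W) (U' ⊗ W') :=
  tmap (stensor_in_bilinear f g).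

Lemma stensor_bilinear : is_bilinear stensor.
Proof.
split=> [c f f' g|c f g g']; apply: tensor_hom_ext => u w;
  rewrite homD homZ !tmapE scaler_sumr -big_split; apply: eq_bigr => i _;
  rewrite scaler_sumr -big_split; apply: eq_bigr => k _ /=.
  by rewrite linearPl scalerDr scale_swap.
by rewrite linearP homD homZ linearPr scalerDr scale_swap.
Qed.

Definition tensor_act : Hom (Hom U U' ⊗ Hom W W') (Hom (U ⊗ W) (U' ⊗ W')) :=
  tmap stensor_bilinear.
End TensorOfMaps.
End SuperMaps.

Section Braiding.
Variables (K : fieldType) (V : superspace K).
Local Notation V2 := (V ⊗ V)%type.
Local Notation V3 := (V ⊗ V ⊗ V)%type.

(* V (x) V (x) V is bracketed to the left, so that I (x) f is transported
   along the associator. *)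
Definition opl (W : superspace K) (f : Hom V2 W) : Hom V3 (W ⊗ V) :=
  stensor f (idfun : {linear V -> V}).
Definition opr (W : superspace K) (f : Hom V2 W) : Hom V3 (V ⊗ W) :=
  stensor (idfun : {linear V -> V}) f \o assoc V V V : {linear V3 -> (V ⊗ W)%type}.

Definition op12 (S : Hom V2 V2) : Hom V3 V3 := opl S.
Definition op23 (S : Hom V2 V2) : Hom V3 V3 :=
  assocV V V V \o opr S : {linear V3 -> V3}.
Definition op13 (S : Hom V2 V2) : Hom V3 V3 :=
  op23 (sflip V V) \o op12 S \o op23 (sflip V V) : {linear V3 -> V3}.

Definition commuting (U : lmodType K) (f g : Hom U U) :=
  forall u, f (g u) = g (f u).

Definition locally_nilpotent (U : lmodType K) (f : Hom U U) :=
  forall u, exists n, iter n f u = 0.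

Definition braid_op (S : Hom V V ⊗ Hom V V) : Hom V2 V2 :=
  tensor_act V V V V S.

Record braiding_map (S : Hom V V ⊗ Hom V V) : Prop := {
  braiding_even : parity S false;
  braiding_flip : commuting (braid_op S) (sflip V V);
  braiding12_23 : commuting (op12 (braid_op S)) (op23 (braid_op S));
  braiding13_23 : commuting (op13 (braid_op S)) (op23 (braid_op S));
  braiding12_13 : commuting (op12 (braid_op S)) (op13 (braid_op S))
}.
End Braiding.

Local Open Scope classical_set_scope.

(* [e i = (n, k)] is the exponent of z_i ^ n zeta_i ^ k. *)
Definition expo := {ffun 'I_3 -> int * nat}.

Definition mono (i : 'I_3) (n : int) (k : nat) : expo :=
  [ffun j => if j == i then (n, k) else (0, 0%N)].

Section FormalSeries.
Variable K : fieldType.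

(* Formal series in z_1, z_2, z_3, zeta_1, zeta_2, zeta_3 are given by their
   coefficients. [\sum_(x \in A) F x] is the sum over the support of F, and 0
   if this support is infinite; the sums below have finite support whenever
   they are applied to a field Y and a locally nilpotent N. *)
Definition fscalar := expo -> K.
Definition fop (U W : lmodType K) := expo -> U -> W.

Definition splits (e : expo) : set (expo * expo) := [set p | p.1 + p.2 = e].

Definition fmul (f g : fscalar) : fscalar :=
  fun e => \sum_(p \in splits e) f p.1 * g p.2.
Definition fpow (f : fscalar) (n : nat) : fscalar :=
  iter n (fmul f) (fun e => (e == 0)%:R).
Definition fscale (U W : lmodType K) (f : fscalar) (A : fop U W) : fop U W :=
  fun e u => \sum_(p \in splits e) f p.1 *: A p.2 u.
Definition fcomp (U U' W : lmodType K) (A : fop U' W) (B : fop U U') : fop U W :=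
  fun e u => \sum_(p \in splits e) A p.1 (B p.2 u).

Definition fmono (e0 : expo) : fscalar := fun e => (e == e0)%:R.

(* \sum_(n, k) A n k z_i ^ n zeta_i ^ k *)
Definition fvar (U W : lmodType K) (i : 'I_3) (A : int -> nat -> U -> W) :
    fop U W :=
  fun e u => let: (n, k) := e i in if e == mono i n k then A n k u else 0.

(* exp(L N), for a locally nilpotent operator N *)
Definition fexp (U : lmodType K) (L : fscalar) (N : U -> U) : fop U U :=
  fun e u => \sum_(k \in [set: nat]) ((k`!%:R)^-1 * fpow L k e) *: iter k N u.

(* Binomial coefficient n(n-1)...(n-m+1)/m!; K is meant to have characteristic 0. *)
Definition binz (n : int) (m : nat) : K :=
  (\prod_(l < m) (n%:~R - l%:R)) / m`!%:R.

(* vartheta_ij = zeta_i - \sum_(n >= 1) z_i ^ -n z_j ^ n / n *)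
Definition vartheta (i j : 'I_3) : fscalar := fun e =>
  fmono (mono i 0 1) e -
  \sum_(n \in [set n : nat | (0 < n)%N])
     n%:R^-1 * fmono (mono i (- n%:Z) 0 + mono j n%:Z 0) e.

(* (z_i - z_j) ^ n, expanded in |z_i| > |z_j| *)
Definition zdiff_pow (i j : 'I_3) (n : int) : fscalar := fun e =>
  \sum_(m \in [set: nat])
     (-1) ^+ m * binz n m * fmono (mono i (n - m%:Z) 0 + mono j m%:Z 0) e.

(* A formal variable x (or its image under an expansion iota), through its
   powers x ^ n, n in Z, and its formal logarithm. *)
Record formal_var := FormalVar {
  var_pow : int -> fscalar;
  var_log : fscalar
}.

Definition zvar (i : 'I_3) : formal_var :=
  FormalVar (fun n => fmono (mono i n 0)) (fmono (mono i 0 1)).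

(* iota_{z_i, z_j} of z_ij *)
Definition iota_gt (i j : 'I_3) : formal_var :=
  FormalVar (zdiff_pow i j) (vartheta i j).

(* iota_{z_j, z_i} of z_ij = - z_ji; recall that zeta_ij = zeta_ji. *)
Definition iota_lt (i j : 'I_3) : formal_var :=
  FormalVar (fun n e => (-1) ^ n * zdiff_pow j i n e) (vartheta j i).

(* delta_N(x, y) = (\sum_(n in Z) x ^ (-n-1) y ^ n) exp((log y - log x) N) *)
Definition delta (U : lmodType K) (N : U -> U) (x y : formal_var) : fop U U :=
  fscale
    (fun e => \sum_(n \in [set: int]) fmul (var_pow x (- n - 1)) (var_pow y n) e)
    (fexp (fun e => var_log y e - var_log x e) N).
End FormalSeries.

Definition z1 : 'I_3 := @Ordinal 3 0 isT.
Definition z2 : 'I_3 := @Ordinal 3 1 isT.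
Definition z3 : 'I_3 := @Ordinal 3 2 isT.

(* Membership in V((z))[zeta] of \sum_(n, k) f n k z ^ n zeta ^ k *)
Definition log_laurent (K : fieldType) (V : lmodType K) (f : int -> nat -> V) :=
  exists (N : int) (M : nat),
    forall n k, (n < N) || (M <= k)%N -> f n k = 0.

(* D_z = d/dz + z^-1 d/dzeta *)
Definition Dz (K : fieldType) (V : lmodType K) (f : int -> nat -> V) n k : V :=
  (n + 1)%:~R *: f (n + 1) k + k.+1%:R *: f (n + 1) k.+1.

Section StateField.
Variables (K : fieldType) (V : superspace K).
Local Notation V2 := (V ⊗ V)%type.
Local Notation V3 := (V ⊗ V ⊗ V)%type.

(* [Y n k a b] is the coefficient of z ^ n zeta ^ k in Y(a, z) b. *)
Variable Y : int -> nat -> {bilinear V -> V -> V}.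

Definition Ymap n k : Hom V2 V := tlift (Y n k).

(* Y(z_i) (I (x) Y(z_j)) *)
Definition Y_IY (i j : 'I_3) : fop V3 V :=
  fcomp (fvar i Ymap) (fvar j (fun n k => opr (Ymap n k))).

(* Y(z_i) (Y(z_j) (x) I) *)
Definition Y_YI (i j : 'I_3) : fop V3 V :=
  fcomp (fvar i Ymap) (fvar j (fun n k => opl (Ymap n k))).

(* z_12 ^ N *)
Definition z12_pow (N : nat) : fscalar K :=
  fpow (fun e => fmono K (mono z1 1 0) e - fmono K (mono z2 1 0) e) N.

Definition locality (S : Hom V2 V2) :=
  forall (p q : bool) (a b : V), parity a p -> parity b q ->
  exists N : nat, forall (c : V) (e : expo),
    fcomp (Y_IY z1 z2)
      (fscale (z12_pow N) (fexp (vartheta K z1 z2) (op12 S))) e (a ⊗ b ⊗ c)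
    = (-1) ^+ (p && q) *:
      fcomp (Y_IY z2 z1)
        (fscale (z12_pow N) (fexp (vartheta K z2 z1) (op12 S))) e (b ⊗ a ⊗ c).

Definition hexagon (S : Hom V2 V2) :=
  forall n k v, S (opl (Ymap n k) v) = opl (Ymap n k) (op13 S v + op23 S v).
End StateField.

Record logVA (K : fieldType) (V : superspace K) := LogVA {
  vac : V;
  transl : Hom V V;
  modes : int -> nat -> {bilinear V -> V -> V};
  braid : Hom V V ⊗ Hom V V;

  vac_even : parity vac false;
  transl_even : parity transl false;
  modes_log_laurent : forall a b, log_laurent (fun n k => modes n k a b);
  modes_even : forall n k p q a b, parity a p -> parity b q ->
    parity (modes n k a b) (p (+) q);
  braid_braiding_map : braiding_map braid;

  vac_left : forall n k b,
    modes n k vac b = if (n == 0) && (k == 0%N) then b else 0;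
  vac_right_regular : forall n k a,
    (n < 0) || (0 < k)%N -> modes n k a vac = 0;
  vac_right : forall a, modes 0 0 a vac = a;
  transl_vac : transl vac = 0;
  covariance : forall a b n k,
    transl (modes n k a b) - modes n k a (transl b) =
    Dz (fun n' k' => modes n' k' a b) n k;
  braid_nilpotent : locally_nilpotent (braid_op braid);
  braid_locality : locality modes (braid_op braid);
  braid_hexagon : hexagon modes (braid_op braid)
}.

(* Main.v *)
(* Write X(z) for the part of Y(z) free of zeta. Locality against the vacuum gives
   Y(z) = X(z) exp (- zeta S), so by the hexagon relation all powers of the zeta_i
   in the three terms assemble into exp (- zeta_1 S13 - zeta_2 S23 - zeta_3 S12), and
   exp (vartheta_ij S) becomes a factor (1 - z_j / z_i)^S. What remains is the
   Borcherds identity for the modes of X, in which the integers in the binomial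
   coefficients are shifted by S12 and S13:
     sum_j C(m + S13, j) (a_(n+j) b)_(m+k-j) c
       = sum_j (-1)^j C(n + S12, j)
           (a_(m+n-j) (b_(k+j) c) - (-1)^n b_(n+k-j) (a_(m+j) c)).
   For large n it is locality of a and b. For large m it is weak associativity,
   which follows from locality of a and c, the skew symmetry
   X(z) = exp (z T) X(-z) P and Vandermonde's identity. The difference D of both
   sides satisfies D(m+1,k,n) = D(m,k+1,n) + D(m,k,n+1), so it vanishes always. *)

From HB Require Import structures.
From mathcomp Require Import all_boot all_order all_algebra.
From mathcomp Require Import sesquilinear.
From mathcomp Require Import all_classical all_reals.
From mathcomp Require Import complex.
From mathcomp Require Import zify ring.
Require Import Defs.

Set Implicit Arguments.
Unset Strict Implicit.
Unset Printing Implicit Defensive.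

Import Order.TTheory GRing.Theory Num.Theory.
Local Open Scope ring_scope.
Local Open Scope classical_set_scope.

(** * Binomial coefficients and divided powers of operators *)

(** Every product of series is a sum over a support, with value 0 when that support is infinite, so
    each rearrangement must be preceded by a truncation. Truncating a field on v alone does not
    suffice: the twists apply polynomials in S12 and S13 of unbounded degree to v before the field
    acts. Local nilpotence leaves only finitely many iterates of v, which gives bounds uniform in
    these operators. Weak associativity is the one place where three operators meet. Moving X past
    exp (z T) produces the exponent - (S12 + S13), the flipped twist brings n + S13, and by
    Vandermonde only S12 survives, the exponent that locality of a and c requires. The closing
    induction works because its two thresholds depend on v alone and not on k, which the recursion
    shifts. Each step of the recursion raises m + n by one, and once this sum is large one of the
    two indices has passed its threshold. *)

Section HomMaps.
Variables (K : fieldType) (U W : lmodType K) (F : Hom U W).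
Lemma mapZ c x : F (c *: x) = c *: F x. Proof. exact: linearZ. Qed.
Lemma mapD x y : F (x + y) = F x + F y. Proof. exact: linearD. Qed.
Lemma mapB x y : F (x - y) = F x - F y. Proof. exact: linearB. Qed.
Lemma mapN x : F (- x) = - F x. Proof. exact: linearN. Qed.
Lemma map0 : F 0 = 0. Proof. exact: linear0. Qed.
Lemma map_sum I (r : seq I) (P : pred I) (E : I -> U) :
  F (\sum_(i <- r | P i) E i) = \sum_(i <- r | P i) F (E i).
Proof. exact: linear_sum. Qed.
End HomMaps.

Section Operators.
Variables (K : numFieldType) (U : lmodType K).
Implicit Types F G H : Hom U U.

Lemma scalerSV n (w : U) : n.+1%:R *: (n.+1%:R^-1 *: w) = w.
Proof. by rewrite scalerA mulfV ?pnatr_eq0 // scale1r. Qed.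

Lemma scalerSI n (x y : U) : n.+1%:R *: x = n.+1%:R *: y -> x = y.
Proof. by move=> xy; rewrite -[x](scalerK (a := n.+1%:R)) ?pnatr_eq0 // xy scalerK ?pnatr_eq0. Qed.

(* F (F - 1) ... (F - t + 1) / t!, so that (1 - x)^F = sum_t (-x)^t binop F t. *)
Fixpoint binop F t w : U :=
  if t is t'.+1 then t'.+1%:R^-1 *: (F (binop F t' w) - t'%:R *: binop F t' w) else w.

Arguments binop : simpl never.
Lemma binop0 F w : binop F 0 w = w. Proof. by []. Qed.
Lemma binopSE F t w : binop F t.+1 w =
  t.+1%:R^-1 *: (F (binop F t w) - t%:R *: binop F t w).
Proof. by []. Qed.

Lemma binopS F t w :
  t.+1%:R *: binop F t.+1 w = F (binop F t w) - t%:R *: binop F t w.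
Proof. by rewrite binopSE scalerSV. Qed.

Lemma binop_linear F t : linear (binop F t).
Proof.
move=> c x y; elim: t => [//|t IHt]; rewrite !binopSE IHt.
rewrite linearP !scalerDr !scalerN !scalerDr opprD !addrA !scalerA.
rewrite -!addrA; congr (_ + _); first by rewrite mulrC.
rewrite [RHS]addrCA; congr (_ + _); congr (_ + _); rewrite -?scalerN ?scalerA.
by congr (_ *: _); ring.
Qed.
HB.instance Definition _ F t := GRing.isLinear.Build K U U *:%R
  (binop F t) (binop_linear F t).

Fixpoint dpow F k w : U :=
  if k is k'.+1 then k'.+1%:R^-1 *: F (dpow F k' w) else w.
Arguments dpow : simpl never.

Lemma dpow0 F w : dpow F 0 w = w. Proof. by []. Qed.

Lemma dpowSE F k w : dpow F k.+1 w = k.+1%:R^-1 *: F (dpow F k w).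
Proof. by []. Qed.

Lemma dpowS F k w : k.+1%:R *: dpow F k.+1 w = F (dpow F k w).
Proof. by rewrite dpowSE scalerSV. Qed.

Lemma dpow_linear F t : linear (dpow F t).
Proof.
move=> c x y; elim: t => [|t IHt]; first by rewrite !dpow0.
by rewrite !dpowSE IHt linearP scalerDr !scalerA mulrC.
Qed.
HB.instance Definition _ F t := GRing.isLinear.Build K U U *:%R
  (dpow F t) (dpow_linear F t).

Lemma binopZ F t c w : binop F t (c *: w) = c *: binop F t w.
Proof. exact: linearZ_LR. Qed.
Lemma binopDr F t x y : binop F t (x + y) = binop F t x + binop F t y.
Proof. exact: linearD. Qed.
Lemma dpowZ F t c w : dpow F t (c *: w) = c *: dpow F t w.
Proof. exact: linearZ_LR. Qed.
Lemma dpowDr F t x y : dpow F t (x + y) = dpow F t x + dpow F t y.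
Proof. exact: linearD. Qed.

(** Multiply by t + 1 = (t + 1 - l) + l. By [binopS] the first summand lowers the binomial of F and
    the second that of G, and the corrections - (t - l) and - l add up to the - t of F + G. *)
Lemma vandermonde F G t w : commuting F G ->
  \sum_(l < t.+1) binop F (t - l) (binop G l w) = binop (F + G) t w.
Proof.
move=> FG.
have comm l x : binop F l (G x) = G (binop F l x).
  elim: l => [//|l IHl]; rewrite !binopSE IHl FG.
  by rewrite (mapZ G) (mapB G) (mapZ G).
elim: t w => [|t IHt] w; first by rewrite big_ord1.
apply: (@scalerSI t); rewrite binopS -IHt.
transitivity (\sum_(l < t.+2) ((t.+1 - l)%N%:R *: binop F (t.+1 - l) (binop G l w))
   + \sum_(l < t.+2) (l%:R *: binop F (t.+1 - l) (binop G l w))).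
  rewrite scaler_sumr -big_split /=; apply: eq_bigr => l _.
  by rewrite -scalerDl -natrD subnK // -ltnS.
rewrite big_ord_recr /= subnn scale0r addr0.
rewrite [X in _ + X]big_ord_recl /= scale0r add0r -big_split /=.
rewrite (map_sum F) (map_sum G) scaler_sumr -big_split -sumrB; apply: eq_bigr => l _.
have lt : (l <= t)%N by rewrite -ltnS.
rewrite /bump /= add1n subSS subSn // binopS.
rewrite -[X in _ + X]linearZ /= binopS (raddfB (binop F _)) /= (linearZ_LR (binop F _)) /= comm.
by rewrite addrACA -opprD -scalerDl -natrD subnK.
Qed.

Lemma dpowD F G t w : commuting F G ->
  \sum_(l < t.+1) dpow F (t - l) (dpow G l w) = dpow (F + G) t w.
Proof.
move=> FG.
have comm l x : dpow F l (G x) = G (dpow F l x).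
  elim: l => [|l IHl]; first by rewrite !dpow0.
  by rewrite !dpowSE IHl FG (mapZ G).
elim: t w => [|t IHt] w; first by rewrite big_ord1 !dpow0.
apply: (@scalerSI t); rewrite dpowS -IHt.
transitivity (\sum_(l < t.+2) ((t.+1 - l)%N%:R *: dpow F (t.+1 - l) (dpow G l w))
   + \sum_(l < t.+2) (l%:R *: dpow F (t.+1 - l) (dpow G l w))).
  rewrite scaler_sumr -big_split /=; apply: eq_bigr => l _.
  by rewrite -scalerDl -natrD subnK // -ltnS.
rewrite big_ord_recr /= subnn scale0r addr0.
rewrite [X in _ + X]big_ord_recl /= scale0r add0r -big_split /=.
rewrite (map_sum F) (map_sum G) -big_split; apply: eq_bigr => l _.
have lt : (l <= t)%N by rewrite -ltnS.
rewrite /bump /= add1n subSS subSn // dpowS.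
by rewrite -[X in _ + X]linearZ /= dpowS comm.
Qed.
End Operators.
Arguments binop {K U} F t w : simpl never.
Arguments dpow {K U} F k w : simpl never.

Section MoreOperators.
Variables (K : numFieldType).

Definition id_hom (U : lmodType K) : Hom U U := idfun : {linear U -> U}.

Lemma commuting_id (U : lmodType K) (F : Hom U U) c : commuting F (c *: id_hom U).
Proof. by move=> u; rewrite homZ (mapZ F). Qed.

Lemma binop_intertwine (U W : lmodType K) (h : Hom U W) (F : Hom U U)
    (G : Hom W W) t w :
  (forall u, h (F u) = G (h u)) -> h (binop F t w) = binop G t (h w).
Proof.
move=> hF; elim: t => [//|t IHt].
by rewrite !binopSE (mapZ h) (mapB h) hF (mapZ h) IHt.
Qed.

Lemma dpow_intertwine (U W : lmodType K) (h : Hom U W) (F : Hom U U)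
    (G : Hom W W) t w :
  (forall u, h (F u) = G (h u)) -> h (dpow F t w) = dpow G t (h w).
Proof.
move=> hF; elim: t => [|t IHt]; first by rewrite !dpow0.
by rewrite !dpowSE (mapZ h) hF IHt.
Qed.

Variables (U : lmodType K).
Implicit Types F : Hom U U.

Lemma binop_id t (w : U) : binop (id_hom U) t.+2 w = 0.
Proof.
elim: t => [|t IHt]; last by rewrite binopSE IHt map0 !(scaler0, subr0).
by rewrite !binopSE !binop0 scale0r subr0 invr1 !scale1r subrr scaler0.
Qed.

Lemma binop_pascal F t (w : U) :
  binop (F + id_hom U) t.+1 w = binop F t.+1 w + binop F t w.
Proof.
rewrite -vandermonde; last by rewrite -[id_hom U]scale1r; apply: commuting_id.
rewrite 2!big_ord_recl big1 => [|l _]; last by rewrite /= binop_id linear0.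
rewrite addr0 /= binop0 subSS subn0 [binop (id_hom U) _ w]binopSE binop0.
by rewrite scale0r subr0 invr1 scale1r subn0.
Qed.

(** Scalar binomials become operator binomials, so that [vandermonde] can merge a power of z_ij with
    the exponential of a logarithm. *)
Lemma binz_binop (n : int) t (w : U) :
  binz K n t *: w = binop (n%:~R *: id_hom U) t w.
Proof.
elim: t w => [|t IHt] w; first by rewrite /binz big_ord0 divr1 scale1r.
rewrite binopSE -IHt homZ /= -scalerBl scalerA scalerA; congr (_ *: _).
rewrite /binz big_ord_recr factS natrM invfM /=; ring.
Qed.
End MoreOperators.

Section BinomialCoefficients.
Variables (K : numFieldType) (n : int).

Lemma binzS (p : int) m : m.+1%:R * binz K p m.+1 = (p%:~R - m%:R) * binz K p m.
Proof.
rewrite /binz big_ord_recr factS natrM /=; field.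
by rewrite ?nat1r ?natr1 !pnatr_eq0 -lt0n fact_gt0.
Qed.

Lemma binz_pascal m : binz K (n + 1) m.+1 = binz K n m.+1 + binz K n m.
Proof.
have S0 (p : int) t : binz K p t.+1 = (p%:~R - t%:R) * binz K p t / t.+1%:R.
  rewrite -binzS. by rewrite mulrAC mulfV ?mul1r // pnatr_eq0.
elim: m => [|m IHm].
  by rewrite /binz !big_ord1 big_ord0 !divr1 intrD !subr0.
rewrite S0 IHm ![binz K n _.+1]S0 intrD; field.
by rewrite ?nat1r ?natr1 ?pnatr_eq0 // -natrD pnatr_eq0.
Qed.

Lemma binz0 m : binz K 0 m.+1 = 0.
Proof. by rewrite /binz big_ord_recl subrr !mul0r. Qed.
End BinomialCoefficients.

(** The list only has to contain the support; its surplus terms may vanish. *)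
Lemma fsum_seq (T : choiceType) (W : nmodType) (A : set T) (r : seq T) (f : T -> W) :
  uniq r -> (forall x, x \in r -> A x) -> (forall x, A x -> f x != 0 -> x \in r) ->
  \sum_(x \in A) f x = \sum_(x <- r) f x.
Proof.
move=> ur rA fr; rewrite (fsbigE r) //; last first.
  by move=> x Ax; apply: contraNeq; apply: fr.
rewrite big_seq_cond [RHS]big_seq; apply: eq_bigl => x.
by case: (boolP (x \in r)) => //= /rA Ax; rewrite mem_set.
Qed.

(** * Exponents and finite sums *)

Section Exponents.
Implicit Types (e p q : expo).

Lemma pairD (p q : int) (a b : nat) : (p, a) + (q, b) = (p + q, (a + b)%N).
Proof. by []. Qed.

Lemma monoE i n k l : mono i n k l = if l == i then (n, k) else (0, 0%N).
Proof. exact: ffunE. Qed.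

Lemma expoDE e e' l : (e + e') l = e l + e' l.
Proof. exact: ffunE. Qed.

(* Truncated in the exponents of the zeta_l: [esub e q] is the complement of
   [q] in [e] only if [q + esub e q == e]. *)
Definition esub e q : expo :=
  [ffun l => ((e l).1 - (q l).1, ((e l).2 - (q l).2)%N)].

Lemma esub_addl p q : esub (p + q) p = q.
Proof.
apply/ffunP => l; rewrite ffunE expoDE; case: (p l) (q l) => [x a] [y b].
by rewrite pairD /= addrC addKr addKn.
Qed.

(** An exponent splits in infinitely many ways, but p determines q, so a list of possible first
    components is enough. The filter discards those p for which the subtraction in [esub] was
    truncated. *)
Lemma splits_sum (W : zmodType) (s : seq expo) e (H : expo -> expo -> W) :
  uniq s -> (forall p q, p + q = e -> H p q != 0 -> p \in s) ->
  \sum_(p \in splits e) H p.1 p.2 =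
  \sum_(p <- s | p + esub e p == e) H p (esub e p).
Proof.
move=> us Hs.
transitivity (\sum_(p <- [seq (p, esub e p) | p <- s & p + esub e p == e]) H p.1 p.2);
  last by rewrite big_map big_filter.
apply: fsum_seq.
- by rewrite map_inj_uniq ?filter_uniq // => p q [].
- by move=> x /= /mapP[p]; rewrite mem_filter => /andP[/eqP ? _] ->.
- move=> [p q] /= pq; move/(Hs _ _ pq) => ps.
  have qE : q = esub e p by rewrite -pq esub_addl.
  apply/mapP; exists p; last by rewrite qE.
  by rewrite mem_filter ps andbT -qE pq.
Qed.

Lemma splits_sumr (W : zmodType) (s : seq expo) e (H : expo -> expo -> W) :
  uniq s -> (forall p q, p + q = e -> H p q != 0 -> q \in s) ->
  \sum_(p \in splits e) H p.1 p.2 =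
  \sum_(q <- s | esub e q + q == e) H (esub e q) q.
Proof.
move=> us Hs.
transitivity (\sum_(p <- [seq (esub e q, q) | q <- s & esub e q + q == e]) H p.1 p.2);
  last by rewrite big_map big_filter.
apply: fsum_seq.
- by rewrite map_inj_uniq ?filter_uniq // => p q [].
- by move=> x /= /mapP[q]; rewrite mem_filter => /andP[/eqP ? _] ->.
- move=> [p q] /= pq; move/(Hs _ _ pq) => qs.
  have pE : p = esub e q by rewrite -pq addrC esub_addl.
  apply/mapP; exists q; last by rewrite pE.
  by rewrite mem_filter qs andbT -pE pq.
Qed.

Variables i j k : 'I_3.
Hypotheses (ij : i != j) (ik : i != k) (jk : j != k).

Lemma ord3_split (P : 'I_3 -> Prop) : P i -> P j -> P k -> forall l, P l.
Proof.
move=> Pi Pj Pk l.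
have : l \in [set i; j; k]%SET.
  rewrite (_ : [set i; j; k]%SET = [set: 'I_3]%SET) ?finset.in_setT //.
  apply/eqP; rewrite eqEcard finset.subsetT cardsT card_ord.
  by rewrite finset.setUC cardsU1 cards2 !inE negb_or ![k == _]eq_sym ij ik jk.
by rewrite !inE => /orP[/orP[]|] /eqP ->.
Qed.

(** Exponents are addressed by role: (i, j, k) will be (1, 2, 3), (2, 1, 3) and (1, 3, 2) for the
    three terms of the identity, where z_ij is the expanded difference and z_k the remaining
    variable. *)
Definition texpo x a y b z c : expo := mono i x a + mono j y b + mono k z c.

Lemma texpoi x a y b z c : texpo x a y b z c i = (x, a).
Proof.
by rewrite !expoDE !monoE eqxx (negPf ij) (negPf ik) !pairD !addr0 !addn0.
Qed.
Lemma texpoj x a y b z c : texpo x a y b z c j = (y, b).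
Proof.
rewrite !expoDE !monoE eqxx eq_sym (negPf ij) (negPf jk).
by rewrite !pairD addr0 add0r addn0.
Qed.
Lemma texpok x a y b z c : texpo x a y b z c k = (z, c).
Proof.
rewrite !expoDE !monoE eqxx ![k == _]eq_sym (negPf ik) (negPf jk).
by rewrite !pairD !add0r.
Qed.

Definition texpoE := (texpoi, texpoj, texpok).

Lemma expoP e e' : e i = e' i -> e j = e' j -> e k = e' k -> e = e'.
Proof. by move=> ei ej ek; apply/ffunP; apply: ord3_split. Qed.

Lemma texpo_eta e : e = texpo (e i).1 (e i).2 (e j).1 (e j).2 (e k).1 (e k).2.
Proof. by apply: expoP; rewrite texpoE -surjective_pairing. Qed.

Lemma texpo_inj x a y b z c x' a' y' b' z' c' :
  texpo x a y b z c = texpo x' a' y' b' z' c' ->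
  [/\ x = x', y = y' & z = z'] /\ [/\ a = a', b = b' & c = c'].
Proof.
move=> E; move: (congr1 (fun f : expo => f i) E) (congr1 (fun f : expo => f j) E)
  (congr1 (fun f : expo => f k) E).
by rewrite !texpoE => -[-> ->] [-> ->] [-> ->].
Qed.

Lemma texpoD x a y b z c x' a' y' b' z' c' :
  texpo x a y b z c + texpo x' a' y' b' z' c' =
  texpo (x + x') (a + a') (y + y') (b + b') (z + z') (c + c').
Proof. by apply: expoP; rewrite !(texpoE, expoDE). Qed.

Lemma esub_texpo x a y b z c x' a' y' b' z' c' :
  esub (texpo x a y b z c) (texpo x' a' y' b' z' c') =
  texpo (x - x') (a - a') (y - y') (b - b') (z - z') (c - c').
Proof. by apply: expoP; rewrite ?[LHS]ffunE !texpoE. Qed.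

Lemma monoiE n l : mono i n l = texpo n l 0 0%N 0 0%N.
Proof. by apply: expoP; rewrite texpoE monoE ?eqxx // eq_sym ?(negPf ij) ?(negPf ik). Qed.
Lemma monojE n l : mono j n l = texpo 0 0%N n l 0 0%N.
Proof. by apply: expoP; rewrite texpoE monoE ?eqxx // ?(negPf ij) // eq_sym (negPf jk). Qed.
Lemma monokE n l : mono k n l = texpo 0 0%N 0 0%N n l.
Proof. by apply: expoP; rewrite texpoE monoE ?eqxx // ?(negPf ik) ?(negPf jk). Qed.
End Exponents.

(** * Expansion of powers and exponentials of formal logarithms *)

Section LogCoefficients.
Variables (K : numFieldType) (s : K).

(* The coefficient of t^x in (s log (1 - t))^d / d!. *)
Fixpoint log_coef (d x : nat) : K :=
  if d is d'.+1 then
    - (s / d'.+1%:R) * \sum_(n < x) n.+1%:R^-1 * log_coef d' (x - n.+1)%N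
  else (x == 0%N)%:R.

Lemma log_coefS d x : d.+1%:R * log_coef d.+1 x =
  - s * \sum_(n < x) n.+1%:R^-1 * log_coef d (x - n.+1)%N.
Proof.
rewrite /= mulNr mulrN mulNr mulrA mulrCA mulfV ?mulr1 //.
by rewrite pnatr_eq0.
Qed.

(** Grouping by w = n + 1 + y: taking partial sums, which is division by 1 - t, commutes with the
    convolution. *)
Lemma exchange_triangle (f g : nat -> K) x :
  \sum_(n < x) f n * (\sum_(y < (x - n.+1)%N) g y) =
  \sum_(w < x) \sum_(n < w) f n * g (w - n.+1)%N.
Proof.
elim: x => [|x IHx]; first by rewrite !big_ord0.
rewrite big_ord_recr [RHS]big_ord_recr /= subnn big_ord0 mulr0 addr0 -IHx.
rewrite -big_split /=; apply: eq_bigr => n _.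
by rewrite subSn // big_ord_recr mulrDr.
Qed.

(* The Euler operator t d/dt sends (s log (1 - t))^(d+1) / (d+1)! to
   - s t / (1 - t) times (s log (1 - t))^d / d!. *)
Lemma log_coef_euler d x :
  x%:R * log_coef d.+1 x = - s * \sum_(y < x) log_coef d y.
Proof.
(* The splitting x = (x - n - 1) + (n + 1) is the Leibniz rule for t d/dt on a product of one factor
   log (1 - t) and the remaining power. *)
move: d x; have step d' x : d'.+1%:R * (x%:R * log_coef d'.+1 x) =
    - s * (\sum_(y < x) log_coef d' y +
      \sum_(n < x) n.+1%:R^-1 * ((x - n.+1)%N%:R * log_coef d' (x - n.+1)%N)).
  rewrite mulrCA log_coefS mulrCA; congr (_ * _).
  rewrite [X in X + _](reindex_inj rev_ord_inj) -big_split mulr_sumr /=.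
  apply: eq_bigr => n _ /=.
  have -> : x%:R = (x - n.+1)%N%:R + n.+1%:R :> K by rewrite -natrD subnK.
  field.
  by rewrite ?nat1r ?natr1 pnatr_eq0.
elim=> [|d IHd] x.
  apply: (@mulfI _ 1%:R); rewrite ?oner_eq0 // step mul1r.
  rewrite [X in _ + X]big1 ?addr0 // => n _ /=.
  by case: (x - n.+1)%N => [|m]; rewrite ?mul0r !mulr0.
apply: (@mulfI _ d.+2%:R); rewrite ?pnatr_eq0 // step mulrCA; congr (_ * _).
rewrite -[d.+2%:R]/(1 + d.+1)%:R natrD mulrDl mul1r; congr (_ + _).
under eq_bigr => n _ do rewrite IHd mulrCA.
rewrite -mulr_sumr (exchange_triangle (fun n => n.+1%:R^-1) (log_coef d)) mulr_sumr [RHS]mulr_sumr.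
by apply: eq_bigr => w _; rewrite log_coefS.
Qed.

(** With f_d = (s log (1 - t))^d / d!, this is the differential equation (1 - t) f_(d+1)' = - s
    f_d. *)
Lemma log_coef_rec d x : x.+1%:R * log_coef d.+1 x.+1 =
  x%:R * log_coef d.+1 x - s * log_coef d x.
Proof. by rewrite !log_coef_euler big_ord_recr mulrDr !mulNr. Qed.
End LogCoefficients.

Section LogExp.
Variables (K : numFieldType) (U : lmodType K) (s : K) (F : Hom U U).

(** This is exp (log (1 - t) s F) = (1 - t)^(s F) on a nilpotent vector. Both sides satisfy (x + 1)
    E(x + 1) = (x - s F) E(x) with the same value at 0; the hypothesis removes the boundary term
    with D powers of F. *)
Lemma log_coef_sum D x w : iter D F w = 0 ->
  \sum_(d < D) log_coef s d x *: iter d F w =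
  (-1) ^+ x *: binop (s *: F) x w.
Proof.
case: D => [/= -> | D FD]; first by rewrite big_ord0 linear0 scaler0.
set E := fun x => \sum_(d < D.+1) log_coef s d x *: iter d F w.
rewrite -/(E x); elim: x => [|x IHx].
  rewrite /E big_ord_recl big1 => [|d _]; last by rewrite /= big_ord0 mulr0 scale0r.
  by rewrite /= !scale1r addr0.
apply: (@scalerSI _ _ x).
rewrite scalerA -commr_nat -scalerA binopS homZ exprSr mulrN1.
have -> : x.+1%:R *: E x.+1 = x%:R *: E x - s *: F (E x).
  rewrite /E big_ord_recl /= scale0r add0r scaler_sumr.
  rewrite [X in x%:R *: X]big_ord_recl /= scalerDr scalerA.
  rewrite (_ : x%:R * _ = 0) ?scale0r ?add0r; last by case: (x) => [|m]; rewrite /= ?mul0r ?mulr0.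
  rewrite (map_sum F) [X in _ - _ *: X]big_ord_recr /= (mapZ F) [F (iter D F w)]FD scaler0 addr0.
  rewrite !scaler_sumr -sumrB; apply: eq_bigr => d _.
  by rewrite scalerA log_coef_rec scalerBl -!scalerA (mapZ F).
rewrite IHx (mapZ F) scaleNr scalerBr opprB; congr (_ - _).
  by rewrite !scalerA mulrC.
by rewrite !scalerA mulrC.
Qed.
End LogExp.

Section Expansion.
Variables (K : numFieldType) (i j k : 'I_3).
Hypotheses (ij : i != j) (ik : i != k) (jk : j != k).
Variables (s c : K).
Local Notation te := (texpo i j k).

(* z_i^-x z_j^x zeta_i^a zeta_k^b *)
Definition log_expo x a b : expo := te (- x%:Z) a x%:Z 0%N 0 b.

(* s vartheta_ij + c zeta_k: for s = 1, c = -1 and s = -1, c = 1 this is the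
   logarithm in the delta functions of the theorem, for s = 1, c = 0 the one
   in the locality axiom. *)
Definition log_series (e : expo) : K :=
  s * vartheta K i j e + c * fmono K (mono k 0 1) e.

Lemma log_expo0 : log_expo 0 0 0 = 0.
Proof. by apply: (expoP ij ik jk); rewrite (texpoE ij ik jk) ffunE. Qed.

Lemma vartheta_mono : mono i (0 : int) 1 = log_expo 0 1 0.
Proof. by rewrite (monoiE ij ik jk). Qed.

Lemma vartheta_mono2 n : mono i (- n%:Z) 0 + mono j n%:Z 0 = log_expo n 0 0.
Proof.
by rewrite (monoiE ij ik jk) (monojE ij ik jk) (texpoD ij ik jk) !(addr0, add0r).
Qed.

Lemma log_expo_inj x a b x' a' b' : log_expo x a b = log_expo x' a' b' ->
  [/\ x = x', a = a' & b = b'].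
Proof. by case/(texpo_inj ij ik jk) => [[_ [->] _] [-> _ ->]]. Qed.

Lemma log_expoD x a b x' a' b' :
  log_expo x a b + log_expo x' a' b' = log_expo (x + x') (a + a') (b + b').
Proof. by rewrite (texpoD ij ik jk) -opprD. Qed.

Lemma vartheta_sum n a b :
  \sum_(m \in [set m : nat | (0 < m)%N])
    m%:R^-1 * fmono K (mono i (- m%:Z) 0 + mono j m%:Z 0) (log_expo n a b) =
  if [&& 0 < n, a == 0 & b == 0]%N then n%:R^-1 else 0.
Proof.
have fE m : fmono K (mono i (- m%:Z) 0 + mono j m%:Z 0) (log_expo n a b) =
    [&& m == n, a == 0 & b == 0]%N%:R.
  rewrite vartheta_mono2 /fmono; congr (nat_of_bool _)%:R.
  apply/eqP/and3P => [/log_expo_inj[-> -> ->] // | [/eqP-> /eqP-> /eqP-> //]].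
case: ifP => [/and3P[n0 a0 b0]|nab].
  rewrite (fsum_seq (r := [:: n])) //.
  - by rewrite big_seq1 fE eqxx a0 b0 mulr1.
  - by move=> x; rewrite inE => /eqP ->.
  - move=> x /= x0; rewrite fE inE; case: (x == n) => //=.
    by rewrite mulr0 eqxx.
rewrite fsbig1 // => m /= m0; rewrite fE; case: eqP => [E|_]; last by rewrite mulr0.
by rewrite -E m0 in nab; rewrite nab mulr0.
Qed.

Lemma log_seriesE n a b : log_series (log_expo n a b) =
  if [&& n == 0, a == 1 & b == 0]%N then s else
  if [&& n == 0, a == 0 & b == 1]%N then c else
  if [&& 0 < n, a == 0 & b == 0]%N then - (s / n%:R) else 0.
Proof.
rewrite /log_series /vartheta vartheta_sum vartheta_mono /fmono (monokE ij ik jk).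
rewrite -[texpo _ _ _ _ _ _ _ _ _]/(log_expo 0 0 1).
have eqE x a' b' : (log_expo n a b == log_expo x a' b') = [&& n == x, a == a' & b == b'].
  by apply/eqP/and3P => [/log_expo_inj[-> -> ->] // | [/eqP-> /eqP-> /eqP-> //]].
rewrite !eqE {eqE}; case: n => [|n]; case: a => [|[|a]]; case: b => [|[|b]];
  by rewrite /= !(subr0, sub0r, addr0, add0r, mulr0, mulr1, mulrN).
Qed.

Lemma log_series_supp e : log_series e != 0 -> exists x a b, e = log_expo x a b.
Proof.
apply: contraNP => ne.
have no x a b : (e == log_expo x a b) = false.
  by apply/eqP => E; apply: ne; exists x, a, b.
rewrite /log_series /vartheta fsbig1 => [|n _]; last first.
  by rewrite vartheta_mono2 /fmono no mulr0.
rewrite vartheta_mono /fmono (monokE ij ik jk).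
by rewrite -[texpo _ _ _ _ _ _ _ _ _]/(log_expo 0 0 1) !no subr0 !mulr0 addr0.
Qed.

Lemma fpow_supp n e : fpow log_series n e != 0 -> exists x a b, e = log_expo x a b.
Proof.
elim: n e => [|n IHn] e /=.
  case: (eqVneq e 0) => [-> _|_]; last by rewrite eqxx.
  by exists 0%N, 0%N, 0%N; rewrite log_expo0.
apply: contraNP => ne; apply/eqP; apply: fsbig1 => -[p q] /= pq.
have [->|/log_series_supp[x [a [b E]]]] := eqVneq (log_series p) 0.
  by rewrite mul0r.
have [->|/IHn[x' [a' [b' E']]]] := eqVneq (fpow log_series n q) 0.
  by rewrite mulr0.
by case: ne; do 3!eexists; rewrite -pq E E' log_expoD.
Qed.

(** The multinomial coefficient of L^n / n! for L = s zeta_i + c zeta_k + s log (1 - z_j / z_i), in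
    which the last summand occurs n - a - b times. *)
Definition expo_coef n x a b : K :=
  if (a + b <= n)%N then
    (s ^+ a / a`!%:R) * (c ^+ b / b`!%:R) * log_coef s (n - (a + b)) x
  else 0.

Lemma esub_log_expo x a b x' a' b' : (x' <= x)%N ->
  esub (log_expo x a b) (log_expo x' a' b') = log_expo (x - x') (a - a') (b - b').
Proof.
move=> xx'; rewrite (esub_texpo ij ik jk) subrr opprK.
by rewrite /log_expo -(subzn xx') opprB addrC sub0n.
Qed.

Lemma log_expo_esubP x a b x' a' b' : (x' <= x)%N ->
  (log_expo x' a' b' + esub (log_expo x a b) (log_expo x' a' b') ==
    log_expo x a b) = (a' <= a)%N && (b' <= b)%N.
Proof.
move=> xx'; rewrite esub_log_expo // log_expoD subnKC //.
apply/eqP/andP => [/log_expo_inj[_ <- <-]|[aa bb]]; last by rewrite !subnKC.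
by rewrite !leq_addr.
Qed.

Lemma fmul_log_series (f : fscalar K) x a b :
  (forall e, f e != 0 -> exists x a b, e = log_expo x a b) ->
  fmul log_series f (log_expo x a b) =
  (if (0 < a)%N then s * f (log_expo x a.-1 b) else 0) +
  (if (0 < b)%N then c * f (log_expo x a b.-1) else 0) +
  \sum_(m < x) - (s / m.+1%:R) * f (log_expo (x - m.+1) a b).
Proof.
move=> f_supp.
(* The monomials of the logarithm that can occur: zeta_i, zeta_k and (z_j / z_i)^m for 0 < m <= x. A
   larger m would leave a negative power of z_j / z_i, outside the support of f. *)
pose r := log_expo 0 1 0 :: log_expo 0 0 1 ::
  [seq log_expo m.+1 0 0 | m <- iota 0 x].
rewrite /fmul (@splits_sum _ r _ (fun p q => log_series p * f q)) /r.
- rewrite !big_cons big_map !log_expo_esubP // !esub_log_expo // !log_seriesE /=.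
  rewrite !andbT !subn0 !subn1 -!addrA.
  rewrite [iota 0 x](_ : _ = index_iota 0 x) ?big_mkord; last by rewrite /index_iota subn0.
  rewrite [X in if (0 < b)%N then _ + X else X](_ : _ =
      \sum_(m < x) - (s / m.+1%:R) * f (log_expo (x - m.+1) a b)).
    by do 2 case: ifP => _; rewrite ?add0r.
  apply: eq_big => m; first by rewrite log_expo_esubP.
  by rewrite esub_log_expo // log_seriesE /= !subn0.
- rewrite /= !inE negb_or -andbA; apply/and4P; split.
  + by apply/eqP => /log_expo_inj[].
  + by apply/mapP => -[m _ /log_expo_inj[]].
  + by apply/mapP => -[m _ /log_expo_inj[]].
  + by rewrite map_inj_uniq ?iota_uniq // => m m' /log_expo_inj[[]].
- move=> p q pq; rewrite mulf_eq0 negb_or => /andP[pn0 /f_supp[x1 [a1 [b1 qE]]]].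
  have [x2 [a2 [b2 pE]]] := log_series_supp pn0.
  move: pn0 pq; rewrite {}pE {}qE log_seriesE log_expoD => pn0 /log_expo_inj[E _ _].
  rewrite !inE; move: pn0.
  case: ifP => [/and3P[/eqP-> /eqP-> /eqP->]|_]; first by rewrite eqxx.
  case: ifP => [/and3P[/eqP-> /eqP-> /eqP->]|_]; first by rewrite eqxx orbT.
  case: ifP => [/and3P[x20 /eqP-> /eqP->] _|_]; last by rewrite eqxx.
  apply/orP; right; apply/orP; right; apply/mapP; exists x2.-1; last by rewrite prednK.
  by rewrite mem_iota /= add0n -E; case: x2 x20 {E} => //= m _; rewrite leq_addr.
Qed.

(** Write n + 1 = a + b + (n + 1 - a - b): the summands cancel against a!, b! and, through
    [log_coefS], the factorial hidden in [log_coef]. *)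
Lemma expo_coefS n x a b : n.+1%:R * expo_coef n.+1 x a b =
  (if (0 < a)%N then s * expo_coef n x a.-1 b else 0) +
  (if (0 < b)%N then c * expo_coef n x a b.-1 else 0) +
  \sum_(m < x) - (s / m.+1%:R) * expo_coef n (x - m.+1) a b.
Proof.
pose C := (s ^+ a / a`!%:R) * (c ^+ b / b`!%:R).
have -> : (if (0 < a)%N then s * expo_coef n x a.-1 b else 0) =
    a%:R * expo_coef n.+1 x a b.
  case: a @C => [|a] C /=; first by rewrite mul0r.
  rewrite /expo_coef addSn ltnS subSS; case: ifP => _; last by rewrite !mulr0.
  rewrite factS natrM exprS; field; rewrite !pnatr_eq0 -!lt0n !fact_gt0 /=.
  by rewrite ?natr1 ?nat1r pnatr_eq0.
have -> : (if (0 < b)%N then c * expo_coef n x a b.-1 else 0) =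
    b%:R * expo_coef n.+1 x a b.
  case: b @C => [|b] C /=; first by rewrite mul0r.
  rewrite /expo_coef addnS ltnS subSS; case: ifP => _; last by rewrite !mulr0.
  rewrite factS natrM exprS; field; rewrite !pnatr_eq0 -!lt0n !fact_gt0 /=.
  by rewrite ?natr1 ?nat1r pnatr_eq0.
rewrite -mulrDl -natrD /expo_coef -/C.
case: (ltngtP (a + b) n.+1) => [ab|ab|ab].
- rewrite ltnS in ab; rewrite ab subSn //.
  under eq_bigr do rewrite mulrCA.
  rewrite -mulr_sumr [in LHS]mulrCA [X in X + _]mulrCA -mulrDr; congr (_ * _).
  under eq_bigr do rewrite mulNr -mulrA -mulNr.
  rewrite -mulr_sumr -log_coefS -mulrDl -natrD.
  by congr (_%:R * _); rewrite addnS subnKC.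
- rewrite mulr0 big1 ?mulr0 ?addr0 // => m _.
  by rewrite leqNgt (ltn_trans _ ab) // mulr0.
- rewrite big1 ?ab ?addr0 // => m _.
  by rewrite ltnn mulr0.
Qed.

Lemma fpow_log_series n x a b :
  fpow log_series n (log_expo x a b) = n`!%:R * expo_coef n x a b.
Proof.
elim: n x a b => [|n IHn] x a b.
  rewrite /= -log_expo0 mul1r /expo_coef leqn0 addn_eq0.
  have -> : (log_expo x a b == log_expo 0 0 0) = [&& x == 0, a == 0 & b == 0]%N.
    by apply/eqP/and3P => [/log_expo_inj[-> -> ->] // | [/eqP-> /eqP-> /eqP-> //]].
  have [->|_] := eqVneq a 0%N; have [->|_] := eqVneq b 0%N; rewrite ?andbF //=.
  by rewrite !divr1 !mul1r andbT.
rewrite /= -/(fpow log_series n) fmul_log_series => [|e]; last exact: fpow_supp.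
rewrite !IHn factS mulnC natrM -[RHS]mulrA expo_coefS !mulrDr mulr_sumr.
congr (_ + _ + _); try by case: ifP => _; rewrite ?mulr0 // mulrCA.
by apply: eq_bigr => m _; rewrite IHn mulrCA.
Qed.

Lemma fexp_log_series (U : lmodType K) (F : Hom U U) x a b u :
  (exists D, iter D F u = 0) ->
  fexp log_series F (log_expo x a b) u =
  (s ^+ a / a`!%:R) * (c ^+ b / b`!%:R) *:
    ((-1) ^+ x *: binop (s *: F) x (iter (a + b) F u)).
Proof.
case=> D FD.
have iter0 m : (D <= m)%N -> iter m F u = 0.
  move=> Dm; rewrite -(subnK Dm) iterD FD; elim: (m - D)%N => //= d ->.
  exact: (map0 F).
rewrite -(@log_coef_sum _ _ _ _ D); last first.
  by rewrite -iterD iter0 // leq_addr.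
have fpowE n : (n`!%:R)^-1 * fpow log_series n (log_expo x a b) = expo_coef n x a b.
  by rewrite fpow_log_series mulKf // pnatr_eq0 -lt0n fact_gt0.
(* Powers below a + b are too small to contain zeta_i^a zeta_k^b, and those from a + b + D on
   annihilate u. *)
rewrite /fexp (fsum_seq (r := [seq (d + (a + b))%N | d <- index_iota 0 D])).
- rewrite big_map big_mkord scaler_sumr; apply: eq_bigr => d _.
  by rewrite fpowE /expo_coef leq_addl addnK scalerA iterD.
- by rewrite map_inj_uniq ?iota_uniq // => d d' /addIn.
- by [].
- move=> n _; rewrite fpowE /expo_coef; case: leqP => [abn|_]; last by rewrite scale0r eqxx.
  move=> ne; apply/mapP; exists (n - (a + b))%N; last by rewrite subnK.
  rewrite mem_index_iota /= ltnNge; apply: contraNN ne => Dn.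
  by rewrite iter0 ?scaler0 // (leq_trans Dn) ?leq_subr.
Qed.

Lemma fexp_log_series_supp (U : lmodType K) (F : Hom U U) e u :
  fexp log_series F e u != 0 -> exists x a b, e = log_expo x a b.
Proof.
apply: contraNP => ne; apply/eqP/fsbig1 => n _.
have [->|/fpow_supp//] := eqVneq (fpow log_series n e) 0.
by rewrite mulr0 scale0r.
Qed.

Section Twist.
Variables (U : lmodType K) (F : Hom U U) (u : U).
Hypothesis F_nilp : exists D, iter D F u = 0.
(** In z_k-degree r, f is kappa z_ij^n z_k^r. Fixing this degree singles out one n in the delta
    series (r = - n - 1); locality has r = 0. The constant kappa absorbs the sign from z_12 = -
    z_21. *)
Variables (f : fscalar K) (n r : int) (kappa : K).
Hypothesis f_supp : forall e : expo, (e k).1 = r -> f e != 0 ->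
  exists m : nat, e = te (n - m%:Z) 0%N m%:Z 0%N r 0%N.
Hypothesis f_coef : forall m : nat,
  f (te (n - m%:Z) 0%N m%:Z 0%N r 0%N) = kappa * ((-1) ^+ m * binz K n m).

(* Vandermonde merges z_ij^n with exp (s vartheta_ij F) into the binomial series
   of z_i^n (1 - z_j / z_i)^(n + s F), up to powers of zeta_i. *)
Lemma fscale_fexp t a b :
  fscale f (fexp log_series F) (te (n - t%:Z) a t%:Z 0%N r b) u =
  (kappa * (s ^+ a / a`!%:R) * (c ^+ b / b`!%:R)) *:
  ((-1) ^+ t *: binop (n%:~R *: id_hom U + s *: F) t (iter (a + b) F u)).
Proof.
pose q m := te (n - m%:Z) 0%N m%:Z 0%N r 0%N.
have q_inj : injective q by move=> m m' /(texpo_inj ij ik jk)[[_ []]].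
have qE m : (m <= t)%N -> esub (te (n - t%:Z) a t%:Z 0%N r b) (q m) = log_expo (t - m) a b.
  move=> mt; rewrite (esub_texpo ij ik jk) /log_expo !subn0 subrr -(subzn mt).
  by congr (texpo _ _ _ _ _ _ _ _ _); ring.
rewrite /fscale (@splits_sum _ [seq q m | m <- index_iota 0 t.+1] _
  (fun p p' => f p *: fexp log_series F p' u)).
- rewrite big_map big_mkord (eq_bigl xpredT) => [|[m mt]] /=; last first.
    rewrite qE // (texpoD ij ik jk) -(subzn (mt : (m <= t)%N)) !addr0 !add0n.
    by apply/eqP; congr (texpo _ _ _ _ _ _ _ _ _); ring.
  rewrite [_ + s *: F]addrC -vandermonde; last exact: commuting_id.
  rewrite !scaler_sumr; apply: eq_bigr => -[m /= mt] _.
  rewrite qE // fexp_log_series // f_coef !scalerA.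
  rewrite -[binop (n%:~R *: _) _ _]binz_binop [in RHS]linearZ_LR /= scalerA.
  congr (_ *: _); rewrite -[in RHS](subnK (mt : (m <= t)%N)) exprD; ring.
- by rewrite map_inj_uniq ?iota_uniq.
move=> p p' pp' H0.
have [fp|fp] := eqVneq (f p) 0; first by rewrite fp scale0r eqxx in H0.
have [fp'|/fexp_log_series_supp[x [a' [b' p'E]]]] :=
  eqVneq (fexp log_series F p' u) 0; first by rewrite fp' scaler0 eqxx in H0.
have pr : (p k).1 = r.
  by move/(congr1 (fun e : expo => (e k).1)): pp';
    rewrite p'E expoDE !(texpoE ij ik jk) /= addr0.
have [m pE] := f_supp pr fp.
apply/mapP; exists m; last by [].
move: pp'; rewrite pE p'E (texpoD ij ik jk) => /(texpo_inj ij ik jk)[[_ mxt _] _].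
rewrite mem_index_iota /= ltnS; lia.
Qed.

Lemma dpow_scale (x : K) a w : dpow (x *: F) a w = (x ^+ a / a`!%:R) *: iter a F w.
Proof.
elim: a => [|a IHa]; first by rewrite dpow0 divr1 scale1r.
rewrite dpowSE IHa homZ /= (mapZ F) !scalerA; congr (_ *: _).
rewrite factS natrM exprS; field.
by rewrite ?nat1r ?natr1 !pnatr_eq0 -lt0n fact_gt0.
Qed.

Lemma fscale_fexp_dpow t a b :
  fscale f (fexp log_series F) (te (n - t%:Z) a t%:Z 0%N r b) u =
  kappa *: ((-1) ^+ t *: binop (n%:~R *: id_hom U + s *: F) t
    (dpow (s *: F) a (dpow (c *: F) b u))).
Proof.
have iterZ x w m : iter m F (x *: w) = x *: iter m F w.
  by elim: m => //= m ->; rewrite (mapZ F).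
rewrite fscale_fexp !dpow_scale iterZ -iterD scalerA.
rewrite 2!(linearZ_LR (binop _ _)) /= !scalerA.
by congr (_ *: _); ring.
Qed.

Lemma fscale_fexp_supp (e : expo) : (e k).1 = r -> fscale f (fexp log_series F) e u != 0 ->
  exists t a b, e = te (n - t%:Z) a t%:Z 0%N r b.
Proof.
move=> er; apply: contraNP => ne; apply/eqP/fsbig1 => -[p p'] /= pp'.
have [->|/fexp_log_series_supp[x [a [b p'E]]]] := eqVneq (fexp log_series F p' u) 0.
  by rewrite scaler0.
have pr : (p k).1 = r by rewrite -er -pp' p'E expoDE (texpoE ij ik jk) /= addr0.
have [->|/(f_supp pr)[m pE]] := eqVneq (f p) 0; first by rewrite scale0r.
case: ne; exists (m + x)%N, a, b.
rewrite -pp' p'E pE (texpoD ij ik jk) PoszD !addr0 !add0n.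
by congr (texpo _ _ _ _ _ _ _ _ _); ring.
Qed.
End Twist.
End Expansion.

(** * Powers of z_i - z_j and the scalar part of the delta functions *)

Section DiffPow.
Variables (K : numFieldType) (i j k : 'I_3).
Hypotheses (ij : i != j) (ik : i != k) (jk : j != k).
Local Notation te := (texpo i j k).

Lemma zdiff_powE n x a y b z c : zdiff_pow K i j n (te x a y b z c) =
  if [&& a == 0%N, b == 0%N, z == 0, c == 0%N, x + y == n & 0 <= y]
  then (-1) ^+ `|y|%N * binz K n `|y|%N else 0.
Proof.
have qE (p : int) m : mono i (p - m%:Z) 0 + mono j m%:Z 0 = te (p - m%:Z) 0%N m%:Z 0%N 0 0%N.
  by rewrite (monoiE ij ik jk) (monojE ij ik jk) (texpoD ij ik jk) !(addr0, add0r).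
rewrite /zdiff_pow; case: ifP => [|H].
  move=> /and5P[/eqP-> /eqP-> /eqP-> /eqP-> /andP[/eqP<- y0]].
  case: y y0 => // m _; rewrite absz_nat.
  rewrite (fsum_seq (r := [:: m])) //.
    by rewrite big_seq1 qE /fmono addrK eqxx mulr1.
  move=> m' _; rewrite inE qE /fmono.
  case: (te _ _ _ _ _ _ =P _) => [|_]; last first.
    by rewrite mulr0 eqxx.
  by case/(texpo_inj ij ik jk) => -[_ [->]].
apply: fsbig1 => m _; rewrite qE /fmono; case: eqP; last by rewrite mulr0.
case/(texpo_inj ij ik jk) => -[xE yE zE] [aE bE cE].
by rewrite aE bE cE zE xE yE subrK !eqxx in H.
Qed.

Lemma zdiff_pow_supp n e : zdiff_pow K i j n e != 0 ->
  exists m : nat, e = te (n - m%:Z) 0%N m%:Z 0%N 0 0%N.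
Proof.
rewrite {1}(texpo_eta ij ik jk e) zdiff_powE; case: ifP => [|_]; last by rewrite eqxx.
case/and5P => /eqP a0 /eqP b0 /eqP z0 /eqP c0 /andP[/eqP xy y0] _.
exists `|(e j).1|%N; rewrite {1}(texpo_eta ij ik jk e) a0 b0 z0 c0 -xy.
by rewrite (gez0_abs y0) addrK.
Qed.

Lemma zdiff_pow_coef n (m : nat) :
  zdiff_pow K i j n (te (n - m%:Z) 0%N m%:Z 0%N 0 0%N) = (-1) ^+ m * binz K n m.
Proof. by rewrite zdiff_powE !eqxx /= subrK eqxx. Qed.

Lemma fmul_fmono (e0 e : expo) (g : fscalar K) : (forall l, (e0 l).2 = 0%N) ->
  fmul (fmono K e0) g e = g (esub e e0).
Proof.
move=> e00; rewrite /fmul (@splits_sum _ [:: e0] _ (fun p q => fmono K e0 p * g q)) //.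
  rewrite big_cons big_nil /fmono eqxx mul1r addr0 ifT //.
  apply/eqP/ffunP => l; rewrite expoDE ffunE.
  move: (e00 l); case: (e0 l) (e l) => [x a] [y b] /= ->.
  by rewrite pairD subn0 addrC subrK add0n.
move=> p q _; rewrite /fmono inE; case: (p == e0) => //=.
by rewrite mul0r eqxx.
Qed.

Lemma fmul_fmono_r (e0 e : expo) (g : fscalar K) : (forall l, (e0 l).2 = 0%N) ->
  fmul g (fmono K e0) e = g (esub e e0).
Proof.
move=> e00; rewrite /fmul (@splits_sumr _ [:: e0] _ (fun p q => g p * fmono K e0 q)) //.
  rewrite big_cons big_nil /fmono eqxx mulr1 addr0 ifT //.
  apply/eqP/ffunP => l; rewrite expoDE ffunE.
  move: (e00 l); case: (e0 l) (e l) => [x a] [y b] /= ->.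
  by rewrite pairD subn0 subrK addn0.
move=> p q _; rewrite /fmono inE; case: (q == e0) => //=.
by rewrite mulr0 eqxx.
Qed.

Lemma mono_log0 l n l' : (mono l n 0 l').2 = 0%N.
Proof. by rewrite monoE; case: ifP. Qed.

Lemma zdiff_powS n (e : expo) : zdiff_pow K i j (n + 1) e =
  zdiff_pow K i j n (esub e (mono i 1 0)) - zdiff_pow K i j n (esub e (mono j 1 0)).
Proof.
rewrite (texpo_eta ij ik jk e) (monoiE ij ik jk) (monojE ij ik jk).
rewrite !(esub_texpo ij ik jk) !subn0 !subr0 !zdiff_powE.
case: (_ == 0%N); case: (_ == 0%N); case: (_ == 0); case: (_ == 0%N); rewrite /= ?subr0 //.
set x := (e i).1; set y := (e j).1.
have -> : (x - 1 + y == n) = (x + y == n + 1) by lia.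
have -> : (x + (y - 1) == n) = (x + y == n + 1) by lia.
case: (_ == _); rewrite /= ?subr0 //; case: y => [[|m]|m] //=; last by rewrite subr0.
  by rewrite subr0 /binz !big_ord0.
by rewrite subn1 binz_pascal exprS; ring.
Qed.

(** For a natural exponent the expansion is the genuine power and hence independent of the domain.
    The case kappa = -1 expresses z_12^N through z_21, as the right side of locality requires. *)
Lemma fpow_diff (N : nat) (kappa : K) (e : expo) :
  fpow (fun e => kappa * (fmono K (mono i 1 0) e - fmono K (mono j 1 0) e)) N e =
  kappa ^+ N * zdiff_pow K i j N%:Z e.
Proof.
set A := (fun _ => _); elim: N e => [|N IHN] e.
  rewrite /= mul1r; case: eqP => [->|ne].
    have -> : 0 = te (0 - 0%:Z) 0%N 0%:Z 0%N 0 0%N.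
      by apply: (expoP ij ik jk); rewrite (texpoE ij ik jk) ffunE.
    by rewrite zdiff_pow_coef /binz big_ord0 expr0 divr1 mul1r.
  apply/esym/eqP; apply: contra_notT ne => E; have [[|m] eE] := zdiff_pow_supp E.
    by rewrite eE; apply: (expoP ij ik jk); rewrite (texpoE ij ik jk) ffunE.
  by move: E; rewrite eE zdiff_pow_coef binz0 mulr0 eqxx.
rewrite -[N.+1%:Z]/(1 + N)%:Z PoszD [_ + N%:Z]addrC zdiff_powS /= -/(fpow A N).
rewrite /fmul (@splits_sum _ [:: mono i 1 0; mono j 1 0] _ (fun p q => A p * fpow A N q)).
- have sub1 l : mono l 1 0 + esub e (mono l 1 0) == e.
    apply/eqP/ffunP => l'; rewrite expoDE !ffunE; case: (l' == l); case: (e l') => y b.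
      by rewrite pairD /= subn0 addrC subrK add0n.
    by rewrite pairD /= subn0 subr0 !add0r add0n.
  rewrite big_mkcond !big_cons big_nil !sub1 !IHN /A /fmono !eqxx.
  rewrite (monoiE ij ik jk) (monojE ij ik jk).
  have -> : (te 1 0%N 0 0%N 0 0%N == te 0 0%N 1 0%N 0 0%N) = false.
    by apply/eqP => /(texpo_inj ij ik jk)[[]].
  have -> : (te 0 0%N 1 0%N 0 0%N == te 1 0%N 0 0%N 0 0%N) = false.
    by apply/eqP => /(texpo_inj ij ik jk)[[]].
  by rewrite exprS /=; ring.
- rewrite /= inE andbT (monoiE ij ik jk) (monojE ij ik jk).
  by apply/eqP => /(texpo_inj ij ik jk)[[]].
- move=> p q _; rewrite /A /fmono !inE.
  by case: (p == _); case: (p == _) => //=; rewrite subrr mulr0 mul0r eqxx.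
Qed.

End DiffPow.

Section DeltaScalar.
Variables (K : numFieldType) (i j k : 'I_3).
Hypotheses (ij : i != j) (ik : i != k) (jk : j != k).
Local Notation te := (texpo i j k).
Variables (g : int -> fscalar K) (kappa : int -> K).
Hypothesis gE : forall n e, g n e = kappa n * zdiff_pow K i j n e.

Lemma g_supp n (e : expo) : g n e != 0 -> (e k).1 = 0.
Proof.
rewrite gE mulf_eq0 negb_or => /andP[_ /(zdiff_pow_supp ij ik jk)[m ->]].
by rewrite (texpoE ij ik jk).
Qed.

Lemma esubk (e : expo) p : (esub e (mono k p 0) k).1 = (e k).1 - p.
Proof. by rewrite ffunE monoE eqxx. Qed.

(** Since g m is free of z_k, the z_k-degree - n - 1 selects m = n. *)
Lemma delta_scalarl n (e : expo) : (e k).1 = - n - 1 ->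
  \sum_(m \in [set: int]) fmul (fmono K (mono k (- m - 1) 0)) (g m) e =
  g n (esub e (mono k (- n - 1) 0)).
Proof.
move=> ek; rewrite (fsum_seq (r := [:: n])) //.
  by rewrite big_seq1 fmul_fmono // => l; apply: mono_log0.
move=> m _; rewrite fmul_fmono => [/g_supp|l]; last exact: mono_log0.
by rewrite esubk ek inE => E; apply/eqP; lia.
Qed.

(** The shape of delta(z_13, z_2): the difference now carries the exponent - m - 1 and z_k the
    exponent m, yet z_k-degree - n - 1 again selects the n-th power of the difference. *)
Lemma delta_scalarr n (e : expo) : (e k).1 = - n - 1 ->
  \sum_(m \in [set: int]) fmul (g (- m - 1)) (fmono K (mono k m 0)) e =
  g n (esub e (mono k (- n - 1) 0)).
Proof.
move=> ek; rewrite (fsum_seq (r := [:: - n - 1])) //.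
  rewrite big_seq1 fmul_fmono_r => [|l]; last exact: mono_log0.
  by congr (g _ _); lia.
move=> m _; rewrite fmul_fmono_r => [/g_supp|l]; last exact: mono_log0.
by rewrite esubk ek inE => E; apply/eqP; lia.
Qed.

Variables (n : int) (f : fscalar K).
Hypothesis fE : forall e : expo, (e k).1 = - n - 1 ->
  f e = g n (esub e (mono k (- n - 1) 0)).

Lemma delta_scalar_supp (e : expo) : (e k).1 = - n - 1 -> f e != 0 ->
  exists m : nat, e = te (n - m%:Z) 0%N m%:Z 0%N (- n - 1) 0%N.
Proof.
move=> ek; rewrite fE // gE mulf_eq0 negb_or.
case/andP => _ /(zdiff_pow_supp ij ik jk)[m]; rewrite (texpo_eta ij ik jk e).
rewrite (monokE ij ik jk) (esub_texpo ij ik jk) !subr0 !subn0 ek.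
by case/(texpo_inj ij ik jk) => [[-> -> _] [-> -> ->]]; exists m.
Qed.

Lemma delta_scalar_coef (m : nat) :
  f (te (n - m%:Z) 0%N m%:Z 0%N (- n - 1) 0%N) =
  kappa n * ((-1) ^+ m * binz K n m).
Proof.
rewrite fE ?(texpoE ij ik jk) // gE (monokE ij ik jk) (esub_texpo ij ik jk).
by rewrite !subr0 !subn0 subrr (zdiff_pow_coef _ ij ik jk).
Qed.
End DeltaScalar.

(** * Coefficients of products of fields composed with a twist *)

Section Composition.
Variables (K : numFieldType) (i j k : 'I_3).
Hypotheses (ij : i != j) (ik : i != k) (jk : j != k).
Local Notation te := (texpo i j k).

Lemma fvar_supp (U W : lmodType K) l (A : int -> nat -> U -> W) (e : expo) u :
  fvar l A e u != 0 -> e = mono l (e l).1 (e l).2.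
Proof. by rewrite /fvar; case: (e l) => n m /=; case: (e =P _) => // _; rewrite eqxx. Qed.

Lemma fvar_mono (U W : lmodType K) l (A : int -> nat -> U -> W) n m u :
  fvar l A (mono l n m) u = A n m u.
Proof. by rewrite /fvar monoE eqxx /= eqxx. Qed.

Lemma fcomp_fvar (U U' W : lmodType K) (A : int -> nat -> U' -> W)
    (B : int -> nat -> U -> U') (e : expo) u :
  (forall n m, A n m 0 = 0) ->
  fcomp (fvar i A) (fvar j B) e u =
  if e k == (0, 0%N) then A (e i).1 (e i).2 (B (e j).1 (e j).2 u) else 0.
Proof.
move=> A0.
have fvar0 p : fvar i A p (0 : U') = 0.
  by rewrite /fvar; case: (p i) => n m; case: ifP.
rewrite (texpo_eta ij ik jk e) !(texpoE ij ik jk) /=.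
move: (e i).1 (e i).2 (e j).1 (e j).2 (e k).1 (e k).2 => x a y b z c.
have supp p q : p + q = te x a y b z c ->
    fvar i A p (fvar j B q u) != 0 -> [/\ q = mono j y b & (z, c) = (0, 0%N)].
  move=> pq H; have [q0|q0] := eqVneq (fvar j B q u) 0.
    by move: H; rewrite q0 fvar0 eqxx.
  move: pq; rewrite (fvar_supp H) (fvar_supp q0).
  rewrite (monoiE ij ik jk) !(monojE ij ik jk) (texpoD ij ik jk).
  rewrite !(addr0, add0r, addn0, add0n).
  by case/(texpo_inj ij ik jk) => [[_ -> <-] [_ -> <-]].
case: eqP => [zc|zc]; last first.
  apply: fsbig1 => -[p q] /= pq; apply/eqP.
  by apply: contra_notT zc => /(supp _ _ pq)[].
rewrite /fcomp (@splits_sumr _ [:: mono j y b] _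
    (fun p q => fvar i A p (fvar j B q u))) //; last first.
  by move=> p q /supp pq /pq[-> _]; rewrite inE.
case: zc => -> ->.
have E : esub (te x a y b 0 0%N) (mono j y b) = mono i x a.
  by rewrite (monojE ij ik jk) (esub_texpo ij ik jk) (monoiE ij ik jk) !subrr !subnn
    subr0 subn0.
rewrite big_mkcond big_cons big_nil E !fvar_mono ifT /= ?addr0 //.
rewrite (monoiE ij ik jk) (monojE ij ik jk) (texpoD ij ik jk).
by rewrite !(addr0, add0r, addn0, add0n).
Qed.

Section Coefficients.
Variables (U U' W : lmodType K) (G : fop U' W) (B : fop U U') (v : U).

Section Outer.
Variables (C : int -> nat -> int -> nat -> U' -> W) (n r : int).
Variable Bc : nat -> nat -> nat -> U'.
Hypothesis GE : forall (e : expo) w,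
  G e w = if e k == (0, 0%N) then C (e i).1 (e i).2 (e j).1 (e j).2 w else 0.
Hypothesis C0 : forall x a y b, C x a y b 0 = 0.
Hypothesis B_supp : forall e : expo, (e k).1 = r -> B e v != 0 ->
  exists t a b, e = te (n - t%:Z) a t%:Z 0%N r b.
Hypothesis BE : forall t a b, B (te (n - t%:Z) a t%:Z 0%N r b) v = Bc t a b.

(** The fields do not involve z_k, so the z_k-degree belongs to the twist alone and n is fixed. The
    twist contributes z_i^(n-t) z_j^t, and a large t pushes the field in z_j below its
    truncation. *)
Lemma fcomp_outer J x a y b c :
  (forall t a', (J <= t)%N -> C (x - n + t%:Z) (a - a') (y - t%:Z) b (Bc t a' c) = 0) ->
  fcomp G B (te x a y b r c) v =
  \sum_(t < J) \sum_(a' < a.+1) C (x - n + t%:Z) (a - a') (y - t%:Z) b (Bc t a' c).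
Proof.
move=> CJ; pose q t a' := te (n - t%:Z) a' t%:Z 0%N r c.
have q_inj t a1 t' a2 : q t a1 = q t' a2 -> t = t' /\ a1 = a2.
  by case/(texpo_inj ij ik jk) => [[_ [->] _] [-> _ _]].
have esubq t a' : esub (te x a y b r c) (q t a') =
    te (x - n + t%:Z) (a - a') (y - t%:Z) b 0 0%N.
  rewrite (esub_texpo ij ik jk) subn0 subrr subnn.
  by congr (texpo _ _ _ _ _ _ _ _ _); ring.
rewrite /fcomp (@splits_sumr _ [seq q t a' | t <- index_iota 0 J, a' <- index_iota 0 a.+1]
  _ (fun p q => G p (B q v))).
- rewrite big_mkcond big_allpairs_dep big_mkord; apply: eq_bigr => t _.
  rewrite big_mkord; apply: eq_bigr => -[a' a'a] _ /=.
  rewrite esubq GE !(texpoE ij ik jk) eqxx /= BE ifT // (texpoD ij ik jk).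
  rewrite add0n addn0 subnK // add0r; apply/eqP.
  by congr (texpo _ _ _ _ _ _ _ _ _); ring.
- apply: allpairs_uniq; rewrite ?iota_uniq // => -[t a1] [t' a2] _ _ /=.
  by case/q_inj => -> ->.
- move=> p p' pp' H.
  have [p0|p0] := eqVneq (B p' v) 0.
    by move: H; rewrite p0 GE C0 if_same eqxx.
  move: H; rewrite GE; case: (p k =P _) => [pk H|]; last by rewrite eqxx.
  have pr : (p' k).1 = r.
    move/(congr1 (fun e : expo => (e k).1)): pp'.
    by rewrite expoDE (texpoE ij ik jk) pk /= add0r.
  have [t [a' [b' p'E]]] := B_supp pr p0.
  have b'E : b' = c.
    move/(congr1 (fun e : expo => (e k).2)): pp'.
    by rewrite expoDE p'E !(texpoE ij ik jk) pk.
  have pE : p = esub (te x a y b r c) p' by rewrite -pp' addrC esub_addl.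
  subst b'; rewrite p'E; apply/allpairsP; exists (t, a'); split=> //=.
    rewrite mem_index_iota /= ltnNge; apply: contraNN H => Jt.
    by rewrite pE p'E esubq !(texpoE ij ik jk) /= BE CJ.
  rewrite mem_index_iota ltnS /=.
  move/(congr1 (fun e : expo => (e i).2)): pp'.
  by rewrite expoDE p'E !(texpoE ij ik jk) /= => <-; rewrite leq_addl.
Qed.
End Outer.

Section Inner.
Variables (C : int -> nat -> int -> nat -> U' -> W).
Variable Bc : int -> nat -> nat -> nat -> U'.
Hypothesis GE : forall (e : expo) w,
  G e w = if e i == (0, 0%N) then C (e k).1 (e k).2 (e j).1 (e j).2 w else 0.
Hypothesis C0 : forall x a y b, C x a y b 0 = 0.
Hypothesis B_supp : forall n (e : expo), (e k).1 = - n - 1 -> B e v != 0 ->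
  exists t a b, e = te (n - t%:Z) a t%:Z 0%N (- n - 1) b.
Hypothesis BE : forall n t a b,
  B (te (n - t%:Z) a t%:Z 0%N (- n - 1) b) v = Bc n t a b.

(** Here the fields involve z_k and z_j but not z_i, so x = n - t is fixed and n = x + t varies with
    t. The twist takes z_k^(-x-t-1), which leaves z + x + t + 1 for the outer field. *)
Lemma fcomp_inner J x a y b z c :
  (forall t c', (J <= t)%N ->
    C (z + x + t%:Z + 1) (c - c') (y - t%:Z) b (Bc (x + t%:Z) t a c') = 0) ->
  fcomp G B (te x a y b z c) v =
  \sum_(t < J) \sum_(c' < c.+1)
    C (z + x + t%:Z + 1) (c - c') (y - t%:Z) b (Bc (x + t%:Z) t a c').
Proof.
(* The exponent x + t - t stays unsimplified so as to match [BE] with n = x + t. *)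
move=> CJ; pose q t c' := te (x + t%:Z - t%:Z) a t%:Z 0%N (- (x + t%:Z) - 1) c'.
have q_inj t a1 t' a2 : q t a1 = q t' a2 -> t = t' /\ a1 = a2.
  by case/(texpo_inj ij ik jk) => [[_ [->] _] [_ _ ->]].
have esubq t c' : esub (te x a y b z c) (q t c') =
    te 0 0%N (y - t%:Z) b (z + x + t%:Z + 1) (c - c').
  rewrite (esub_texpo ij ik jk) subn0 subnn.
  by congr (texpo _ _ _ _ _ _ _ _ _); ring.
rewrite /fcomp (@splits_sumr _ [seq q t c' | t <- index_iota 0 J, c' <- index_iota 0 c.+1]
  _ (fun p q => G p (B q v))).
- rewrite big_mkcond big_allpairs_dep big_mkord; apply: eq_bigr => t _.
  rewrite big_mkord; apply: eq_bigr => -[c' c'c] _ /=.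
  rewrite esubq GE !(texpoE ij ik jk) eqxx /= BE ifT // (texpoD ij ik jk).
  rewrite add0n addn0 subnK // add0r; apply/eqP.
  by congr (texpo _ _ _ _ _ _ _ _ _); ring.
- apply: allpairs_uniq; rewrite ?iota_uniq // => -[t a1] [t' a2] _ _ /=.
  by case/q_inj => -> ->.
- move=> p p' pp' H.
  have [p0|p0] := eqVneq (B p' v) 0.
    by move: H; rewrite p0 GE C0 if_same eqxx.
  move: H; rewrite GE; case: (p i =P _) => [pi H|]; last by rewrite eqxx.
  have [n [t [a' [c' p'E]]]] :
      exists n t a' c', p' = te (n - t%:Z) a' t%:Z 0%N (- n - 1) c'.
    by exists (- (p' k).1 - 1); apply: B_supp => //; ring.
  have [xE aE] : n - t%:Z = x /\ a' = a.
    move/(congr1 (fun e : expo => e i)): pp'; rewrite expoDE pi p'E.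
    by rewrite !(texpoE ij ik jk) pairD add0r => -[].
  have {}p'E : p' = q t c'.
    by rewrite p'E aE /q -xE; congr (texpo _ _ _ _ _ _ _ _ _); ring.
  have pE : p = esub (te x a y b z c) p' by rewrite -pp' addrC esub_addl.
  rewrite p'E; apply/allpairsP; exists (t, c'); split=> //=.
    rewrite mem_index_iota /= ltnNge; apply: contraNN H => Jt.
    by rewrite pE p'E esubq !(texpoE ij ik jk) /= BE CJ.
  rewrite mem_index_iota ltnS /=.
  move/(congr1 (fun e : expo => (e k).2)): pp'.
  by rewrite expoDE p'E !(texpoE ij ik jk) /= => <-; rewrite leq_addl.
Qed.
End Inner.
End Coefficients.
End Composition.

(** * Parity and braiding maps *)

Section PureTensors.
Variables (K : fieldType) (U W : lmodType K).
Implicit Types (u : U) (w : W).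
Lemma tpureDl u u' w : (u + u') ⊗ w = u ⊗ w + u' ⊗ w. Proof. exact: linearDl. Qed.
Lemma tpureDr u w w' : u ⊗ (w + w') = u ⊗ w + u ⊗ w'. Proof. exact: linearDr. Qed.
Lemma tpureZl c u w : (c *: u) ⊗ w = c *: (u ⊗ w). Proof. exact: linearZl_LR. Qed.
Lemma tpureZr c u w : u ⊗ (c *: w) = c *: (u ⊗ w). Proof. exact: linearZr_LR. Qed.
Lemma tpure0l w : (0 : U) ⊗ w = 0. Proof. exact: linear0l. Qed.
Lemma tpure0r u : u ⊗ (0 : W) = 0. Proof. exact: linear0r. Qed.
End PureTensors.

Section Parity.
Variables (K : fieldType).
Implicit Types (U W : superspace K).

Definition even_hom U W (f : Hom U W) := forall i u, part i (f u) = f (part i u).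

Lemma part_parity U (u : U) i j : parity u i -> part j u = if j == i then u else 0.
Proof. by move=> ui; rewrite -{1}ui partK ui. Qed.

Lemma parity_part U i (u : U) : parity (part i u) i.
Proof. by rewrite /parity partK eqxx. Qed.

Lemma parity_hom_even U W (f : Hom U W) : parity f false -> even_hom f.
Proof.
move=> f0 i u.
have fE v : f v = part true (f (part true v)) + part false (f (part false v)).
  by rewrite -{1}f0 hom_partE big_bool.
rewrite fE [in RHS]fE (mapD (part i)) !partK.
by case: i; rewrite /= (map0 f) (map0 (part _)).
Qed.

Lemma id_even U : even_hom (idfun : {linear U -> U}).
Proof. by []. Qed.

Lemma even_hom_part U W (f : Hom U W) k :
  even_hom f -> part k f = if k then 0 else f.
Proof.
move=> f_even; apply: homP => u; rewrite hom_partE big_bool !f_even !partK.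
case: k => /=; first by rewrite !(map0 f) addr0.
by rewrite addrC -(mapD f) part_sum.
Qed.

Lemma stensorE U U' W W' (f : Hom U U') (g : Hom W W') u w :
  even_hom g -> stensor f g (u ⊗ w) = f u ⊗ g w.
Proof.
move=> g_even; rewrite tmapE !big_bool !(even_hom_part _ g_even) /=.
rewrite !tpure0r !scaler0 !add0r !expr0 !scale1r -tpureDl.
by rewrite addrC -(mapD f) part_sum.
Qed.

Lemma stensor_comp U W W' W'' (h : Hom W W'') (f : Hom W' W'') (g : Hom W W') x :
  even_hom h -> even_hom f -> even_hom g -> (forall w, h w = f (g w)) ->
  stensor (idfun : {linear U -> U}) f (stensor (idfun : {linear U -> U}) g x) =
  stensor (idfun : {linear U -> U}) h x.
Proof.
move=> he fe ge hE; elim/tensor_ind: x => [|u w x IHx]; first by rewrite !map0.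
rewrite (mapD (stensor _ g)) (mapD (stensor _ f)) (mapD (stensor _ h)) IHx.
by rewrite !stensorE // hE.
Qed.

Lemma tensor_homog_ext U W (X : lmodType K) (f g : Hom (U ⊗ W) X) :
  (forall i j u w, parity u i -> parity w j -> f (u ⊗ w) = g (u ⊗ w)) ->
  forall x, f x = g x.
Proof.
move=> fg x; suff -> : f = g by []; apply: tensor_hom_ext => u w.
rewrite -(part_sum u) -(part_sum w) !(tpureDl, tpureDr) /= !linearD /=.
by do ![congr (_ + _)]; apply: fg; apply: parity_part.
Qed.

Lemma tensor_parity U W (u : U) (w : W) i j :
  parity u i -> parity w j -> parity (u ⊗ w) (i (+) j).
Proof.
move=> ui wj; rewrite /parity tensor_partE big_bool.
rewrite !(part_parity _ ui) !(part_parity _ wj).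
by case: i {ui}; case: j {wj}; rewrite /= ?(tpure0l, tpure0r, addr0, add0r).
Qed.

Lemma tensor3_homog_ext U (V : superspace K) W (X : lmodType K) (f g : Hom (U ⊗ V ⊗ W) X) :
  (forall i j k u v w, parity u i -> parity v j -> parity w k ->
     f (u ⊗ v ⊗ w) = g (u ⊗ v ⊗ w)) ->
  forall x, f x = g x.
Proof.
move=> fg; elim/tensor_ind => [|y w x IHx]; first by rewrite !linear0.
rewrite !linearD IHx; congr (_ + _).
elim/tensor_ind: y => [|u v y IHy]; first by rewrite tpure0l !linear0.
rewrite tpureDl !linearD IHy; congr (_ + _).
rewrite -(part_sum u) -(part_sum v) -(part_sum w).
rewrite !(tpureDl, tpureDr) /= !linearD /=.
by do ![congr (_ + _)]; apply: fg; apply: parity_part.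
Qed.

(** The case of two odd maps is included because an even element of End(V) (x) End(V) has summands
    of both kinds. *)
Lemma stensor_even U U' W W' (f : Hom U U') (g : Hom W W') m :
  parity f m -> parity g m -> even_hom (stensor f g).
Proof.
move=> fm gm k.
apply: (@tensor_homog_ext _ _ _ (part k \o stensor f g : {linear _ -> _})
  (stensor f g \o part k : {linear _ -> _})) => i j u w ui wj /=.
have hom_parity (X Y : superspace K) (h : Hom X Y) x l : parity h m -> parity x l ->
    parity (h x) (l (+) m).
  move=> hm xl; rewrite -hm hom_partE big_bool !(part_parity _ xl).
  by case: l {xl}; rewrite /= !(map0 h) (map0 (part _)) ?add0r ?addr0;
    apply: parity_part.
have E : stensor f g (u ⊗ w) = (-1) ^+ (m && i) *: (f u ⊗ g w).
  rewrite tmapE !big_bool !(part_parity _ ui) !(part_parity _ gm).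
  by case: i {ui}; case: m {fm gm hom_parity}; rewrite /=
    ?(map0 f) ?(tpure0l, tpure0r, addr0, add0r, scaler0).
have fgm := tensor_parity (hom_parity _ _ _ _ _ fm ui) (hom_parity _ _ _ _ _ gm wj).
rewrite E (mapZ (part k)) (part_parity _ fgm).
rewrite (part_parity _ (tensor_parity ui wj)) addbACA addbb addbF.
by case: ifP => _; rewrite ?E // scaler0 map0.
Qed.

Lemma tensor_act_even U U' W W' (x : Hom U U' ⊗ Hom W W') :
  parity x false -> even_hom (tensor_act U U' W W' x).
Proof.
move=> <-; elim/tensor_ind: x => [|f g x IHx].
  by move=> i u; rewrite (map0 (part _)) map0 !hom0 (map0 (part i)).
rewrite (mapD (part _)) mapD => i u; rewrite !homD (mapD (part i)) IHx.
congr (_ + _); rewrite tensor_partE big_bool mapD !homD (mapD (part i)) !tmapE.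
by congr (_ + _); apply: stensor_even; apply: parity_part.
Qed.

Lemma sflip_homog U W (u : U) (w : W) i j : parity u i -> parity w j ->
  sflip U W (u ⊗ w) = (-1) ^+ (i && j) *: (w ⊗ u).
Proof.
move=> ui wj; rewrite tmapE !big_bool.
rewrite !(part_parity _ ui) !(part_parity _ wj).
by case: i {ui}; case: j {wj};
  rewrite /= ?(tpure0l, tpure0r, addr0, add0r, scaler0).
Qed.

Lemma sflipK U W x : sflip W U (sflip U W x) = x.
Proof.
move: x; apply: (@tensor_homog_ext _ _ _ (sflip W U \o sflip U W : {linear _ -> _})
  (idfun : {linear _ -> _})) => i j u w ui wj /=.
rewrite (sflip_homog ui wj) linearZ /= (sflip_homog wj ui) scalerA.
by rewrite [j && i]andbC -expr2 sqrr_sign scale1r.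
Qed.

Lemma sflip_even U W : even_hom (sflip U W).
Proof.
move=> k; apply: (@tensor_homog_ext _ _ _ (part k \o sflip U W : {linear _ -> _})
  (sflip U W \o part k : {linear _ -> _})) => i j u w ui wj /=.
rewrite (sflip_homog ui wj) linearZ /= (part_parity _ (tensor_parity ui wj)).
rewrite (part_parity _ (tensor_parity wj ui)) [j (+) i]addbC.
by case: ifP => _; rewrite ?(sflip_homog ui wj) // scaler0 linear0.
Qed.

Lemma sflip_natural U U' W (f : Hom U U') x : even_hom f ->
  sflip U' W (stensor f (idfun : {linear W -> W}) x) =
  stensor (idfun : {linear W -> W}) f (sflip U W x).
Proof.
move=> f_even; move: x.
apply: (@tensor_homog_ext _ _ _
  (sflip U' W \o stensor f (idfun : {linear W -> W}) : {linear _ -> _})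
  (stensor (idfun : {linear W -> W}) f \o sflip U W : {linear _ -> _})).
move=> i j u w ui wj; rewrite -[LHS]/(sflip U' W (stensor f _ (u ⊗ w))).
rewrite -[RHS]/(stensor _ f (sflip U W (u ⊗ w))) stensorE; last exact: id_even.
have fui : parity (f u) i by rewrite /parity f_even ui.
rewrite (sflip_homog fui wj) (sflip_homog ui wj).
by rewrite (mapZ (stensor _ f)) stensorE.
Qed.
End Parity.

Section Flips.
Variables (K : fieldType) (V : superspace K).
Local Notation V2 := (V ⊗ V)%type.
Local Notation V3 := (V ⊗ V ⊗ V)%type.
Local Notation P12 := (op12 (sflip V V)).
Local Notation P23 := (op23 (sflip V V)).

Lemma op12_opl (f : Hom V2 V2) v : op12 f v = opl f v. Proof. by []. Qed.

Lemma opr_assoc (W : superspace K) (f : Hom V2 W) v :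
  opr f v = stensor (idfun : {linear V -> V}) f (assoc V V V v).
Proof. by []. Qed.

Lemma op23_opr (f : Hom V2 V2) v : op23 f v = assocV V V V (opr f v).
Proof. by []. Qed.

Lemma oplE (W : superspace K) (f : Hom V2 W) x c : opl f (x ⊗ c) = f x ⊗ c.
Proof. exact/stensorE/id_even. Qed.

Lemma op12E (f : Hom V2 V2) x c : op12 f (x ⊗ c) = f x ⊗ c.
Proof. exact: oplE. Qed.

Lemma oprE (W : superspace K) (f : Hom V2 W) a b c : even_hom f ->
  opr f (a ⊗ b ⊗ c) = a ⊗ f (b ⊗ c).
Proof. by move=> f_even; rewrite opr_assoc assocE stensorE. Qed.

Lemma op23E (f : Hom V2 V2) a b c : even_hom f ->
  op23 f (a ⊗ b ⊗ c) = assocV V V V (a ⊗ f (b ⊗ c)).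
Proof. by move=> f_even; rewrite op23_opr oprE. Qed.

Lemma assocK (x : V3) : assocV V V V (assoc V V V x) = x.
Proof.
move: x; apply: (tensor3_homog_ext (f := assocV V V V \o assoc V V V : {linear _ -> _})
  (g := (idfun : {linear _ -> _}))) => i j k a b c _ _ _ /=.
by rewrite assocE assocVE.
Qed.

Lemma assocVK (x : (V ⊗ (V ⊗ V))%type) : assoc V V V (assocV V V V x) = x.
Proof.
elim/tensor_ind: x => [|a y x IHx]; first by rewrite !map0.
rewrite !mapD IHx; congr (_ + _).
elim/tensor_ind: y => [|b c y IHy]; first by rewrite tpure0r !map0.
by rewrite tpureDr !mapD IHy assocVE assocE.
Qed.

Lemma op23_op23 (f g : Hom V2 V2) v : op23 f (op23 g v) = assocV V V V
  (stensor (idfun : {linear V -> V}) f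
    (stensor (idfun : {linear V -> V}) g (assoc V V V v))).
Proof.
by rewrite op23_opr opr_assoc op23_opr assocVK opr_assoc.
Qed.

Lemma op23_commute (f g : Hom V2 V2) v : even_hom f -> even_hom g ->
  commuting f g -> op23 f (op23 g v) = op23 g (op23 f v).
Proof.
move=> fe ge fg; apply: etrans (op23_op23 f g v) _; apply: etrans (esym (op23_op23 g f v)).
have fge : even_hom (f \o g : {linear V2 -> V2}) by move=> i u /=; rewrite fe ge.
congr (assocV V V V _); apply: etrans (stensor_comp _ fge fe ge _) (esym _) => //.
by apply: (stensor_comp _ fge ge fe) => u /=; rewrite fg.
Qed.

Lemma P12K v : P12 (P12 v) = v.
Proof.
elim/tensor_ind: v => [|x c v IHv]; first by rewrite !map0.
by rewrite !mapD IHv !(oplE, op12E) sflipK.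
Qed.

Lemma P23K v : P23 (P23 v) = v.
Proof.
rewrite !op23_opr !opr_assoc assocVK -[RHS]assocK; congr (assocV _ _ _ _).
move: (assoc V V V v) => {v} v.
elim/tensor_ind: v => [|x c v IHv]; first by rewrite !map0.
by rewrite !mapD IHv !stensorE ?sflipK //; apply: sflip_even.
Qed.

Lemma sflip_assoc (v : V3) : sflip V2 V v = assoc V V V (P12 (P23 v)).
Proof.
move: v; apply: (tensor3_homog_ext (f := sflip V2 V)
  (g := assoc V V V \o P12 \o P23 : {linear _ -> _})) => i j k a b c ai bj ck.
rewrite (sflip_homog (tensor_parity ai bj) ck) -[RHS]/(assoc V V V (P12 (P23 _))).
rewrite op23E; last exact: sflip_even.
rewrite (sflip_homog bj ck) tpureZr !mapZ assocVE op12E (sflip_homog ai ck).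
rewrite tpureZl mapZ assocE scalerA -signr_addb; congr (_ ^+ _ *: _).
by rewrite -andb_addl addbC.
Qed.

(* Moving the last factor to the front is [P12 \o P23]. *)
Lemma sflip_opl (W : superspace K) (f : Hom V2 W) v : even_hom f ->
  sflip W V (opl f v) = opr f (P12 (P23 v)).
Proof.
by move=> fe; rewrite sflip_natural // sflip_assoc.
Qed.

Lemma op12_cycle (f : Hom V2 V2) v : even_hom f ->
  P12 (P23 (op12 f v)) = op23 f (P12 (P23 v)).
Proof.
move=> fe; rewrite -[LHS]assocK -sflip_assoc.
by rewrite op12_opl sflip_opl.
Qed.

Lemma op12_nilpotent (f : Hom V2 V2) : locally_nilpotent f ->
  locally_nilpotent (op12 f).
Proof.
move=> fn; elim/tensor_ind => [|x c v [n IHv]]; first by exists 0%N.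
have iter_op0 m : iter m (op12 f) 0 = 0 by elim: m => //= m ->; rewrite (map0 (op12 f)).
have iter_addv m u w : iter m (op12 f) (u + w) = iter m (op12 f) u + iter m (op12 f) w.
  by elim: m => //= m ->; rewrite (mapD (op12 f)).
have iterE m : iter m (op12 f) (x ⊗ c) = iter m f x ⊗ c.
  by elim: m => //= m ->; rewrite op12E.
have iterf0 m : iter m f 0 = 0 by elim: m => //= m ->; rewrite (map0 f).
have [m fm] := fn x; exists (m + n)%N.
by rewrite iter_addv [in X in X + _]addnC iterE !iterD fm iterf0 tpure0l IHv iter_op0 addr0.
Qed.
End Flips.

(** * Relations between the braiding, the flips and the fields *)

Section Relations.
Variables (K : numFieldType) (V : superspace K) (A : logVA V).
Local Notation V2 := (V ⊗ V)%type.
Local Notation V3 := (V ⊗ V ⊗ V)%type.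
Local Notation S := (braid_op (braid A)).
Local Notation Y n k := (Ymap (modes A) n k).
Local Notation P := (sflip V V).
Local Notation P12 := (op12 P).
Local Notation P23 := (op23 P).
Local Notation S12 := (op12 S).
Local Notation S23 := (op23 S).
Local Notation S13 := (op13 S).

Lemma braid_even : even_hom S.
Proof. exact/tensor_act_even/braiding_even/braid_braiding_map. Qed.

Lemma YE n k a b : Y n k (a ⊗ b) = modes A n k a b.
Proof. exact: tliftE. Qed.

Lemma Y_even n k : even_hom (Y n k).
Proof.
move=> i; apply: (@tensor_homog_ext _ _ _ _ (part i \o Y n k : {linear _ -> _})
  (Y n k \o part i : {linear _ -> _})) => p q a b ap bq.
rewrite -[LHS]/(part i (Y n k (a ⊗ b))) -[RHS]/(Y n k (part i (a ⊗ b))).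
rewrite YE (part_parity _ (modes_even A n k ap bq)).
rewrite (part_parity _ (tensor_parity ap bq)).
by case: ifP => _; rewrite ?YE ?map0.
Qed.

Lemma S_flip u : S (P u) = P (S u).
Proof. exact: (braiding_flip (braid_braiding_map A)). Qed.

Lemma S12_S23 v : S12 (S23 v) = S23 (S12 v).
Proof. exact: (braiding12_23 (braid_braiding_map A)). Qed.
Lemma S13_S23 v : S13 (S23 v) = S23 (S13 v).
Proof. exact: (braiding13_23 (braid_braiding_map A)). Qed.
Lemma S12_S13 v : S12 (S13 v) = S13 (S12 v).
Proof. exact: (braiding12_13 (braid_braiding_map A)). Qed.

Lemma S13E v : S13 v = P23 (S12 (P23 v)). Proof. by []. Qed.

Lemma S12_P12 v : S12 (P12 v) = P12 (S12 v).
Proof.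
elim/tensor_ind: v => [|x c v IHv]; first by rewrite !map0.
by rewrite !mapD IHv !oplE S_flip.
Qed.

Lemma S23_P23 v : S23 (P23 v) = P23 (S23 v).
Proof. exact: (op23_commute _ braid_even (@sflip_even K V V) S_flip). Qed.

Lemma S13_P23 v : S13 (P23 v) = P23 (S12 v).
Proof. by rewrite S13E P23K. Qed.

Lemma S12_P23 v : S12 (P23 v) = P23 (S13 v).
Proof. by rewrite S13E P23K. Qed.

(** S13 is defined by conjugation with P23, so conjugation with P12 goes through the 3-cycle of
    [op12_cycle], which carries S12 to S23. *)
Lemma S13_P12 v : S13 (P12 v) = P12 (S23 v).
Proof.
have := op12_cycle (P23 (P12 v)) braid_even.
rewrite P23K P12K => <-.
by rewrite P12K -S13E.
Qed.

Lemma S23_P12 v : S23 (P12 v) = P12 (S13 v).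
Proof. by rewrite -[v in RHS]P12K S13_P12 P12K. Qed.

Lemma S_opl m v : S (opl (Y m 0) v) = opl (Y m 0) (S13 v + S23 v).
Proof. exact: braid_hexagon. Qed.

Lemma flip_opl m k v : P (opl (Y m k) v) = opr (Y m k) (P12 (P23 v)).
Proof. exact/sflip_opl/Y_even. Qed.

(** The second hexagon relation, for I (x) Y: cyclic permutation turns it into the axiom for Y (x)
    I, since S commutes with the flip. *)
Lemma S_opr m v : S (opr (Y m 0) v) = opr (Y m 0) (S12 v + S13 v).
Proof.
rewrite -{1}[v]P12K -{1}[P12 v]P23K -flip_opl S_flip S_opl flip_opl.
rewrite !mapD -S12_P23 -S12_P12 -S23_P23 -S13_P12 P23K P12K.
by [].
Qed.

Lemma S12_nilpotent : locally_nilpotent S12.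
Proof. exact/op12_nilpotent/braid_nilpotent. Qed.

Lemma S13_nilpotent : locally_nilpotent S13.
Proof.
move=> v; have [n Sn] := S12_nilpotent (P23 v); exists n.
have E m : iter m S13 v = P23 (iter m S12 (P23 v)).
  elim: m => [|m IHm]; first by rewrite P23K.
  by rewrite !iterS IHm S13_P23.
by rewrite E Sn map0.
Qed.

Local Notation vac := (vac A).

Lemma flip_vacr b : P (b ⊗ vac) = vac ⊗ b.
Proof.
rewrite -(part_sum b) tpureDl tpureDr !mapD.
by rewrite !(sflip_homog (parity_part _ b) (vac_even A)) !andbF !scale1r.
Qed.

Lemma flip_vacl b : P (vac ⊗ b) = b ⊗ vac.
Proof. by rewrite -flip_vacr sflipK. Qed.

Lemma P23_vac a b : P23 (a ⊗ b ⊗ vac) = a ⊗ vac ⊗ b.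
Proof. by rewrite op23E ?flip_vacr ?assocVE //; apply: sflip_even. Qed.

(** On vac (x) vac (x) b the z^0 coefficient of the hexagon relation reads s = s + s for s = S (vac
    (x) b), by the two vacuum axioms. *)
Lemma S_vacl b : S (vac ⊗ b) = 0.
Proof.
have Y0 u : Y 0 0 (vac ⊗ u) = u by rewrite YE vac_left.
have := S_opl 0 (vac ⊗ vac ⊗ b); rewrite oplE Y0 mapD.
have -> : opl (Y 0 0) (S23 (vac ⊗ vac ⊗ b)) = S (vac ⊗ b).
  rewrite op23E; last exact: braid_even.
  elim/tensor_ind: (S (vac ⊗ b)) => [|x y u IHu]; first by rewrite tpure0r !map0.
  by rewrite tpureDr !mapD IHu assocVE oplE Y0.
have -> : opl (Y 0 0) (S13 (vac ⊗ vac ⊗ b)) = S (vac ⊗ b).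
  rewrite S13E op23E; last exact: sflip_even.
  rewrite flip_vacl assocVE oplE.
  elim/tensor_ind: (S (vac ⊗ b)) => [|x y u IHu]; first by rewrite tpure0l !map0.
  by rewrite tpureDl !mapD IHu P23_vac oplE YE vac_right.
by move/eqP; rewrite -subr_eq0 opprD addrA subrr sub0r oppr_eq0 => /eqP.
Qed.
End Relations.

(** * Bounds for the modes *)

Section NatSums.
Variables (K : numFieldType) (U W : lmodType K).

Definition nsum (F : nat -> U) : U := \sum_(t \in [set: nat]) F t.

Lemma nsumE J (F : nat -> U) : (forall t, (J <= t)%N -> F t = 0) ->
  nsum F = \sum_(t < J) F t.
Proof.
move=> FJ; rewrite /nsum (fsum_seq (r := index_iota 0 J)) ?iota_uniq ?big_mkord //.
move=> t _; rewrite mem_index_iota /= ltnNge; apply: contraNN => Jt.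
by rewrite FJ.
Qed.

Lemma binop_stable (M : U -> Prop) (F : Hom U U) t u :
  (forall c x y, M x -> M y -> M (c *: x + y)) -> (forall x, M x -> M (F x)) ->
  M 0 -> M u -> M (binop F t u).
Proof.
move=> Mlin MF M0 Mu; elim: t => [//|t IHt].
rewrite binopSE -[_ *: _]addr0; apply: (Mlin) => //.
by rewrite addrC -scaleNr; apply: Mlin => //; apply: MF.
Qed.

Lemma dpow_stable (M : U -> Prop) (F : Hom U U) t u :
  (forall c x y, M x -> M y -> M (c *: x + y)) -> (forall x, M x -> M (F x)) ->
  M 0 -> M u -> M (dpow F t u).
Proof.
move=> Mlin MF M0 Mu; elim: t => [|t IHt]; first by rewrite dpow0.
by rewrite dpowSE -[_ *: _]addr0; apply: (Mlin) => //; apply: MF.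
Qed.

(** Induction on the nilpotency index: the minimum of the bounds for u and for the iterates of F u
    serves all iterates of u. *)
Lemma iter_bound (F : Hom U U) (R : int -> U -> Prop) : locally_nilpotent F ->
  (forall q, R q 0) -> (forall u, exists Q : int, forall q, q < Q -> R q u) ->
  forall u, exists Q : int, forall q, q < Q -> forall a, R q (iter a F u).
Proof.
move=> Fn R0 Rb u; have [n] := Fn u; elim: n u => [|n IHn] u /=.
  move=> ->; exists 0 => q _ a; suff -> : iter a F 0 = 0 by [].
  by elim: a => //= a ->; rewrite (map0 F).
rewrite -iterS iterSr => /IHn[Q1 H1]; have [Q2 H2] := Rb u.
exists (Num.min Q1 Q2) => q; rewrite lt_min => /andP[q1 q2] [|a]; first exact: H2.
by rewrite iterSr; apply: H1.
Qed.
End NatSums.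

Section Bounds.
Variables (K : numFieldType) (V : superspace K) (A : logVA V).
Local Notation V2 := (V ⊗ V)%type.
Local Notation V3 := (V ⊗ V ⊗ V)%type.
Local Notation S := (braid_op (braid A)).
Local Notation Y n k := (Ymap (modes A) n k).
Local Notation P := (sflip V V).
Local Notation P12 := (op12 P).
Local Notation P23 := (op23 P).
Local Notation S12 := (op12 S).
Local Notation S23 := (op23 S).
Local Notation S13 := (op13 S).

Lemma Y_bound (u : V2) :
  exists Q : int, forall q, q < Q -> forall k, Y q k u = 0.
Proof.
elim/tensor_ind: u => [|a b u [Q HQ]]; first by exists 0 => *; rewrite map0.
have [N [M HN]] := modes_log_laurent A a b.
exists (Num.min Q N) => q; rewrite lt_min => /andP[q1 q2] k.
by rewrite mapD HQ // YE HN ?q2 // addr0.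
Qed.

Lemma opl_bound (v : V3) :
  exists Q : int, forall q, q < Q -> forall k, opl (Y q k) v = 0.
Proof.
elim/tensor_ind: v => [|x c v [Q HQ]]; first by exists 0 => *; rewrite map0.
have [N HN] := Y_bound x.
exists (Num.min Q N) => q; rewrite lt_min => /andP[q1 q2] k.
by rewrite mapD HQ // oplE HN // tpure0l addr0.
Qed.

Lemma opr_bound (v : V3) :
  exists Q : int, forall q, q < Q -> forall k, opr (Y q k) v = 0.
Proof.
have [Q HQ] := opl_bound (P23 (P12 v)).
by exists Q => q /HQ Hq k; rewrite -[v]P12K -[P12 v]P23K -flip_opl Hq map0.
Qed.

(* Unlike the kernel of [opr (Y q k)], these spaces are stable under S12 and S13. *)
Definition opr_null q (v : V3) :=
  forall a b k, opr (Y q k) (iter a S12 (iter b S13 v)) = 0.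
Definition opl_null q (v : V3) := forall b k, opl (Y q k) (iter b S13 v) = 0.

Lemma iter_lin (U : lmodType K) (F : Hom U U) m c x y :
  iter m F (c *: x + y) = c *: iter m F x + iter m F y.
Proof. by elim: m => //= m ->; rewrite (mapD F) (mapZ F). Qed.

Lemma iter_0 (U : lmodType K) (F : Hom U U) m : iter m F 0 = 0.
Proof. by elim: m => //= m ->; rewrite (map0 F). Qed.

Lemma iter_comm (U : lmodType K) (F G : Hom U U) m u :
  commuting F G -> iter m F (G u) = G (iter m F u).
Proof. by move=> FG; elim: m => //= m ->. Qed.

Lemma opr_null_lin q c x y : opr_null q x -> opr_null q y -> opr_null q (c *: x + y).
Proof.
by move=> Hx Hy a b k; rewrite !iter_lin mapD mapZ Hx Hy scaler0 addr0.
Qed.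

Lemma opr_null0 q : opr_null q 0.
Proof. by move=> a b k; rewrite !iter_0 map0. Qed.

Lemma opr_null_S12 q x : opr_null q x -> opr_null q (S12 x).
Proof.
move=> Hx a b k; rewrite iter_comm -?iterSr; first exact: Hx.
by move=> u; rewrite S12_S13.
Qed.

Lemma opr_null_S13 q x : opr_null q x -> opr_null q (S13 x).
Proof. by move=> Hx a b k; rewrite -iterSr; exact: Hx. Qed.

Lemma opr_nullE q x k : opr_null q x -> opr (Y q k) x = 0.
Proof. by move/(_ 0%N 0%N k). Qed.

Lemma opr_null_bound (v : V3) : exists Q : int, forall q, q < Q -> opr_null q v.
Proof.
have H1 := iter_bound (@S12_nilpotent K V A)
  (R := fun q u => forall k, opr (Y q k) u = 0) (fun q k => map0 (opr (Y q k))) opr_bound.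
have [|Q HQ] := iter_bound (@S13_nilpotent K V A)
  (R := fun q u => forall a k, opr (Y q k) (iter a S12 u) = 0) _ H1 v.
  by move=> q a k; rewrite iter_0 map0.
by exists Q => q /HQ Hq a b k; apply: Hq.
Qed.

Lemma opl_null_lin q c x y : opl_null q x -> opl_null q y -> opl_null q (c *: x + y).
Proof. by move=> Hx Hy b k; rewrite !iter_lin mapD mapZ Hx Hy scaler0 addr0. Qed.

Lemma opl_null0 q : opl_null q 0.
Proof. by move=> b k; rewrite !iter_0 map0. Qed.

Lemma opl_null_S13 q x : opl_null q x -> opl_null q (S13 x).
Proof. by move=> Hx b k; rewrite -iterSr; exact: Hx. Qed.

Lemma opl_nullE q x k : opl_null q x -> opl (Y q k) x = 0.
Proof. by move/(_ 0%N k). Qed.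

Lemma opl_null_bound (v : V3) : exists Q : int, forall q, q < Q -> opl_null q v.
Proof.
have [Q HQ] := iter_bound (@S13_nilpotent K V A)
  (R := fun q u => forall k, opl (Y q k) u = 0) (fun q k => map0 (opl (Y q k))) opl_bound v.
by exists Q => q /HQ Hq b k; apply: Hq.
Qed.

Lemma opr_null_binop q c s F t x : F = S12 \/ F = S13 -> opr_null q x ->
  opr_null q (binop (c *: id_hom V3 + s *: F) t x).
Proof.
move=> FS; apply: (binop_stable (M := @opr_null q)); [exact: opr_null_lin| |exact: opr_null0].
move=> y Hy; rewrite homD !homZ; apply: opr_null_lin => //.
rewrite -[s *: _]addr0; apply: opr_null_lin; last exact: opr_null0.
by case: FS => ->; [apply: opr_null_S12|apply: opr_null_S13].
Qed.

Lemma opr_null_dpow q s F t x : F = S12 \/ F = S13 -> opr_null q x ->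
  opr_null q (dpow (s *: F) t x).
Proof.
move=> FS; apply: (dpow_stable (M := @opr_null q)); [exact: opr_null_lin| |exact: opr_null0].
move=> y Hy; rewrite homZ -[s *: _]addr0; apply: opr_null_lin; last exact: opr_null0.
by case: FS => ->; [apply: opr_null_S12|apply: opr_null_S13].
Qed.

Lemma opl_null_binop q c s t x : opl_null q x ->
  opl_null q (binop (c *: id_hom V3 + s *: S13) t x).
Proof.
apply: (binop_stable (M := @opl_null q)); [exact: opl_null_lin| |exact: opl_null0].
move=> y Hy; rewrite homD !homZ; apply: opl_null_lin => //.
rewrite -[s *: _]addr0; apply: opl_null_lin; last exact: opl_null0.
exact: opl_null_S13.
Qed.

Lemma opl_null_dpow q s t x : opl_null q x -> opl_null q (dpow (s *: S13) t x).
Proof.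
apply: (dpow_stable (M := @opl_null q)); [exact: opl_null_lin| |exact: opl_null0].
move=> y Hy; rewrite homZ -[s *: _]addr0; apply: opl_null_lin; last exact: opl_null0.
exact: opl_null_S13.
Qed.
End Bounds.

(** * Coefficients of the products of fields *)

Section Locality.
Variables (K : numFieldType) (V : superspace K) (A : logVA V).
Local Notation V2 := (V ⊗ V)%type.
Local Notation V3 := (V ⊗ V ⊗ V)%type.
Local Notation S := (braid_op (braid A)).
Local Notation Y n k := (Ymap (modes A) n k).
Local Notation P := (sflip V V).
Local Notation P12 := (op12 P).
Local Notation P23 := (op23 P).
Local Notation S12 := (op12 S).
Local Notation S23 := (op23 S).
Local Notation S13 := (op13 S).
Local Notation vac := (vac A).

Section OuterProduct.
Variables i j k : 'I_3.
Hypotheses (ij : i != j) (ik : i != k) (jk : j != k).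

Lemma Y_IY_coef (e : expo) w : Y_IY (modes A) i j e w =
  if e k == (0, 0%N) then Y (e i).1 (e i).2 (opr (Y (e j).1 (e j).2) w) else 0.
Proof. by apply: (fcomp_fvar ij ik jk) => n m; apply: map0. Qed.

Lemma Y_YI_coef (e : expo) w : Y_YI (modes A) i j e w =
  if e k == (0, 0%N) then Y (e i).1 (e i).2 (opl (Y (e j).1 (e j).2) w) else 0.
Proof. by apply: (fcomp_fvar ij ik jk) => n m; apply: map0. Qed.

Variables (s c : K) (v : V3) (f : fscalar K) (n r : int) (kappa : K).
Hypothesis f_supp : forall e : expo, (e k).1 = r -> f e != 0 ->
  exists m : nat, e = texpo i j k (n - m%:Z) 0%N m%:Z 0%N r 0%N.
Hypothesis f_coef : forall m : nat,
  f (texpo i j k (n - m%:Z) 0%N m%:Z 0%N r 0%N) = kappa * ((-1) ^+ m * binz K n m).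

Definition outer_coef (x : int) (a : nat) (y : int) (b c' : nat) : nat -> V := fun t =>
  \sum_(a' < a.+1) Y (x - n + t%:Z) (a - a') (opr (Y (y - t%:Z) b)
     ((-1) ^+ t *: binop (n%:~R *: id_hom V3 + s *: S12) t
       (dpow (s *: S12) a' (dpow (c *: S12) c' v)))).

Lemma outer_term_bound y : exists J, forall z x l b c' a' t, (J <= t)%N ->
  Y x l (opr (Y (y - t%:Z) b) (z *: ((-1) ^+ t *:
    binop (n%:~R *: id_hom V3 + s *: S12) t
       (dpow (s *: S12) a' (dpow (c *: S12) c' v))))) = 0.
Proof.
have [Q HQ] := opr_null_bound A v.
exists (absz (y - Q + 1)) => z x l b c' a' t Jt.
rewrite scalerA opr_nullE ?map0 // -[_ *: _]addr0.
apply: opr_null_lin; last exact: opr_null0.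
apply: opr_null_binop; first by left.
do 2![apply: opr_null_dpow; first by left].
by apply: HQ; clear -Jt; lia.
Qed.

Lemma outer_coef_bound y : exists J, forall x a b c' t, (J <= t)%N ->
  outer_coef x a y b c' t = 0.
Proof.
have [J HJ] := outer_term_bound y; exists J => x a b c' t Jt.
apply: big1 => a' _; move: (HJ 1 (x - n + t%:Z) (a - a')%N b c' a' t Jt).
by rewrite scale1r.
Qed.

Lemma fcomp_Y_IY x a y b c' :
  fcomp (Y_IY (modes A) i j) (fscale f (fexp (log_series i j k s c) S12))
    (texpo i j k x a y b r c') v =
  kappa *: nsum (outer_coef x a y b c').
Proof.
have [J1 HJ1] := outer_term_bound y; have [J2 HJ2] := outer_coef_bound y.
rewrite (nsumE (J := maxn J1 J2)) => [|t]; last first.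
  by rewrite geq_max => /andP[_]; apply: HJ2.
have S12n : exists D, iter D S12 v = 0 by exact: S12_nilpotent.
rewrite (fcomp_outer ij ik jk
  (C := fun x a y b w => Y x a (opr (Y y b) w)) Y_IY_coef _
  (fscale_fexp_supp ij ik jk f_supp)
  (fun t a b => fscale_fexp_dpow ij ik jk s c S12n f_supp f_coef t a b)
  (J := maxn J1 J2)).
- rewrite scaler_sumr; apply: eq_bigr => t _; rewrite scaler_sumr.
  by apply: eq_bigr => a' _; rewrite (mapZ (opr _)) mapZ.
- by move=> *; rewrite !map0.
- by move=> t a'; rewrite geq_max => /andP[Jt _]; apply: HJ1.
Qed.
End OuterProduct.

Section InnerProduct.
Variables i j k : 'I_3.
Hypotheses (ij : i != j) (ik : i != k) (jk : j != k).
Variables (s c : K) (v : V3) (f : fscalar K).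
Hypothesis f_supp : forall n (e : expo), (e k).1 = - n - 1 -> f e != 0 ->
  exists m : nat, e = texpo i j k (n - m%:Z) 0%N m%:Z 0%N (- n - 1) 0%N.
Hypothesis f_coef : forall n (m : nat),
  f (texpo i j k (n - m%:Z) 0%N m%:Z 0%N (- n - 1) 0%N) = (-1) ^+ m * binz K n m.

Definition inner_coef (x : int) (a : nat) (y : int) (b : nat) (z : int) (c' : nat) :
    nat -> V := fun t =>
  \sum_(b' < c'.+1) Y (z + x + t%:Z + 1) (c' - b') (opl (Y (y - t%:Z) b)
     ((-1) ^+ t *: binop ((x + t%:Z)%:~R *: id_hom V3 + s *: S13) t
       (dpow (s *: S13) a (dpow (c *: S13) b' v)))).

Lemma inner_term_bound y : exists J, forall x l b a b' z t, (J <= t)%N ->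
  Y x l (opl (Y (y - t%:Z) b) ((-1) ^+ t *:
    binop (z *: id_hom V3 + s *: S13) t
       (dpow (s *: S13) a (dpow (c *: S13) b' v)))) = 0.
Proof.
have [Q HQ] := opl_null_bound A v.
exists (absz (y - Q + 1)) => x l b a b' z t Jt.
rewrite opl_nullE ?map0 // -[_ *: _]addr0.
apply: opl_null_lin; last exact: opl_null0.
apply: opl_null_binop; do 2!apply: opl_null_dpow.
by apply: HQ; clear -Jt; lia.
Qed.

Lemma inner_coef_bound y : exists J, forall x a b z c' t, (J <= t)%N ->
  inner_coef x a y b z c' t = 0.
Proof.
have [J HJ] := inner_term_bound y; exists J => x a b z c' t Jt.
by apply: big1 => a' _; apply: HJ.
Qed.

Lemma fcomp_Y_YI x a y b z c' :
  fcomp (Y_YI (modes A) k j) (fscale f (fexp (log_series i j k s c) S13))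
    (texpo i j k x a y b z c') v =
  nsum (inner_coef x a y b z c').
Proof.
have [J1 HJ1] := inner_term_bound y; have [J2 HJ2] := inner_coef_bound y.
rewrite (nsumE (J := maxn J1 J2)) => [|t]; last first.
  by rewrite geq_max => /andP[_]; apply: HJ2.
have S13n : exists D, iter D S13 v = 0 by exact: S13_nilpotent.
have [kj ki ji] : [/\ k != j, k != i & j != i] by rewrite eq_sym jk eq_sym ik eq_sym ij.
have f_coef1 n m : f (texpo i j k (n - m%:Z) 0%N m%:Z 0%N (- n - 1) 0%N) =
    1 * ((-1) ^+ m * binz K n m) by rewrite mul1r.
rewrite (fcomp_inner ij ik jk
  (C := fun x a y b w => Y x a (opl (Y y b) w)) (Y_YI_coef kj ki ji) _
  (fun n => fscale_fexp_supp ij ik jk (@f_supp n))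
  (fun n t a b => fscale_fexp_dpow ij ik jk s c S13n (@f_supp n) (f_coef1 n) t a b)
  (J := maxn J1 J2)).
- apply: eq_bigr => t _; apply: eq_bigr => b' _; by rewrite scale1r.
- by move=> *; rewrite !map0.
- move=> t b'; rewrite geq_max => /andP[Jt _].
  by rewrite scale1r HJ1.
Qed.
End InnerProduct.

Lemma z12_powE i j N kappa (e : expo) (k : 'I_3) : i != j -> i != k -> j != k ->
  (forall e, fmono K (mono z1 1 0) e - fmono K (mono z2 1 0) e =
    kappa * (fmono K (mono i 1 0) e - fmono K (mono j 1 0) e)) ->
  z12_pow K N e = kappa ^+ N * zdiff_pow K i j N%:Z e.
Proof.
move=> ij ik jk E; rewrite -(fpow_diff ij ik jk) /z12_pow; congr (fpow _ _ _).
exact/funext.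
Qed.

Lemma vartheta_log_series i j k : vartheta K i j = log_series i j k 1 0.
Proof. by apply/funext => e; rewrite /log_series mul1r mul0r addr0. Qed.

Lemma texpo_swap i j k x a y b z c :
  texpo i j k x a y b z c = texpo j i k y b x a z c.
Proof. by rewrite /texpo [mono i _ _ + _]addrC. Qed.

Lemma outer_coefZ s c z v n x a y b c' t :
  outer_coef s c (z *: v) n x a y b c' t = z *: outer_coef s c v n x a y b c' t.
Proof.
rewrite /outer_coef scaler_sumr; apply: eq_bigr => a' _.
rewrite (dpowZ (c *: S12)) (dpowZ (s *: S12)) binopZ scale_swap.
by rewrite (mapZ (opr _)) mapZ.
Qed.

Lemma fcomp_z12_pow i j k N kappa v x l y l' : i != j -> i != k -> j != k ->
  (forall e, fmono K (mono z1 1 0) e - fmono K (mono z2 1 0) e =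
    kappa * (fmono K (mono i 1 0) e - fmono K (mono j 1 0) e)) ->
  fcomp (Y_IY (modes A) i j) (fscale (z12_pow K N) (fexp (vartheta K i j) S12))
    (texpo i j k x l y l' 0 0%N) v =
  kappa ^+ N *: nsum (outer_coef 1 0 v N%:Z x l y l' 0).
Proof.
move=> ij ik jk E; rewrite (vartheta_log_series i j k).
apply: (fcomp_Y_IY ij ik jk) => [e _|m].
  rewrite (z12_powE N _ ij ik jk E) mulf_eq0 negb_or => /andP[_].
  exact: zdiff_pow_supp.
by rewrite (z12_powE N _ ij ik jk E) (zdiff_pow_coef _ ij ik jk).
Qed.

(** The sign (-1)^N comes from z_12 = - z_21, while P12 absorbs the sign of exchanging a and b. *)
Lemma locality_coef p q a b : parity a p -> parity b q -> exists N : nat,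
  forall c x l y l',
  nsum (outer_coef 1 0 (a ⊗ b ⊗ c) N%:Z x l y l' 0) =
  (-1) ^+ N *: nsum (outer_coef 1 0 (P12 (a ⊗ b ⊗ c)) N%:Z y l' x l 0).
Proof.
move=> ap bq; have [N HN] := @braid_locality K V A p q a b ap bq; exists N => c x l y l'.
have := HN c (texpo z1 z2 z3 x l y l' 0 0%N).
rewrite (fcomp_z12_pow N (kappa := 1)) // => [|e]; last by rewrite mul1r.
rewrite texpo_swap (fcomp_z12_pow N (kappa := -1)) // => [|e]; last by rewrite mulN1r opprB.
rewrite expr1n scale1r => ->.
rewrite oplE (sflip_homog ap bq) tpureZl.
have [J HJ] := outer_coef_bound 1 0 (b ⊗ a ⊗ c) N%:Z x.
rewrite !(nsumE (J := J)) => [|t Jt|t Jt]; last 2 first.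
- by rewrite outer_coefZ HJ ?scaler0.
- exact: HJ.
rewrite scale_swap; congr (_ *: _); rewrite scaler_sumr; apply: eq_bigr => t _.
by rewrite outer_coefZ.
Qed.
End Locality.

(** * Consequences of the vacuum and covariance axioms *)

Section Vacuum.
Variables (K : numFieldType) (V : superspace K) (A : logVA V).
Local Notation V2 := (V ⊗ V)%type.
Local Notation V3 := (V ⊗ V ⊗ V)%type.
Local Notation S := (braid_op (braid A)).
Local Notation Y n k := (Ymap (modes A) n k).
Local Notation P := (sflip V V).
Local Notation P12 := (op12 P).
Local Notation P23 := (op23 P).
Local Notation S12 := (op12 S).
Local Notation S23 := (op23 S).
Local Notation S13 := (op13 S).
Local Notation vac := (vac A).
Local Notation T := (transl A).

Definition ins_vac (u : V2) : V3 := u ⊗ vac.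
Lemma ins_vac_linear : linear ins_vac.
Proof. by move=> c x y; rewrite /ins_vac tpureDl tpureZl. Qed.
HB.instance Definition _ := GRing.isLinear.Build K V2 V3 *:%R ins_vac ins_vac_linear.
Definition ins : Hom V2 V3 := ins_vac.

Lemma insE u : ins u = u ⊗ vac. Proof. by []. Qed.

Lemma S12_ins u : S12 (ins u) = ins (S u).
Proof. by rewrite !insE op12E. Qed.

Lemma P12_ins u : P12 (ins u) = ins (P u).
Proof. by rewrite !insE op12E. Qed.

Lemma S_vacr b : S (b ⊗ vac) = 0.
Proof. by rewrite -flip_vacl S_flip S_vacl map0. Qed.

Lemma S13_ins u : S13 (ins u) = 0.
Proof.
rewrite insE; elim/tensor_ind: u => [|a b u IHu]; first by rewrite tpure0l map0.
rewrite tpureDl mapD IHu addr0 S13E P23_vac op12E S_vacr tpure0l.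
exact: map0.
Qed.

Lemma opr_ins_eq0 q k u : (q < 0) || (0 < k)%N -> opr (Y q k) (ins u) = 0.
Proof.
move=> qk; rewrite insE; elim/tensor_ind: u => [|a b u IHu]; first by rewrite tpure0l map0.
rewrite tpureDl mapD IHu addr0 oprE; last exact: Y_even.
by rewrite YE vac_right_regular // tpure0r.
Qed.

Lemma opr_ins0 u : opr (Y 0 0) (ins u) = u.
Proof.
rewrite insE; elim/tensor_ind: u => [|a b u IHu]; first by rewrite tpure0l map0.
rewrite tpureDl mapD IHu oprE; last exact: Y_even.
by rewrite YE vac_right.
Qed.

(* Coefficient of z_2^0 zeta_1^(k+1) of locality on a (x) b (x) vac: there
   zeta_1 does not occur on the right-hand side. *)
Lemma Y_exp_sum m k u :
  \sum_(a < k.+2) Y m (k.+1 - a) (dpow S a u) = 0.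
Proof.
move: u; suff H : forall p q a b, parity a p -> parity b q ->
    \sum_(j < k.+2) Y m (k.+1 - j) (dpow S j (a ⊗ b)) = 0.
  pose F : Hom V2 V := \sum_(j < k.+2)
    ((Y m (k.+1 - j) \o dpow S j : {linear V2 -> V}) : Hom V2 V).
  have FE u : F u = \sum_(j < k.+2) Y m (k.+1 - j) (dpow S j u) by rewrite hom_sum.
  move=> u; rewrite -FE.
  apply: (@tensor_homog_ext _ _ _ _ F (0 : Hom V2 V)) => p q a b ap bq.
  by rewrite FE (H p q).
move=> p q a b ap bq; have [N HN] := locality_coef A ap bq.
(* In degree 0 of z_2 only t = 0 survives, because the inner field is regular on the vacuum. There
   the twist contributes z_1^N, hence the shift of m by N. *)
have := HN vac (m + N%:Z) k.+1 0 0%N.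
rewrite -[_ ⊗ vac]/(ins _) P12_ins.
have tw t a' w : (-1) ^+ t *: binop (N%:Z%:~R *: id_hom V3 + 1 *: S12) t
    (dpow (1 *: S12) a' (dpow (0 *: S12) 0 (ins w))) =
  ins ((-1) ^+ t *: binop (N%:Z%:~R *: id_hom V2 + 1 *: S) t (dpow S a' w)).
  rewrite dpow0 (mapZ ins) (binop_intertwine (h := ins) (G := N%:Z%:~R *: id_hom V3 + 1 *: S12)).
    by rewrite (dpow_intertwine (h := ins) (G := 1 *: S12)) // => x; rewrite homZ scale1r S12_ins.
  by move=> x; rewrite !homD !homZ mapD !(mapZ ins) S12_ins.
rewrite (nsumE (J := 1%N)) => [|[|t] // _]; last first.
  by apply: big1 => a' _; rewrite tw opr_ins_eq0 ?map0 //; apply/orP; left; lia.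
rewrite big_ord1 (nsumE (J := 0%N)) => [|t _]; last first.
  by apply: big1 => b' _; rewrite tw opr_ins_eq0 ?map0 // orbT.
rewrite big_ord0 scaler0 => H; rewrite -[RHS]H; apply: eq_bigr => a' _.
by rewrite tw binop0 subr0 opr_ins0 expr0 scale1r addrK.
Qed.

(* Y(z) = X(z) exp (- zeta S), where X is the part of Y free of zeta. *)
Lemma Y_dpow m k u : Y m k u = Y m 0 (dpow (- 1 *: S) k u).
Proof.
elim/ltn_ind: k u => [[|k]] IHk u; first by rewrite dpow0.
have := Y_exp_sum m k u; rewrite big_ord_recl /= dpow0 subn0 => /eqP.
rewrite addr_eq0 => /eqP ->.
under eq_bigr => j _ do rewrite IHk // /bump /= add1n subSS ?ltnS ?leq_subr //.
rewrite -(map_sum (Y m 0)) -mapN; congr (Y m 0 _).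
have SS : commuting (-1 *: S) S by move=> x; rewrite !homZ mapZ.
(* The coefficient of zeta^(k+1) in exp (- zeta S) exp (zeta S) = 1. *)
have := dpowD k.+1 u SS.
rewrite big_ord_recl /= dpow0 subn0 scaleN1r addNr => E.
apply/eqP; rewrite eq_sym -addr_eq0; apply/eqP; apply: etrans E _.
by rewrite dpowSE hom0 scaler0.
Qed.

Lemma T_even : even_hom T.
Proof. exact/parity_hom_even/transl_even. Qed.

Definition T2 : Hom V2 V2 := stensor (idfun : {linear V -> V}) T.

Lemma T2E a b : T2 (a ⊗ b) = a ⊗ T b.
Proof. exact/stensorE/T_even. Qed.

(** On X(z) exp (- zeta S) the summand z^-1 d/dzeta of D_z acts as - z^-1 S; this is the last
    term. *)
Lemma T_Y m u : T (Y m 0 u) =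
  Y m 0 (T2 u) + (m + 1)%:~R *: Y (m + 1) 0 u - Y (m + 1) 0 (S u).
Proof.
have -> : Y (m + 1) 0 (S u) = - Y (m + 1) 1 u.
  by rewrite (Y_dpow _ 1) dpowSE dpow0 invr1 scale1r homZ scaleN1r mapN opprK.
rewrite opprK; elim/tensor_ind: u => [|a b u IHu].
  by rewrite !map0 !addr0.
rewrite (mapD T2) !(mapD (Y _ _)) (mapD T) IHu T2E !YE scalerDr.
move/eqP: (covariance A a b m 0); rewrite subr_eq /Dz scale1r => /eqP ->.
rewrite [X in _ = X + _]addrACA [RHS]addrACA; congr (_ + _).
by rewrite [LHS]addrC addrA.
Qed.

(** In other words Y(b, z) 1 = exp (z T) b: on b (x) 1 the terms of [T_Y] with T2 and S vanish,
    which leaves the recursion of the exponential. *)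
Lemma Y_vac_dpow (q : nat) b : Y q%:Z 0 (b ⊗ vac) = dpow T q b.
Proof.
elim: q => [|q IHq]; first by rewrite YE vac_right dpow0.
apply: (@scalerSI _ _ q); rewrite dpowS -IHq T_Y T2E transl_vac tpure0r map0 add0r.
rewrite S_vacr map0 subr0 -[q.+1%:Z]/(1 + q)%:Z PoszD [1 + _]addrC.
by congr (_ *: _); rewrite intrD -natr1.
Qed.

Lemma dpow_T2 q a b : dpow T2 q (a ⊗ b) = a ⊗ dpow T q b.
Proof.
elim: q => [|q IHq]; first by rewrite !dpow0.
by rewrite !dpowSE IHq T2E tpureZr.
Qed.

Lemma opr_ins (q : nat) u : opr (Y q%:Z 0) (ins u) = dpow T2 q u.
Proof.
rewrite insE; elim/tensor_ind: u => [|a b u IHu].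
  by rewrite tpure0l !(map0 (opr _)) linear0.
rewrite tpureDl mapD IHu oprE; last exact: Y_even.
by rewrite Y_vac_dpow dpowDr dpow_T2.
Qed.

(** I (x) T is the z^1 coefficient of I (x) Y(z) on u (x) 1, so this is an instance of [S_opr] in
    which S13 vanishes. *)
Lemma S_T2 u : S (T2 u) = T2 (S u).
Proof.
have T2E1 w : T2 w = opr (Y 1%:Z 0) (ins w).
  by rewrite opr_ins dpowSE dpow0 invr1 scale1r.
by rewrite [in LHS]T2E1 S_opr S12_ins S13_ins addr0 -T2E1.
Qed.
End Vacuum.

(** * Locality and skew symmetry of the modes free of logarithms *)

Section SignsAndSums.
Variables (K : numFieldType).

Lemma signzD (a b : int) : (-1 : K) ^ (a + b) = (-1) ^ a * (-1) ^ b.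
Proof. by rewrite expfzDr // oppr_eq0 oner_eq0. Qed.

Lemma signzN (a : int) : (-1 : K) ^ (- a) = (-1) ^ a.
Proof. by rewrite -exprz_inv invrN invr1. Qed.

Lemma signr_nat (n : nat) : (-1 : K) ^+ n * (-1) ^+ n = 1.
Proof. by rewrite -expr2 sqrr_sign. Qed.

Lemma triangle_sum (U : zmodType) (f : nat -> nat -> U) n :
  \sum_(a < n) \sum_(b < n - a) f a b = \sum_(r < n) \sum_(a < r.+1) f a (r - a)%N.
Proof.
elim: n => [|n IHn]; first by rewrite !big_ord0.
rewrite [RHS]big_ord_recr /= -IHn [LHS]big_ord_recr /= subSnn big_ord1.
rewrite [in RHS]big_ord_recr /= subnn addrA -big_split /=; congr (_ + _).
by apply: eq_bigr => a _; rewrite (subSn (ltnW (ltn_ord a))) big_ord_recr.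
Qed.

Lemma triangle_swap (U : zmodType) (f : nat -> nat -> U) n :
  \sum_(a < n) \sum_(b < n - a) f a b = \sum_(b < n) \sum_(a < n - b) f a b.
Proof.
rewrite triangle_sum (triangle_sum (fun b a => f a b)); apply: eq_bigr => r _.
rewrite (reindex_inj rev_ord_inj); apply: eq_bigr => a _ /=.
by rewrite subSS subKn // -ltnS.
Qed.

Lemma binop_diag (U : lmodType K) (t : nat) (w : U) : binop (t%:R *: id_hom U) t w = w.
Proof.
rewrite -[t%:R]/(t%:Z%:~R) -binz_binop.
suff -> : binz K t t = 1 by rewrite scale1r.
elim: t => [|t IHt]; first by rewrite /binz big_ord0 divr1.
rewrite -[t.+1%:Z]/(1 + t)%:Z PoszD [_ + t%:Z]addrC binz_pascal IHt.
have /eqP := binzS K t t; rewrite subrr mul0r mulf_eq0 pnatr_eq0 => /eqP ->.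
by rewrite add0r.
Qed.
End SignsAndSums.

Section ModeSums.
Variables (K : numFieldType) (V V2 V3 : lmodType K).
Variables (X : int -> Hom V2 V) (X2 : int -> Hom V3 V2) (S12 P12 : Hom V3 V3).

Definition shift (U : lmodType K) (n : int) (F : Hom U U) : Hom U U :=
  n%:~R *: id_hom U + F.

Lemma shiftD (U : lmodType K) n (F : Hom U U) : shift (n + 1) F = shift n F + id_hom U.
Proof. by rewrite /shift intrD scalerDl scale1r addrAC. Qed.

Lemma shiftE (U : lmodType K) n (F : Hom U U) u : shift n F u = n%:~R *: u + F u.
Proof. by []. Qed.

Lemma commuting_shift (U : lmodType K) m n (F G : Hom U U) :
  commuting F G -> commuting (shift m F) (shift n G).
Proof.
move=> FG u; rewrite !shiftE (mapD F) (mapD G) (mapZ F) (mapZ G) FG.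
by rewrite !scalerDr scale_swap addrACA.
Qed.

(* [modes_sum n p q v] is the coefficient of z_1^(p+n) z_2^q in
   X(z_1) (I (x) X(z_2)) z_1^n (1 - z_2 / z_1)^(n + S12) v. *)
Definition modes_term n p q (v : V3) t : V :=
  (-1) ^+ t *: X (p + t%:Z) (X2 (q - t%:Z) (binop (shift n S12) t v)).

Definition modes_sum n p q v : V := nsum (modes_term n p q v).

Hypothesis X2_bound : forall v, exists Q : int, forall q, q < Q ->
  forall n t, X2 q (binop (shift n S12) t v) = 0.

Lemma modes_term_bound v q : exists J : nat, forall n p t, (J <= t)%N ->
  modes_term n p q v t = 0.
Proof.
have [Q HQ] := X2_bound v; exists (absz (q - Q + 1)) => n p t Jt.
by rewrite /modes_term HQ ?map0 ?scaler0 //; lia.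
Qed.

Lemma modes_sumD n p q v w :
  modes_sum n p q (v + w) = modes_sum n p q v + modes_sum n p q w.
Proof.
have [J1 H1] := modes_term_bound v q; have [J2 H2] := modes_term_bound w q.
have E t : modes_term n p q (v + w) t = modes_term n p q v t + modes_term n p q w t.
  by rewrite /modes_term binopDr (mapD (X2 _)) (mapD (X _)) scalerDr.
have JJ t : (maxn J1 J2 <= t)%N -> modes_term n p q v t = 0 /\ modes_term n p q w t = 0.
  by rewrite geq_max => /andP[/H1 -> /H2 ->].
rewrite /modes_sum !(nsumE (J := maxn J1 J2)) => [|t /JJ[]|t /JJ[]|t /JJ[E1 E2]] //.
  by rewrite -big_split; apply: eq_bigr => t _; apply: E.
by rewrite E E1 E2 addr0.
Qed.

(** Multiplication by z_1 - z_2, through Pascal's rule for the operator n + S12. *)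
Lemma modes_sum_pascal n p q v :
  modes_sum (n + 1) p q v = modes_sum n p q v - modes_sum n (p + 1) (q - 1) v.
Proof.
have [J1 H1] := modes_term_bound v q; have [J2 H2] := modes_term_bound v (q - 1).
set J := maxn J1 J2; rewrite /modes_sum (nsumE (J := J.+1)) => [|t]; last first.
  by move/ltnW; rewrite geq_max => /andP[/H1 -> _].
rewrite (nsumE (J := J.+1)) => [|t]; last first.
  by move/ltnW; rewrite geq_max => /andP[/H1 -> _].
rewrite (nsumE (J := J)) => [|t]; last by rewrite geq_max => /andP[_ /H2 ->].
rewrite big_ord_recl [X in _ = X - _]big_ord_recl -addrA; congr (_ + _).
rewrite -sumrB; apply: eq_bigr => t _.
rewrite /modes_term !lift0 shiftD binop_pascal (mapD (X2 _)) (mapD (X _)).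
rewrite scalerDr; congr (_ + _); rewrite exprS mulN1r scaleNr; congr (- _).
by congr (_ *: X _ (X2 _ _)); lia.
Qed.

Definition local_at (n : nat) v := forall x y : int,
  modes_sum n%:Z (x - n%:Z) y v = (-1) ^+ n *: modes_sum n%:Z (y - n%:Z) x (P12 v).

Lemma local_atS n v : local_at n v -> local_at n.+1 v.
Proof.
move=> Hn x y; rewrite -[n.+1%:Z]/(1 + n)%:Z PoszD [1 + _]addrC !modes_sum_pascal.
have -> : x - (n%:Z + 1) = (x - 1) - n%:Z by ring.
have -> : x - 1 - n%:Z + 1 = x - n%:Z by ring.
have -> : y - (n%:Z + 1) = (y - 1) - n%:Z by ring.
have -> : y - 1 - n%:Z + 1 = y - n%:Z by ring.
by rewrite !Hn exprS mulN1r scaleNr scalerBr opprB.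
Qed.

Lemma local_at_leq m n v : (m <= n)%N -> local_at m v -> local_at n v.
Proof.
move/subnK <-; elim: (n - m)%N => // d IHd Hm.
by rewrite addSn; apply/local_atS/IHd.
Qed.

Lemma local_atD n v w : local_at n v -> local_at n w -> local_at n (v + w).
Proof. by move=> Hv Hw x y; rewrite mapD !modes_sumD Hv Hw scalerDr. Qed.

Section Skew.
Variables (T : Hom V V) (T2 S P : Hom V2 V2) (ins : Hom V2 V3).
Hypothesis T_X : forall m u, T (X m u) =
  X m (T2 u) + (m + 1)%:~R *: X (m + 1) u - X (m + 1) (S u).
Hypothesis S_T2 : forall u, S (T2 u) = T2 (S u).

(* X(z) (I (x) exp (w T)) = exp (w T) X(z - w) (1 - w / z)^(-S) *)
Lemma X_dpow_T2 i m u : X m (dpow T2 i u) =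
  \sum_(l < i.+1) (-1) ^+ l *:
    dpow T (i - l) (X (m + l%:Z) (binop (shift (m + l%:Z) (- S)) l u)).
Proof.
elim: i m u => [|i IHi] m u.
  by rewrite big_ord1 !dpow0 binop0 scale1r addr0.
have XT2 w : X m (T2 w) = T (X m w) - X (m + 1) (shift (m + 1) (- S) w).
  rewrite T_X shiftE -[(- S) w]/(- S w) (mapB (X _)) (mapZ (X _)).
  by rewrite opprB addrA subrK addrK.
apply: (@scalerSI _ _ i).
rewrite -(mapZ (X m)) dpowS XT2 IHi.
have -> : shift (m + 1) (- S) (dpow T2 i u) = dpow T2 i (shift (m + 1) (- S) u).
  rewrite (dpow_intertwine (h := shift (m + 1) (- S)) (G := T2)) // => w.
  by rewrite !shiftE -![(- S) _]/(- S _) (mapB T2) (mapZ T2) S_T2.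
rewrite IHi (map_sum T).
(* The factor i + 1 = (i + 1 - l) + l is distributed: [E1] absorbs the first part into the power of
   T, [E2] the second into the binomial. *)
have E1 : \sum_(l < i.+1) T ((-1) ^+ l *: dpow T (i - l) (X (m + l%:Z)
      (binop (shift (m + l%:Z) (- S)) l u))) =
    \sum_(l < i.+2) (i.+1 - l)%N%:R *: ((-1) ^+ l *: dpow T (i.+1 - l) (X (m + l%:Z)
      (binop (shift (m + l%:Z) (- S)) l u))).
  rewrite [RHS]big_ord_recr /= subnn scale0r addr0; apply: eq_bigr => l _.
  by rewrite (mapZ T) -dpowS scale_swap subSn // -ltnS.
have E2 : \sum_(l < i.+1) (-1) ^+ l *: dpow T (i - l) (X (m + 1 + l%:Z)
      (binop (shift (m + 1 + l%:Z) (- S)) l (shift (m + 1) (- S) u))) =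
    - \sum_(l < i.+2) l%:R *: ((-1) ^+ l *: dpow T (i.+1 - l) (X (m + l%:Z)
      (binop (shift (m + l%:Z) (- S)) l u))).
  rewrite [in RHS]big_ord_recl scale0r add0r -sumrN; apply: eq_bigr => l _.
  rewrite !lift0 subSS scale_swap -(dpowZ T _ l.+1%:R) -(mapZ (X _) l.+1%:R) binopS.
  rewrite exprS mulN1r scaleNr opprK; congr (_ *: dpow T _ _).
  have -> : m + l.+1%:Z = m + 1 + l%:Z by lia.
  congr (X _ _).
  have sh w : shift (m + 1 + l%:Z) (- S) w - l%:R *: w = shift (m + 1) (- S) w.
    rewrite !shiftE addrAC -scalerBl; congr (_ *: _ + _).
    by rewrite intrD addrK.
  rewrite sh -(binop_intertwine (h := shift (m + 1) (- S))
    (F := shift (m + 1 + l%:Z) (- S))) // => w.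
  by apply: commuting_shift => x.
rewrite E1 E2 opprK -big_split scaler_sumr; apply: eq_bigr => l _ /=.
by rewrite -scalerDl -natrD subnK // -ltnS.
Qed.

Hypothesis X_bound : forall u, exists Q : int, forall q, q < Q -> X q u = 0.
Hypothesis S12_ins : forall u, S12 (ins u) = ins (S u).
Hypothesis P12_ins : forall u, P12 (ins u) = ins (P u).
Hypothesis X2_ins_neg : forall q u, q < 0 -> X2 q (ins u) = 0.
Hypothesis X2_ins : forall (q : nat) u, X2 q%:Z (ins u) = dpow T2 q u.
Hypothesis local_ins : forall u, exists N : nat, forall n, (N <= n)%N -> local_at n (ins u).

Lemma binop_ins n t u : binop (shift n S12) t (ins u) = ins (binop (shift n S) t u).
Proof.
apply/esym/(binop_intertwine (h := ins)) => w.
by rewrite !shiftE (mapD ins) (mapZ ins) S12_ins.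
Qed.

(* Coefficient of z_2^0 in locality on the vacuum; the powers of 1 - w / z cancel
   by Vandermonde's identity. *)
Lemma skew m u : exists H0 : nat, forall H, (H0 <= H)%N ->
  X m u = \sum_(h < H) (-1) ^ (m - h%:Z) *: dpow T h (X (m - h%:Z) (P u)).
Proof.
have [N HN] := local_ins u; have [Q HQ] := X_bound (P u).
(* This n is large enough for locality, it makes m + n a natural number M, and for h > M it gives m
   - h < - n <= Q, so that these terms vanish. *)
pose n := (N + absz m + absz Q)%N; pose M := absz (m + n%:Z).
have ME : M%:Z = m + n%:Z by rewrite /M; lia.
exists M.+1 => H MH.
rewrite -(big_mkord xpredT (fun h => (-1) ^ (m - h%:Z) *: dpow T h (X (m - h%:Z) (P u)))).
rewrite (big_cat_nat (n := M.+1)) //= [X in _ + X]big1_seq ?addr0; last first.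
  move=> h /=; rewrite mem_index_iota => /andP[Mh _].
  by rewrite HQ ?linear0 ?scaler0 //; move: ME Mh; rewrite /n; lia.
rewrite big_mkord.
have nN : (N <= n)%N by rewrite /n -addnA leq_addr.
have := HN n nN (m + n%:Z) 0; rewrite addrK sub0r P12_ins.
rewrite /modes_sum (nsumE (J := 1%N)) => [|[|t] // _]; last first.
  by rewrite /modes_term binop_ins X2_ins_neg ?map0 ?scaler0 //; lia.
rewrite big_ord1 /modes_term binop0 expr0 scale1r addr0 subr0.
rewrite -[0]/(0%:Z) X2_ins dpow0 => ->.
rewrite (nsumE (J := M.+1)) => [|t Mt]; last first.
  by rewrite /modes_term binop_ins X2_ins_neg ?map0 ?scaler0 //; lia.
pose f t l := (-1) ^+ (t + l) *: dpow T (M - t - l) (X (- n%:Z + (t + l)%N%:Z)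
  (binop (shift (- n%:Z + (t + l)%N%:Z) (- S)) l (binop (shift n%:Z S) t (P u)))).
transitivity ((-1) ^+ n *: \sum_(t < M.+1) \sum_(l < M.+1 - t) f t l).
  congr (_ *: _); apply: eq_bigr => t _; have tM : (t <= M)%N by rewrite -ltnS.
  rewrite binop_ins -ME subzn // X2_ins X_dpow_T2 scaler_sumr subSn //.
  apply: eq_bigr => l _; rewrite scalerA -exprD /f.
  by rewrite -addrA -PoszD.
rewrite triangle_sum scaler_sumr (reindex_inj rev_ord_inj); apply: eq_bigr => h _ /=.
have hM : (h <= M)%N by rewrite -ltnS.
rewrite subSS.
have -> : m - h%:Z = - n%:Z + (M - h)%N%:Z by rewrite -subzn // ME; ring.
set r := (M - h)%N.
transitivity ((-1) ^+ n *: ((-1) ^+ r *: dpow T h (X (- n%:Z + r%:Z)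
    (\sum_(t < r.+1) binop (shift (- n%:Z + r%:Z) (- S)) (r - t)
       (binop (shift n%:Z S) t (P u)))))).
  congr (_ *: _); rewrite (map_sum (X _)) (linear_sum (dpow T h)) scaler_sumr.
  apply: eq_bigr => t _; have tr : (t <= r)%N by rewrite -ltnS.
  by rewrite /f subnKC // -subnDA subnKC // /r subKn.
rewrite vandermonde; last first.
  by apply: commuting_shift => x; rewrite -![(- S) _]/(- S _) mapN.
(* Both n and S cancel, and what remains is the binomial C(r, r) = 1. *)
have -> : shift (- n%:Z + r%:Z) (- S) + shift n%:Z S = r%:R *: id_hom V2.
  rewrite /shift addrACA addNr addr0 -scalerDl; congr (_ *: _).
  by rewrite -intrD addrAC addNr add0r.
rewrite binop_diag scalerA; congr (_ *: _).
by rewrite signzD signzN.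
Qed.

End Skew.
End ModeSums.

(** * Weak associativity and the Borcherds identity *)

Section UpperNegation.
Variables (K : numFieldType) (U : lmodType K).
Implicit Types F : Hom U U.

Lemma binop_absorb F t (w : U) :
  t.+1%:R *: binop (F + id_hom U) t.+1 w = binop F t (F w + w).
Proof.
rewrite binop_pascal scalerDr binopS -natr1 scalerDl scale1r addrA subrK.
rewrite binopDr; congr (_ + _).
by rewrite (binop_intertwine (h := F) (G := F)).
Qed.

(** Needed because moving fields past exponentials, and expanding powers of z_13, give exponents of
    the form t - 1 - F, whereas the Borcherds identity has F itself. *)
Lemma binop_upper_neg F t (w : U) :
  binop (shift (t%:Z - 1) (- F)) t w = (-1) ^+ t *: binop F t w.
Proof.
elim: t w => [|t IHt] w; first by rewrite scale1r.
apply: (@scalerSI _ _ t).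
have -> : shift (t.+1%:Z - 1) (- F) = shift (t%:Z - 1) (- F) + id_hom U.
  by rewrite -shiftD; congr shift; lia.
rewrite binop_absorb IHt scale_swap exprS -scalerA binopS.
rewrite shiftE -[(- F) w]/(- F w) addrAC -[X in _ *: w + X]scale1r -scalerDl.
rewrite binopDr binopZ (_ : binop F t (- F w) = - F (binop F t w)); last first.
  rewrite -scaleN1r binopZ scaleN1r; congr (- _).
  by rewrite (binop_intertwine (h := F) (G := F)).
rewrite (_ : (t%:Z - 1)%:~R + 1 = t%:R :> K); last by rewrite intrD subrK.
by rewrite [RHS]scaleN1r -[RHS]scalerN opprB.
Qed.
End UpperNegation.

Section Borcherds.
Variables (K : numFieldType) (V V2 V3 : lmodType K).
Variables (X : int -> Hom V2 V) (X1 X2 : int -> Hom V3 V2).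
Variables (S12 S13 P12 P23 : Hom V3 V3) (S P T2 : Hom V2 V2) (T : Hom V V).
Local Notation msum := (modes_sum X X2 S12).
Local Notation local_at := (local_at X X2 S12 P12).

Hypothesis X_bound : forall u, exists Q : int, forall q, q < Q -> X q u = 0.
Hypothesis X1_bound : forall v, exists Q : int, forall q, q < Q ->
  forall n t, X1 q (binop (shift n S13) t v) = 0.
Hypothesis X2_bound : forall v, exists Q : int, forall q, q < Q -> forall n t,
  X2 q (binop (shift n S12) t v) = 0 /\ X2 q (binop (shift n S13) t v) = 0.
Hypothesis T_X : forall m u, T (X m u) =
  X m (T2 u) + (m + 1)%:~R *: X (m + 1) u - X (m + 1) (S u).
Hypothesis S_T2 : forall u, S (T2 u) = T2 (S u).
Hypothesis X_skew : forall m u H,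
  (forall h, (H <= h)%N -> X (m - h%:Z) (P u) = 0) ->
  X m u = \sum_(h < H) (-1) ^ (m - h%:Z) *: dpow T h (X (m - h%:Z) (P u)).
Hypothesis X2_skew : forall m v H,
  (forall h, (H <= h)%N -> X2 (m - h%:Z) (P23 v) = 0) ->
  X2 m v = \sum_(h < H) (-1) ^ (m - h%:Z) *: dpow T2 h (X2 (m - h%:Z) (P23 v)).
Hypothesis P_X1 : forall q v, P (X1 q v) = X2 q (P12 (P23 v)).
Hypothesis S_X2 : forall q v, S (X2 q v) = X2 q (S12 v + S13 v).
Hypothesis S12_S13 : commuting S12 S13.
Hypothesis P12_S12 : forall v, P12 (S12 v) = S12 (P12 v).
Hypothesis P23_S12 : forall v, P23 (S12 v) = S13 (P23 v).
Hypothesis P23_S13 : forall v, P23 (S13 v) = S12 (P23 v).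
Hypothesis local : forall v, exists N : nat, forall n, (N <= n)%N -> local_at n v.

Lemma X2_bound12 v : exists Q : int, forall q, q < Q ->
  forall n t, X2 q (binop (shift n S12) t v) = 0.
Proof. by have [Q HQ] := X2_bound v; exists Q => q qQ n t; case: (HQ q qQ n t). Qed.

(* [assoc_sum m k n v] is the coefficient of z_2^k z_3^(-n-1) in
   X(z_2) (X(z_3) (x) I) z_2^m (1 + z_3 / z_2)^(m + S13) v. *)
Definition assoc_term m k n v t : V :=
  X (k - m + t%:Z) (X1 (- n - 1 - t%:Z) (binop (shift m S13) t v)).
Definition assoc_sum m k n v := nsum (assoc_term m k n v).

Lemma assoc_term_bound v n : exists J : nat, forall m k t, (J <= t)%N ->
  assoc_term m k n v t = 0.
Proof.
have [Q HQ] := X1_bound v; exists (absz (- n - 1 - Q + 1)) => m k t Jt.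
by rewrite /assoc_term HQ ?map0 //; lia.
Qed.

(** Multiplication by z_2 + z_3, which plays the role of z_1. *)
Lemma assoc_sum_pascal m k n v :
  assoc_sum (m + 1) k n v = assoc_sum m (k - 1) n v + assoc_sum m k (n + 1) v.
Proof.
have [J1 H1] := assoc_term_bound v n; have [J2 H2] := assoc_term_bound v (n + 1).
set J := maxn J1 J2; rewrite /assoc_sum (nsumE (J := J.+1)) => [|t]; last first.
  by move/ltnW; rewrite geq_max => /andP[/H1 -> _].
rewrite (nsumE (J := J.+1)) => [|t]; last first.
  by move/ltnW; rewrite geq_max => /andP[/H1 -> _].
rewrite (nsumE (J := J)) => [|t]; last by rewrite geq_max => /andP[_ /H2 ->].
rewrite big_ord_recl [X in _ = X + _]big_ord_recl -addrA; congr (_ + _).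
  by rewrite /assoc_term !binop0; congr (X _ _); lia.
rewrite -big_split; apply: eq_bigr => t _.
rewrite /assoc_term !lift0 shiftD binop_pascal (mapD (X1 _)) (mapD (X _)).
by congr (X _ (X1 _ _) + X _ (X1 _ _)); lia.
Qed.

(* Both sides of the associativity relation reduce to this expansion: the left
   one by commuting X past the exponential of T2, the right one by skew symmetry. *)
Definition skew_expansion J m k n w : V :=
  \sum_(h < J) (-1) ^ (k - h%:Z) *: dpow T h (msum m (- n - 1 - m) (k - h%:Z) w).

(** Skew symmetry of the inner field brings out exp (z_2 T2), and [X_dpow_T2] moves X past it. This
    adds the exponent - (S12 + S13), by the hexagon relation, to the n + S13 of the flipped twist;
    upper negation turns the sum into m + S12. The second clause allows J to be enlarged later. *)
Lemma modes_sum_skew m k n v : exists J : nat,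
  msum n (- m - 1 - n) k v = skew_expansion J m k n (P23 v) /\
  forall h, (J <= h)%N -> msum m (- n - 1 - m) (k - h%:Z) (P23 v) = 0.
Proof.
have [Q1 HQ1] := X2_bound v; have [Q2 HQ2] := X2_bound (P23 v).
pose J := (absz (k - Q1 + 1)%R + absz (k - Q2 + 1)%R)%N.
have J1 t : (J <= t)%N -> k - t%:Z < Q1 by rewrite /J; lia.
have J2 t : (J <= t)%N -> k - t%:Z < Q2 by rewrite /J; lia.
exists J; split; last first.
  move=> h Jh; rewrite /modes_sum (nsumE (J := 0%N)) ?big_ord0 // => t _.
  rewrite /modes_term; have [|-> _] := HQ2 (k - h%:Z - t%:Z) _ m t.
    by have := J2 h Jh; lia.
  by rewrite map0 scaler0.
set p := - m - 1 - n.
have w0 t h : (J <= t + h)%N -> X2 (k - t%:Z - h%:Z) (binop (shift n S13) t (P23 v)) = 0.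
  by move=> Jth; have [|_ ->] := HQ2 (k - t%:Z - h%:Z) _ n t => //; have := J2 _ Jth; lia.
have P23_binop t : P23 (binop (shift n S12) t v) = binop (shift n S13) t (P23 v).
  apply: binop_intertwine => u.
  by rewrite !shiftE (mapD P23) (mapZ P23) P23_S12.
pose g t h l := ((-1) ^+ t * (-1) ^ (k - t%:Z - (h + l)%N%:Z) * (-1) ^+ l) *:
  dpow T h (X (p + t%:Z + l%:Z) (binop (shift (p + t%:Z + l%:Z) (- S)) l
    (X2 (k - t%:Z - (h + l)%N%:Z) (binop (shift n S13) t (P23 v))))).
transitivity (\sum_(t < J) \sum_(r < J - t) \sum_(l < r.+1) g t (r - l)%N l).
  rewrite /modes_sum (nsumE (J := J)) => [|t Jt]; last first.
    by rewrite /modes_term; have [-> _] := HQ1 _ (J1 t Jt) n t; rewrite map0 scaler0.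
  apply: eq_bigr => t _.
  rewrite /modes_term (@X2_skew _ _ (J - t)) => [|h Jh]; last first.
    by rewrite P23_binop w0 // -leq_subLR.
  rewrite (map_sum (X _)) scaler_sumr; apply: eq_bigr => r _.
  rewrite (mapZ (X _)) (X_dpow_T2 T_X S_T2) !scaler_sumr; apply: eq_bigr => l _.
  have lr : (l <= r)%N by rewrite -ltnS.
  by rewrite P23_binop /g subnK // !scalerA.
(* The sum over h goes outside, since exp (z_2 T) stands in front of the whole expansion. *)
pose G t h := \sum_(l < J - t - h) g t h l.
transitivity (\sum_(t < J) \sum_(h < J - t) G t h).
  apply: eq_bigr => t _; rewrite -(triangle_sum (fun l h => g t h l)).
  by rewrite (triangle_swap (fun l h => g t h l)).
rewrite triangle_swap /skew_expansion; apply: eq_bigr => h _.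
transitivity (\sum_(t < J - h) \sum_(l < J - h - t) g t h l).
  by apply: eq_bigr => t _; rewrite /G subnAC.
rewrite (triangle_sum (fun t l => g t h l)) /modes_sum
    (nsumE (J := (J - h)%N)) => [|t Jt]; last first.
  rewrite /modes_term; have [|-> _] := HQ2 (k - h%:Z - t%:Z) _ m t.
    by have := J2 (h + t)%N; lia.
  by rewrite map0 scaler0.
rewrite (linear_sum (dpow T h)) scaler_sumr; apply: eq_bigr => r _ /=.
pose q := k - h%:Z - r%:Z.
transitivity ((-1) ^ (k - h%:Z) *: dpow T h (X (p + r%:Z) (X2 q
   (\sum_(t < r.+1) binop (shift (p + r%:Z) (- (S12 + S13))) (r - t)
      (binop (shift n S13) t (P23 v)))))).
  rewrite (map_sum (X2 _)) (map_sum (X _)) (linear_sum (dpow T h)) scaler_sumr.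
  apply: eq_bigr => t _; have tr : (t <= r)%N by rewrite -ltnS.
  rewrite /g; congr (_ *: dpow T h _).
    have -> : k - t%:Z - (h + (r - t))%N%:Z = k - h%:Z - r%:Z by lia.
    rewrite signzD signzN mulrAC -exprD subnKC // mulrC -mulrA.
    by rewrite -exprnP signr_nat mulr1.
  have -> : p + t%:Z + (r - t)%N%:Z = p + r%:Z by lia.
  have -> : k - t%:Z - (h + (r - t))%N%:Z = q by rewrite /q; lia.
  congr (X _ _); apply/esym; apply: (binop_intertwine (h := X2 q)) => w.
  rewrite !shiftE -[(- S) _]/(- S _) S_X2 (mapD (X2 q)) (mapZ (X2 q)).
  by rewrite -[(- (S12 + S13)) w]/(- (S12 w + S13 w)) (mapN (X2 q)).
rewrite vandermonde; last first.
  apply: commuting_shift => w.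
  rewrite -![(- (S12 + S13)) _]/(- (S12 _ + S13 _)) (mapN S13) (mapD S13).
  by rewrite S12_S13.
have -> : shift (p + r%:Z) (- (S12 + S13)) + shift n S13 = shift (r%:Z - 1) (- shift m S12).
  apply: homP => w; rewrite homD !shiftE.
  rewrite -[(- (S12 + S13)) w]/(- (S12 w + S13 w)).
  rewrite -[(- shift m S12) w]/(- (m%:~R *: w + S12 w)).
  rewrite addrACA -scalerDl !opprD subrK addrA -scalerBl -intrD -intrB.
  by congr (_%:~R *: _ - _); rewrite /p; ring.
rewrite binop_upper_neg (mapZ (X2 q)) (mapZ (X _)); congr (_ *: dpow T h (_ *: X _ _)).
by rewrite /p; ring.
Qed.

Lemma X_bound_fin (u : nat -> V2) J :
  exists Q : int, forall t, (t < J)%N -> forall q, q < Q -> X q (u t) = 0.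
Proof.
elim: J => [|J [Q HQ]]; first by exists 0.
have [Q' HQ'] := X_bound (u J); exists (Num.min Q Q') => t.
rewrite ltnS leq_eqVlt => /orP[/eqP->|tJ] q; rewrite lt_min => /andP[q1 q2].
  exact: HQ'.
exact: (HQ t).
Qed.

(** On a (x) b (x) c, skew symmetry of the outer field puts c in front of the product of a and b, up
    to sign. Locality for [P23 v], where a and c are adjacent, then restores the order a, c, b. *)
Lemma assoc_sum_skew m k n v : local_at m (P23 v) -> exists H0, forall H, (H0 <= H)%N ->
  assoc_sum m%:Z k n v = skew_expansion H m%:Z k n (P23 v).
Proof.
move=> loc; set w := P12 (P23 v).
have [J1 HJ1] := assoc_term_bound v n.
have [J2 HJ2] := modes_term_bound X X2_bound12 w (- n - 1).
pose J := maxn J1 J2; pose u t := X1 (- n - 1 - t%:Z) (binop (shift m%:Z S13) t v).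
have [Q HQ] := X_bound_fin (fun t => P (u t)) J.
exists (absz (k - m%:Z + J%:Z - Q)%R + 1)%N => H HH.
have XH t h : (t < J)%N -> (H <= h)%N -> X (k - m%:Z + t%:Z - h%:Z) (P (u t)) = 0.
  by move=> tJ Hh; apply: HQ => //; lia.
rewrite /assoc_sum (nsumE (J := J)) => [|t]; last by rewrite geq_max => /andP[/HJ1 -> _].
have P_u t : P (u t) = X2 (- n - 1 - t%:Z) (binop (shift m%:Z S12) t w).
  rewrite /u P_X1; congr (X2 _ _).
  rewrite (binop_intertwine (h := P23) (G := shift m%:Z S12)) => [|x]; last first.
    by rewrite !shiftE (mapD P23) (mapZ P23) P23_S13.
  rewrite (binop_intertwine (h := P12) (G := shift m%:Z S12)) // => x.
  by rewrite !shiftE (mapD P12) (mapZ P12) P12_S12.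
transitivity (\sum_(t < J) \sum_(h < H) (-1) ^ (k - m%:Z + t%:Z - h%:Z) *:
    dpow T h (X (k - m%:Z + t%:Z - h%:Z) (P (u t)))).
  by apply: eq_bigr => t _; rewrite /assoc_term -/(u t) (@X_skew _ _ H) // => h; apply: XH.
rewrite exchange_big /skew_expansion; apply: eq_bigr => h _.
have -> : msum m%:Z (- n - 1 - m%:Z) (k - h%:Z) (P23 v) =
    (-1) ^+ m *: msum m%:Z (k - h%:Z - m%:Z) (- n - 1) w by apply: loc.
rewrite /modes_sum (nsumE (J := J)) => [|t]; last first.
  by rewrite geq_max => /andP[_ /HJ2 ->].
rewrite dpowZ scalerA (linear_sum (dpow T h)) scaler_sumr; apply: eq_bigr => t _ /=.
rewrite P_u /modes_term dpowZ scalerA.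
have -> : k - m%:Z + t%:Z - h%:Z = k - h%:Z - m%:Z + t%:Z by ring.
by congr (_ *: _); rewrite !signzD !signzN.
Qed.

(** Both sides have the same skew expansion up to truncation. The condition on m involves neither k
    nor n, which makes the relation usable in the recursion. *)
Lemma weak_associativity m k n v : local_at m (P23 v) ->
  msum n (- m%:Z - 1 - n) k v = assoc_sum m%:Z k n v.
Proof.
move=> loc; have [J [-> HJ]] := modes_sum_skew m k n v.
have [H0 HH0] := assoc_sum_skew k n loc.
rewrite (HH0 (maxn H0 J)) ?leq_maxl // /skew_expansion.
rewrite -!(big_mkord xpredT (fun h => (-1) ^ (k - h%:Z) *:
  dpow T h (msum m%:Z (- n - 1 - m%:Z) (k - h%:Z) (P23 v)))).
rewrite [RHS](big_cat_nat (n := J)) ?leq_maxr //= [X in _ = _ + X]big1_seq ?addr0 //.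
move=> h /=; rewrite mem_index_iota => /andP[Jh _].
by rewrite HJ // linear0 scaler0.
Qed.

Definition jacobi_defect m k n v : V :=
  msum n (- m - 1 - n) k v
  - (-1) ^ n *: msum n (k - n) (- m - 1) (P12 v) - assoc_sum m k n v.

(* Multiplication by z_1 - z_2 and by z_3 agree on each of the three terms. *)
Lemma jacobi_defect_rec m k n v : jacobi_defect m k n v =
  jacobi_defect (m + 1) (k + 1) n v - jacobi_defect m (k + 1) (n + 1) v.
Proof.
rewrite /jacobi_defect assoc_sum_pascal !modes_sum_pascal; try exact: X2_bound12.
have E1 : - m - 1 - (n + 1) = - (m + 1) - 1 - n by ring.
have E2 : - (m + 1) - 1 - n + 1 = - m - 1 - n by ring.
have E3 : k + 1 - (n + 1) = k - n by ring.
have E4 : k - n + 1 = k + 1 - n by ring.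
have E5 : - m - 1 - 1 = - (m + 1) - 1 by ring.
rewrite E1 E2 E3 E4 E5 !addrK signzD expr1z mulrN1 !scaleNr !scalerBr !opprK.
set a := msum _ _ _ _; set b := (_ *: msum _ _ _ _).
set c := msum _ _ _ _; set d := (_ *: msum _ _ _ _).
have -> : c - a + (b - d) = (c - d) - (a - b).
  by rewrite opprB addrACA [RHS]addrACA [- a - d]addrC.
move: (a - b) (c - d) => y x.
by rewrite opprB opprD !addrA subrK opprB addrC addrA subrK.
Qed.

Theorem borcherds_identity m k n v :
  msum n (- m - 1 - n) k v
  - (-1) ^ n *: msum n (k - n) (- m - 1) (P12 v) = assoc_sum m k n v.
Proof.
apply/eqP; rewrite -subr_eq0 -/(jacobi_defect m k n v); apply/eqP.
have [N1 HN1] := local v; have [Q1 HQ1] := X1_bound v.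
have [M1 HM1] := local (P23 v); have [Q2 HQ2] := X2_bound12 (P12 v).
(* Beyond N the inner exponent - n - 1 - t of the associativity term drops below Q1; beyond M the
   inner exponent - m - 1 - t of the exchanged product drops below Q2. In both cases the remaining
   two terms cancel. *)
pose N := (N1 + absz Q1)%N; pose M := (M1 + absz Q2)%N.
(* Locality handles large n, weak associativity large m; the recursion increases
   m + n. *)
have D_N m' k' n' : N%:Z <= n' -> jacobi_defect m' k' n' v = 0.
  case: n' => // n' nN; have nN1 : (N1 <= n')%N by move: nN; rewrite /N; lia.
  rewrite /jacobi_defect /assoc_sum (nsumE (J := 0%N)) => [|t _]; last first.
    by rewrite /assoc_term HQ1 ?map0 //; move: nN; rewrite /N; lia.
  rewrite big_ord0 subr0 (HN1 n' nN1 (- m' - 1) k').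
  by rewrite -exprnP subrr.
have D_M m' k' n' : M%:Z <= m' -> jacobi_defect m' k' n' v = 0.
  case: m' => // m' mM; have mM1 : (M1 <= m')%N by move: mM; rewrite /M; lia.
  rewrite /jacobi_defect (weak_associativity k' n' (HM1 m' mM1)).
  rewrite /modes_sum (nsumE (J := 0%N)) => [|t _]; last first.
    by rewrite /modes_term HQ2 ?map0 ?scaler0 //; move: mM; rewrite /M; lia.
  by rewrite big_ord0 scaler0 subr0 subrr.
have [d] : exists d : nat, N%:Z + M%:Z - (m + n) <= d%:Z.
  by exists (absz (N%:Z + M%:Z - (m + n))%R); lia.
elim: d m k n => [|d IHd] m k n mn.
  have [nN|mM] : N%:Z <= n \/ M%:Z <= m by lia.
    exact: D_N.
  exact: D_M.
rewrite jacobi_defect_rec !IHd ?subr0 //; lia.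
Qed.
End Borcherds.

(** * The Jacobi identity *)

Section LogFactor.
Variables (K : numFieldType) (V V2 V3 : lmodType K).
Variables (Y : int -> nat -> Hom V2 V) (Z : int -> nat -> Hom V3 V2).
(** To be used with (A, B, C) = (S12, S13, S23) for Y(I (x) Y) and (S13, S23, S12) for Y(Y (x) I); D
    is the remaining part of the twist. *)
Variables (S : Hom V2 V2) (A B C D : Hom V3 V3).
Hypothesis Y_log : forall m k u, Y m k u = Y m 0%N (dpow (- 1 *: S) k u).
Hypothesis Z_log : forall m k v, Z m k v = Z m 0%N (dpow (- 1 *: C) k v).
Hypothesis S_Z : forall m v, S (Z m 0%N v) = Z m 0%N (A v + B v).
Hypotheses (AB : commuting A B) (AC : commuting A C) (BC : commuting B C).
Hypotheses (DA : commuting D A) (DB : commuting D B) (DC : commuting D C).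

Lemma commuting_scale (U : lmodType K) (F G : Hom U U) c d :
  commuting F G -> commuting (c *: F) (d *: G).
Proof. by move=> FG u; rewrite !homZ (mapZ F) (mapZ G) FG scale_swap. Qed.

Lemma dpow_comm (U : lmodType K) (F G : Hom U U) a b u : commuting F G ->
  dpow F a (dpow G b u) = dpow G b (dpow F a u).
Proof.
move=> FG; rewrite (dpow_intertwine (h := dpow G b) (G := F)) // => w.
by rewrite [RHS](dpow_intertwine (h := F) (G := G)).
Qed.

(* By the hexagon relation [S_Z], the exponential of - zeta S moves inside as that
   of - zeta (A + B), and A is cancelled by the twist. *)
Lemma log_factor p q a b u :
  \sum_(a' < a.+1) Y p (a - a')%N (Z q b (D (dpow (1 *: A) a' u))) =
  Y p 0%N (Z q 0%N (D (dpow (- 1 *: C) b (dpow (- 1 *: B) a u)))).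
Proof.
have sum_Z k w : dpow (-1 *: S) k (Z q 0%N w) = Z q 0%N (dpow (-1 *: (A + B)) k w).
  apply/esym/(dpow_intertwine (h := Z q 0%N)) => x.
  by rewrite !homZ homD (mapZ (Z q _)) S_Z.
have ABC : commuting (-1 *: (A + B)) (-1 *: C).
  by apply: commuting_scale => x; rewrite !homD AC BC (mapD C).
have DAB k x : dpow (-1 *: (A + B)) k (D x) = D (dpow (-1 *: (A + B)) k x).
  apply/esym/(dpow_intertwine (h := D)) => w.
  by rewrite !homZ !homD (mapZ D) (mapD D) DA DB.
have DCb k x : dpow (-1 *: C) k (D x) = D (dpow (-1 *: C) k x).
  by apply/esym/(dpow_intertwine (h := D)) => w; rewrite !homZ (mapZ D) DC.
have <- : -1 *: (A + B) + 1 *: A = -1 *: B.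
  by rewrite scalerDr !scaleN1r scale1r addrAC addNr add0r.
rewrite -dpowD; last by apply: commuting_scale => x; rewrite !homD (mapD A) AB.
rewrite (linear_sum (dpow (-1 *: C) b)) (map_sum D) (map_sum (Z q 0%N)) (map_sum (Y p 0%N)).
apply: eq_bigr => a' _.
by rewrite Y_log Z_log sum_Z DCb DAB dpow_comm.
Qed.
End LogFactor.

(** * The Borcherds identity for a logarithmic vertex algebra *)

Section Instance.
Variables (K : numFieldType) (V : superspace K) (A : logVA V).
Local Notation V2 := (V ⊗ V)%type.
Local Notation V3 := (V ⊗ V ⊗ V)%type.
Local Notation S := (braid_op (braid A)).
Local Notation Y n k := (Ymap (modes A) n k).
Local Notation P := (sflip V V).
Local Notation P12 := (op12 P).
Local Notation P23 := (op23 P).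
Local Notation S12 := (op12 S).
Local Notation S23 := (op23 S).
Local Notation S13 := (op13 S).
Local Notation T := (transl A).
Local Notation X := (fun n => Y n 0%N).
Local Notation X1 := (fun n => opl (Y n 0%N)).
Local Notation X2 := (fun n => opr (Y n 0%N)).

Lemma opr_shift_null q n t (v : V3) : opr_null A q v ->
  opr_null A q (binop (shift n S12) t v) /\ opr_null A q (binop (shift n S13) t v).
Proof.
move=> Hv; split; rewrite /shift -[X in _ + X]scale1r; apply: opr_null_binop => //.
  by left.
by right.
Qed.

Lemma X2_null_bound v : exists Q : int, forall q, q < Q -> forall n t,
  X2 q (binop (shift n S12) t v) = 0 /\ X2 q (binop (shift n S13) t v) = 0.
Proof.
have [Q HQ] := opr_null_bound A v; exists Q => q /HQ Hq n t.
by have [H1 H2] := opr_shift_null n t Hq; rewrite !opr_nullE.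
Qed.

Lemma X1_null_bound v : exists Q : int, forall q, q < Q -> forall n t,
  X1 q (binop (shift n S13) t v) = 0.
Proof.
have [Q HQ] := opl_null_bound A v; exists Q => q /HQ Hq n t.
rewrite /shift -[X in _ + X]scale1r; apply: opl_nullE; exact: opl_null_binop.
Qed.

Lemma X2_bound12_inst v : exists Q : int, forall q, q < Q -> forall n t,
  X2 q (binop (shift n S12) t v) = 0.
Proof. exact: (X2_bound12 X2_null_bound). Qed.

Lemma local_homog p q a b c : parity a p -> parity b q ->
  exists N, local_at X X2 S12 P12 N (a ⊗ b ⊗ c).
Proof.
move=> ap bq; have [N HN] := locality_coef A ap bq; exists N => x y.
have E v x' y' : nsum (outer_coef A 1 0 v N%:Z x' 0 y' 0 0) =
    modes_sum X X2 S12 N%:Z (x' - N%:Z) y' v.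
  congr nsum; apply/funext => t.
  rewrite /outer_coef big_ord1 !dpow0 /modes_term (mapZ (opr _)) (mapZ (Y _ _)).
  by rewrite /shift scale1r.
by have := HN c x 0%N y 0%N; rewrite !E.
Qed.

(** The axiom gives an order for homogeneous a and b, uniform in c. Since locality persists in
    higher orders, a maximum serves any finite sum of pure tensors. *)
Lemma local_all v : exists N, forall n, (N <= n)%N -> local_at X X2 S12 P12 n v.
Proof.
pose L w := exists N, forall n, (N <= n)%N -> local_at X X2 S12 P12 n w.
have LD w w' : L w -> L w' -> L (w + w').
  move=> [N HN] [N' HN']; exists (maxn N N') => n; rewrite geq_max => /andP[n1 n2].
  by apply: (local_atD X2_bound12_inst); [apply: HN|apply: HN'].
have L0 : L 0.
  have term0 n p q t : modes_term X X2 S12 n p q 0 t = 0.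
    by rewrite /modes_term linear0 (map0 (opr _)) (map0 (Y _ _)) scaler0.
  exists 0%N => n _ x y; rewrite /modes_sum (map0 P12).
  by rewrite !(nsumE (J := 0%N)) ?big_ord0 ?scaler0 // => t _; apply: term0.
have Lhom p q a b c : parity a p -> parity b q -> L (a ⊗ b ⊗ c).
  move=> ap bq; have [N HN] := local_homog c ap bq; exists N => n Nn.
  exact: (local_at_leq X2_bound12_inst Nn HN).
suff : L v by [].
elim/tensor_ind: v => [//|x c v Lv]; apply: (LD) => //.
elim/tensor_ind: x => [|a b x Lx]; first by rewrite tpure0l.
rewrite tpureDl; apply: (LD) => //; rewrite -(part_sum a) -(part_sum b).
rewrite !(tpureDl, tpureDr).
by apply: (LD); apply: (LD); apply: Lhom; apply: parity_part.
Qed.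

Lemma X_bound_inst u : exists Q : int, forall q, q < Q -> X q u = 0.
Proof. by have [Q HQ] := Y_bound A u; exists Q => q /HQ. Qed.

Lemma X_skew_all m u : exists H0 : nat, forall H, (H0 <= H)%N ->
  X m u = \sum_(h < H) (-1) ^ (m - h%:Z) *: dpow T h (X (m - h%:Z) (P u)).
Proof.
apply: (skew (X := X) (X2 := X2) (S12 := S12) (P12 := P12) (ins := ins A)
  (T_Y A) (S_T2 A) X_bound_inst (S12_ins A) (P12_ins A)) => [q w q0|q w|w].
- by apply: opr_ins_eq0; rewrite q0.
- exact: opr_ins.
- exact: local_all.
Qed.

(** Skew symmetry holds for all large bounds without naming one; this carries it over to any bound
    beyond which the terms vanish. *)
Lemma sum_trunc (U : zmodType) (F : nat -> U) x H :
  (exists H0, forall H', (H0 <= H')%N -> x = \sum_(h < H') F h) ->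
  (forall h, (H <= h)%N -> F h = 0) -> x = \sum_(h < H) F h.
Proof.
move=> [H0 HH0] FH; rewrite (HH0 (maxn H0 H)) ?leq_maxl //.
rewrite -!(big_mkord xpredT F) (big_cat_nat (n := H)) ?leq_maxr //=.
rewrite [X in _ + X]big1_seq ?addr0 // => h /=; rewrite mem_index_iota => /andP[Hh _].
exact: FH.
Qed.

Lemma X_skew_inst m u H : (forall h, (H <= h)%N -> X (m - h%:Z) (P u) = 0) ->
  X m u = \sum_(h < H) (-1) ^ (m - h%:Z) *: dpow T h (X (m - h%:Z) (P u)).
Proof.
move=> XH; apply: (@sum_trunc _ (fun h => (-1) ^ (m - h%:Z) *:
  dpow T h (X (m - h%:Z) (P u))) _ H) (X_skew_all m u) _ => h /XH ->.
by rewrite linear0 scaler0.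
Qed.

Lemma X2_skew_all m v : exists H0 : nat, forall H, (H0 <= H)%N ->
  X2 m v = \sum_(h < H) (-1) ^ (m - h%:Z) *: dpow (T2 A) h (X2 (m - h%:Z) (P23 v)).
Proof.
pose R w := exists H0 : nat, forall H, (H0 <= H)%N ->
  X2 m w = \sum_(h < H) (-1) ^ (m - h%:Z) *: dpow (T2 A) h (X2 (m - h%:Z) (P23 w)).
have RD w w' : R w -> R w' -> R (w + w').
  move=> [N HN] [N' HN']; exists (maxn N N') => n; rewrite geq_max => /andP[n1 n2].
  rewrite (mapD (opr _)) (HN n n1) (HN' n n2) -big_split; apply: eq_bigr => h _.
  by rewrite (mapD P23) (mapD (opr _)) dpowDr scalerDr.
suff : R v by [].
elim/tensor_ind: v => [|x c v Rv].
  exists 0%N => H _; rewrite (map0 (opr _)) big1 // => h _.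
  by rewrite (map0 P23) (map0 (opr _)) linear0 scaler0.
apply: (RD) => //; elim/tensor_ind: x => [|a b x Rx].
  exists 0%N => H _; rewrite tpure0l (map0 (opr _)) big1 // => h _.
  by rewrite (map0 P23) (map0 (opr _)) linear0 scaler0.
rewrite tpureDl; apply: (RD) => //.
have [N HN] := X_skew_all m (b ⊗ c); exists N => H NH.
rewrite (oprE _ _ _ (Y_even A m 0)) (HN H NH).
rewrite (big_morph _ (@tpureDr K V V a) (@tpure0r K V V a)); apply: eq_bigr => h _.
rewrite tpureZr -dpow_T2; congr (_ *: dpow _ _ _).
rewrite (op23E _ _ _ (@sflip_even K V V)) opr_assoc assocVK stensorE //.
exact: Y_even.
Qed.

Lemma X2_skew_inst m v H : (forall h, (H <= h)%N -> X2 (m - h%:Z) (P23 v) = 0) ->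
  X2 m v = \sum_(h < H) (-1) ^ (m - h%:Z) *: dpow (T2 A) h (X2 (m - h%:Z) (P23 v)).
Proof.
move=> XH; apply: (@sum_trunc _ (fun h => (-1) ^ (m - h%:Z) *:
  dpow (T2 A) h (X2 (m - h%:Z) (P23 v))) _ H) (X2_skew_all m v) _ => h /XH ->.
by rewrite linear0 scaler0.
Qed.

Lemma borcherds_logVA m k n v :
  modes_sum X X2 S12 n (- m - 1 - n) k v
  - (-1) ^ n *: modes_sum X X2 S12 n (k - n) (- m - 1) (P12 v) =
  assoc_sum X X1 S13 m k n v.
Proof.
apply: (borcherds_identity (S := S) (P := P) (P23 := P23) (T := T) (T2 := T2 A)).
- exact: X_bound_inst.
- exact: X1_null_bound.
- exact: X2_null_bound.
- exact: T_Y.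
- exact: S_T2.
- exact: X_skew_inst.
- exact: X2_skew_inst.
- by move=> q w; apply: flip_opl.
- by move=> q w; apply: S_opr.
- exact: S12_S13.
- by move=> w; rewrite S12_P12.
- by move=> w; rewrite S13_P23.
- by move=> w; rewrite S12_P23.
- exact: local_all.
Qed.

Lemma opl_log m k v : opl (Y m k) v = opl (Y m 0) (dpow (-1 *: S12) k v).
Proof.
elim/tensor_ind: v => [|x c v IHv]; first by rewrite (linear0 (dpow _ _)) !(map0 (opl _)).
rewrite dpowDr !(mapD (opl _)) IHv; congr (_ + _).
have -> : dpow (-1 *: S12) k (x ⊗ c) = dpow (-1 *: S) k x ⊗ c.
  elim: k {IHv} => [//|k IHk].
  by rewrite !dpowSE IHk !homZ op12E !tpureZl.
by rewrite !oplE Y_dpow.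
Qed.

Lemma opr_log m k v : opr (Y m k) v = opr (Y m 0) (dpow (-1 *: S23) k v).
Proof.
elim/tensor_ind: v => [|x c v IHv]; first by rewrite (linear0 (dpow _ _)) !(map0 (opr _)).
rewrite dpowDr !(mapD (opr _)) IHv; congr (_ + _).
elim/tensor_ind: x => [|a b x IHx].
  by rewrite tpure0l (linear0 (dpow _ _)) !(map0 (opr _)).
rewrite tpureDl dpowDr !(mapD (opr _)) IHx; congr (_ + _).
have E u : dpow (-1 *: S23) k (assocV V V V (a ⊗ u)) =
    assocV V V V (a ⊗ dpow (-1 *: S) k u).
  elim: k {IHv IHx} => [//|k IHk]; rewrite !dpowSE IHk !homZ op23_opr opr_assoc assocVK.
  rewrite stensorE; last exact: braid_even.
  by rewrite !tpureZr !(mapZ (assocV _ _ _)).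
rewrite -assocVE E opr_assoc assocVK stensorE; last exact: Y_even.
rewrite opr_assoc assocVK stensorE; last exact: Y_even.
by rewrite Y_dpow.
Qed.
End Instance.

Section Jacobi.
Variables (K : numFieldType) (V : superspace K) (A : logVA V).
Local Notation V2 := (V ⊗ V)%type.
Local Notation V3 := (V ⊗ V ⊗ V)%type.
Local Notation S := (braid_op (braid A)).
Local Notation Y n k := (Ymap (modes A) n k).
Local Notation P12 := (op12 (sflip V V)).
Local Notation S12 := (op12 S).
Local Notation S23 := (op23 S).
Local Notation S13 := (op13 S).
Local Notation X := (fun n => Y n 0%N).
Local Notation X1 := (fun n => opl (Y n 0%N)).
Local Notation X2 := (fun n => opr (Y n 0%N)).

(** The coefficient of zeta_1^a zeta_2^b zeta_3^c in exp (- zeta_1 S13 - zeta_2 S23 - zeta_3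
    S12). *)
Definition log_twist a b c v : V3 :=
  dpow (-1 *: S23) b (dpow (-1 *: S13) a (dpow (-1 *: S12) c v)).

Lemma binop_commuting (U : lmodType K) (F G : Hom U U) t : commuting F G ->
  forall u, binop F t (G u) = G (binop F t u).
Proof.
move=> FG u; apply/esym/(binop_intertwine (h := G)) => w; exact/esym/FG.
Qed.

Lemma commuting_shiftl (U : lmodType K) n (F G : Hom U U) c : commuting F G ->
  commuting (n%:~R *: id_hom U + c *: F) G.
Proof. by move=> FG u; rewrite !homD !homZ mapD !(mapZ G) FG. Qed.

Lemma outer_modes v n x a y b c t : outer_coef A 1 (-1) v n x a y b c t =
  modes_term X X2 S12 n (x - n) y (log_twist a b c v) t.
Proof.
pose F := n%:~R *: id_hom V3 + 1 *: S12.
pose D : Hom V3 V3 := ((-1) ^+ t *: ((binop F t : {linear V3 -> V3}) : Hom V3 V3)).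
have DE w : D w = (-1) ^+ t *: binop F t w by [].
have S12_12 : commuting S12 S12 by [].
have cD G : commuting S12 G -> commuting D G.
  move=> SG w; rewrite !DE (binop_commuting _ (commuting_shiftl _ _ SG)) (mapZ G).
  by [].
rewrite /outer_coef.
transitivity (\sum_(a' < a.+1) Y (x - n + t%:Z) (a - a') (opr (Y (y - t%:Z) b)
    (D (dpow (1 *: S12) a' (dpow (-1 *: S12) c v))))).
  by apply: eq_bigr.
rewrite (log_factor (Y := fun m k => Y m k) (Z := fun m k => opr (Y m k))
  (@Y_dpow K V A) (@opr_log K V A) (@S_opr K V A) (@S12_S13 K V A)
  (@S12_S23 K V A) (@S13_S23 K V A)); [|exact/cD|exact/cD/S12_S13|exact/cD/S12_S23].
rewrite DE (mapZ (opr _)) (mapZ (Y _ _)) /modes_term /F /shift scale1r.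
by [].
Qed.

(** By upper negation (-1)^t C(x + t - S13, t) = C(- x - 1 + S13, t), which turns the powers of z_13
    into the series of (1 + z_3 / z_2)^(m + S13) with m = - x - 1. *)
Lemma inner_modes v x a z c y b t : inner_coef A (-1) 1 v x a z c y b t =
  assoc_term X X1 S13 (- x - 1) y (- z - 1) (log_twist a b c v) t.
Proof.
pose F := (x + t%:Z)%:~R *: id_hom V3 + (-1) *: S13.
pose D : Hom V3 V3 := ((-1) ^+ t *:
  ((binop F t \o dpow (-1 *: S13) a : {linear V3 -> V3}) : Hom V3 V3)).
have DE w : D w = (-1) ^+ t *: binop F t (dpow (-1 *: S13) a w) by [].
have S13_13 : commuting S13 S13 by [].
have S13_12 : commuting S13 S12 by move=> w; rewrite S12_S13.
have S23_12 : commuting S23 S12 by move=> w; rewrite S12_S23.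
have cD G : commuting S13 G -> commuting D G.
  move=> SG w; rewrite !DE -[in LHS](dpow_intertwine (h := G) (F := -1 *: S13)).
    by rewrite (binop_commuting _ (commuting_shiftl _ _ SG)) (mapZ G).
  by move=> u; rewrite !homZ (mapZ G) SG.
rewrite /inner_coef.
transitivity (\sum_(b' < b.+1) Y (y + x + t%:Z + 1) (b - b') (opl (Y (z - t%:Z) c)
    (D (dpow (1 *: S13) b' v)))).
  by apply: eq_bigr.
rewrite (log_factor (Y := fun m k => Y m k) (Z := fun m k => opl (Y m k))
  (@Y_dpow K V A) (@opl_log K V A) (@S_opl K V A) (@S13_S23 K V A)
  S13_12 S23_12); [|exact/cD|exact/cD/S13_S23|exact/cD].
rewrite DE.
have -> : dpow (-1 *: S13) a (dpow (-1 *: S12) c (dpow (-1 *: S23) b v)) = log_twist a b c v.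
  rewrite (dpow_comm (F := -1 *: S12) (G := -1 *: S23)); last first.
    by apply: commuting_scale => w; rewrite S12_S23.
  by apply: dpow_comm; apply: commuting_scale => w; rewrite S13_S23.
rewrite /assoc_term.
have -> : F = shift (t%:Z - 1) (- shift (- x - 1) S13).
  apply: homP => w; rewrite [RHS]shiftE.
  rewrite -[(- shift (- x - 1) S13) w]/(- (shift (- x - 1) S13 w)) [in RHS]shiftE.
  rewrite opprD addrA -scalerBl -intrB /F homD !homZ scaleN1r.
  by congr (_%:~R *: _ - _); ring.
rewrite binop_upper_neg scalerA signr_nat scale1r.
by congr (Y _ _ (opl (Y _ _) _)); ring.
Qed.

(** Exchanging z_1 and z_2 exchanges S13 and S23, so the second term carries the same logarithmic
    factor as the first. *)
Lemma log_twist_P12 a b c v : log_twist b a c (P12 v) = P12 (log_twist a b c v).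
Proof.
have comm12 w : P12 ((-1 *: S12) w) = (-1 *: S12) (P12 w).
  by rewrite !homZ (mapZ P12) S12_P12.
have comm13 w : P12 ((-1 *: S13) w) = (-1 *: S23) (P12 w).
  by rewrite !homZ (mapZ P12) S23_P12.
have comm23 w : P12 ((-1 *: S23) w) = (-1 *: S13) (P12 w).
  by rewrite !homZ (mapZ P12) S13_P12.
rewrite /log_twist (dpow_intertwine (h := P12) (G := -1 *: S13)) //.
rewrite (dpow_intertwine (h := P12) (G := -1 *: S23)) //.
rewrite (dpow_intertwine (h := P12) (G := -1 *: S12)) //.
by apply: dpow_comm; apply: commuting_scale => w; rewrite S13_S23.
Qed.

Theorem jacobi v (e : expo) :
  fcomp (Y_IY (modes A) z1 z2) (delta S12 (zvar K z3) (iota_gt K z1 z2)) e v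
  - fcomp (Y_IY (modes A) z2 z1) (delta S12 (zvar K z3) (iota_lt K z1 z2)) e
      (P12 v)
  = fcomp (Y_YI (modes A) z2 z3) (delta S13 (iota_gt K z1 z3) (zvar K z2)) e v.
Proof.
have d12 : z1 != z2 by []. have d13 : z1 != z3 by []. have d23 : z2 != z3 by [].
have d21 : z2 != z1 by []. have d32 : z3 != z2 by [].
rewrite (texpo_eta d12 d13 d23 e).
move: (e z1).1 (e z1).2 (e z2).1 (e z2).2 (e z3).1 (e z3).2 => x a y b z c {e}.
(* The exponent of z_3 in delta(z_3, z_12) is - n - 1, so z selects the power z_12^n. *)
pose n := - z - 1; have zE : z = - n - 1 by rewrite /n; ring.
have g1 m (e : expo) : zdiff_pow K z1 z2 m e = 1 * zdiff_pow K z1 z2 m e.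
  by rewrite mul1r.
have g3 m (e : expo) : zdiff_pow K z1 z3 m e = 1 * zdiff_pow K z1 z3 m e.
  by rewrite mul1r.
have -> : fcomp (Y_IY (modes A) z1 z2) (delta S12 (zvar K z3) (iota_gt K z1 z2))
    (texpo z1 z2 z3 x a y b z c) v =
    modes_sum X X2 S12 n (x - n) y (log_twist a b c v).
  rewrite /delta zE (_ : (fun e => var_log _ e - var_log _ e) =
    log_series z1 z2 z3 1 (-1)); last first.
    by apply/funext => e; rewrite /log_series mul1r mulN1r.
  have fE := delta_scalarl d12 d13 d23 g1 (n := n).
  rewrite (fcomp_Y_IY A d12 d13 d23 1 (-1) v (delta_scalar_supp d12 d13 d23 g1 fE)
    (delta_scalar_coef d12 d13 d23 g1 fE)) scale1r.
  by congr nsum; apply/funext => t; apply: outer_modes.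
have -> : fcomp (Y_IY (modes A) z2 z1) (delta S12 (zvar K z3) (iota_lt K z1 z2))
    (texpo z1 z2 z3 x a y b z c) (P12 v) =
    (-1) ^ n *: modes_sum X X2 S12 n (y - n) x (P12 (log_twist a b c v)).
  rewrite /delta zE texpo_swap (_ : (fun e => var_log _ e - var_log _ e) =
    log_series z2 z1 z3 1 (-1)); last first.
    by apply/funext => e; rewrite /log_series mul1r mulN1r.
  (* The sign of z_12^m = (-1)^m z_21^m becomes the (-1)^n of the Borcherds identity. *)
  pose g m : fscalar K := fun e => (-1) ^ m * zdiff_pow K z2 z1 m e.
  have g2 m e : g m e = (-1) ^ m * zdiff_pow K z2 z1 m e by [].
  have fE := delta_scalarl d21 d23 d13 g2 (n := n).
  rewrite (fcomp_Y_IY A d21 d23 d13 1 (-1) (P12 v) (delta_scalar_supp d21 d23 d13 g2 fE)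
    (delta_scalar_coef d21 d23 d13 g2 fE)) -log_twist_P12.
  by congr (_ *: nsum _); apply/funext => t; apply: outer_modes.
have -> : fcomp (Y_YI (modes A) z2 z3) (delta S13 (iota_gt K z1 z3) (zvar K z2))
    (texpo z1 z2 z3 x a y b z c) v =
    assoc_sum X X1 S13 (- x - 1) y n (log_twist a b c v).
  rewrite /delta (_ : (fun e => var_log _ e - var_log _ e) =
    log_series z1 z3 z2 (-1) 1); last first.
    by apply/funext => e; rewrite /log_series mul1r mulN1r addrC.
  have fE m := delta_scalarr d13 d12 d32 g3 (n := m).
  have coef m l := delta_scalar_coef d13 d12 d32 g3 (fE m) l.
  have {}coef m (l : nat) := etrans (coef m l) (mul1r _).
  rewrite (_ : texpo _ _ _ _ _ _ _ _ _ = texpo z1 z3 z2 x a z c y b); last first.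
    by rewrite /texpo -!addrA [mono z2 _ _ + _]addrC.
  rewrite (fcomp_Y_YI A d13 d12 d32 (-1) 1 v
    (fun m => delta_scalar_supp d13 d12 d32 g3 (fE m)) coef).
  by congr nsum; apply/funext => t; apply: inner_modes.
have := borcherds_logVA A (- x - 1) y n (log_twist a b c v).
have -> : - (- x - 1) - 1 - n = x - n by ring.
by have -> : - (- x - 1) - 1 = x by ring.
Qed.
End Jacobi.

Theorem proposition3p30 (R : realType) (V : superspace R[i]) (A : logVA V)
    (v : (V ⊗ V ⊗ V)%type) (e : expo) :
  let S := braid_op (braid A) in
  let Y := modes A in
  fcomp (Y_IY Y z1 z2)
    (delta (op12 S) (zvar R[i] z3) (iota_gt R[i] z1 z2)) e v
  - fcomp (Y_IY Y z2 z1)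
      (delta (op12 S) (zvar R[i] z3) (iota_lt R[i] z1 z2)) e
      (opl (sflip V V) v)
  = fcomp (Y_YI Y z2 z3)
      (delta (op13 S) (iota_gt R[i] z1 z3) (zvar R[i] z2)) e v.
Proof. exact: (jacobi A v e). Qed.
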